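(* Let $\mathcal{M}$ be a finite-dimensional smooth manifold equipped with a smooth affine connection $\nabla$ and a retraction $\mathrm{R}$, and let $f,h_1,\dots,h_l,g_1,\dots,g_m:\mathcal{M}\to\mathbb{R}$ be smooth. Consider the problem of minimizing $f(x)$ over $x\in\mathcal{M}$ subject to $h_i(x)=0$ ($i\in\mathcal{E}:=\{1,\dots,l\}$) and $g_j(x)\le 0$ ($j\in\mathcal{I}:=\{1,\dots,m\}$). Let $w^\star=(x^\star,y^\star,z^\star,s^\star)\in\mathcal{K}:=\mathcal{M}\times\mathbb{R}^l\times\mathbb{R}^m\times\mathbb{R}^m$ be a KKT point of this problem with $s^\star=-g(x^\star)$, and let $\mathcal{A}:=\{j\in\mathcal{I}\mid g_j(x^\star)=0\}$. Assume: 1. (LICQ) the covectors $\{\mathrm{D}h_i(x^\star)\}_{i\in\mathcal{E}}\cup\{\mathrm{D}g_j(x^\star)\}_{j\in\mathcal{A}}$ are linearly independent in $\mathrm{T}^*_{x^\star}\mathcal{M}$; 2. (Strict complementarity) $z^\star_j>0$ for all $j\in\mathcal{A}$; 3. (SOSC) $H(x^\star,y^\star,z^\star)[\xi,\xi]>0$ for every nonzero $\xi\in\mathrm{T}_{x^\star}\mathcal{M}$ satisfying $\mathrm{D}h_i(x^\star)[\xi]=0$ for all $i\in\mathcal{E}$ and $\mathrm{D}g_j(x^\star)[\xi]=0$ for all $j\in\mathcal{A}$. Let $\zeta_\mu$ ($\mu\ge 0$) be the KKT vector field and $J_{\zeta_\mu}$ its Jacobian, as defined in the context. Then: (i) The linear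 map $J_{\zeta_0}(w^\star)$ is nonsingular. (ii) Consequently, for each fixed sufficiently small $\mu\ge 0$, the Newton iteration $$J_{\zeta_\mu}(w_k)\,\xi_k=-\zeta_\mu(w_k),\qquad w_{k+1}=\mathrm{R}_{w_k}(\xi_k),$$ exhibits local superlinear convergence: there are a zero $w_\mu$ of $\zeta_\mu$ near $w^\star$ and a neighborhood of $w_\mu$ such that, for every starting point in this neighborhood, the iteration is well defined and converges superlinearly to $w_\mu$. (iii) Consider the iteration with varying parameters $\mu_k\ge 0$, $$J_{\zeta_{\mu_k}}(w_k)\,\xi_k=-\zeta_{\mu_k}(w_k),\qquad w_{k+1}=\mathrm{R}_{w_k}(\xi_k),$$ started at $w_0$ sufficiently close to $w^\star$. If $\mu_k=o(\|\zeta_0(w_k)\|)$, then $\{w_k\}$ converges superlinearly to $w^\star$. If $\mu_k=\mathcal{O}(\|\zeta_0(w_k)\|^2)$, then $\{w_k\}$ converges quadratically to $w^\star$.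
   Context: Derivatives. For smooth $\phi:\mathcal{M}\to\mathbb{R}$, $\mathrm{D}\phi(x)\in\mathrm{T}_x^*\mathcal{M}$ is its differential, with action $\mathrm{D}\phi(x)[\xi]$ on $\xi\in\mathrm{T}_x\mathcal{M}$. Given the affine connection $\nabla$ (extended to covector fields), the Hessian is the bilinear form $\mathrm{Hess}\,\phi(x)[\xi_1,\xi_2]:=(\nabla_{\xi_1}\mathrm{D}\phi)_x[\xi_2]$ on $\mathrm{T}_x\mathcal{M}$; it is also viewed as a linear map $\mathrm{T}_x\mathcal{M}\to\mathrm{T}_x^*\mathcal{M}$. Retraction. A retraction on $\mathcal{M}$ is a smooth map $\mathrm{R}:\mathrm{T}\mathcal{M}\to\mathcal{M}$, $(x,\xi)\mapsto\mathrm{R}_x(\xi)$, such that the curve $c(t)=\mathrm{R}_x(t\xi)$ satisfies $c(0)=x$ and $\dot c(0)=\xi$. On $\mathcal{K}=\mathcal{M}\times\mathbb{R}^l\times\mathbb{R}^m\times\mathbb{R}^m$ the update is $\mathrm{R}_w(\xi_x,\xi_y,\xi_z,\xi_s)=(\mathrm{R}_x(\xi_x),\,y+\xi_y,\,z+\xi_z,\,s+\xi_s)$ for $w=(x,y,z,s)$. KKT point. The Lagrangian is $\mathcal{L}(x,y,z)=f(x)+\sum_{i=1}^l y_ih_i(x)+\sum_{j=1}^m z_jg_j(x)$. The point $(x^\star,y^\star,z^\star,s^\star)$ with $s^\star=-g(x^\star)$ is a KKT point if $\mathrm{D}_x\mathcal{L}(x^\star,y^\star,z^\star)=0$, $h_i(x^\star)=0$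 for all $i$, $g_j(x^\star)\le 0$ for all $j$, $z^\star_j\ge 0$ for all $j$, and $z^\star_jg_j(x^\star)=0$ for all $j$. The Hessian of the Lagrangian is $$H(x,y,z)=\mathrm{Hess}\,f(x)+\sum_{i=1}^l y_i\,\mathrm{Hess}\,h_i(x)+\sum_{j=1}^m z_j\,\mathrm{Hess}\,g_j(x).$$ KKT vector field. Here $h=(h_1,\dots,h_l)$, $g=(g_1,\dots,g_m)$, $S=\mathrm{diag}(s)$, $Z=\mathrm{diag}(z)$, and $e\in\mathbb{R}^m$ is the all-ones vector. Define $A_E(x):\mathbb{R}^l\to\mathrm{T}_x^*\mathcal{M}$ by $A_E(x)y=\sum_i y_i\mathrm{D}h_i(x)$ and $A_I(x):\mathbb{R}^m\to\mathrm{T}_x^*\mathcal{M}$ by $A_I(x)z=\sum_j z_j\mathrm{D}g_j(x)$, with adjoints $A_E^*(x)\xi=(\mathrm{D}h_i(x)[\xi])_i$ and $A_I^*(x)\xi=(\mathrm{D}g_j(x)[\xi])_j$. For $w=(x,y,z,s)$ and $\mu\ge 0$, $$\zeta_\mu(w)=\begin{bmatrix}\mathrm{D}f(x)+A_E(x)y+A_I(x)z\\ h(x)\\ g(x)+s\\ Sz-\mu e\end{bmatrix},\qquad J_{\zeta_\mu}(w)=\begin{bmatrix}H(x,y,z)&A_E(x)&A_I(x)&0\\ A_E^*(x)&0&0&0\\ A_I^*(x)&0&0&I\\ 0&0&S&Z\end{bmatrix},$$ where $J_{\zeta_\mu}(w)$ acts on $\xi_w=(\xi_x,\xi_y,\xi_z,\xi_s)\in\mathrm{T}_x\mathcal{M}\times\mathbb{R}^l\times\mathbb{R}^m\times\mathbb{R}^m$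 and takes values in $\mathrm{T}_x^*\mathcal{M}\times\mathbb{R}^l\times\mathbb{R}^m\times\mathbb{R}^m$. Conventions. Norms and distances near $w^\star$ are taken in a fixed local chart around $w^\star$ (equivalently, with respect to any fixed auxiliary Riemannian metric); $\|w-w'\|$ denotes such a distance. A sequence $w_k\to\bar w$ converges superlinearly if $\|w_{k+1}-\bar w\|=o(\|w_k-\bar w\|)$, and quadratically if $\|w_{k+1}-\bar w\|=\mathcal{O}(\|w_k-\bar w\|^2)$. The condition $\mu_k=o(\|\zeta_0(w_k)\|)$ means $0\le\mu_k\le\theta(\|\zeta_0(w_k)\|)$ for all $k$, for a fixed function $\theta:[0,\infty)\to[0,\infty)$ with $\theta(0)=0$ and $\theta(t)/t\to0$ as $t\to0^+$. The condition $\mu_k=\mathcal{O}(\|\zeta_0(w_k)\|^2)$ means $0\le\mu_k\le C\|\zeta_0(w_k)\|^2$ for all $k$, for a fixed constant $C$. ''Sufficiently close'' may depend on $\theta$, respectively on $C$. *)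

(* Defs.v *)
(* MathComp-Analysis *)
From HB Require Import structures.
From mathcomp Require Import all_boot all_order all_algebra.
From mathcomp Require Import all_classical all_reals all_analysis.
Import Order.TTheory GRing.Theory Num.Theory.
Import numFieldNormedType.Exports.

Set Implicit Arguments.
Unset Strict Implicit.
Unset Printing Implicit Defensive.

Local Open Scope classical_set_scope.
Local Open Scope ring_scope.

Section Smooth.
Context {R : realType} {V W : normedModType R}.

(* Meant for [U] open and [V] finite-dimensional, where it is the usual C^k. *)
Fixpoint Ck_on (k : nat) (U : set V) (F : V -> W) : Prop :=
  if k is k'.+1 then
    (forall x, U x -> differentiable F x) /\
    (forall v : V, Ck_on k' U (fun x => 'D_v F x))
  else forall x, U x -> {for x, continuous F}.

Definition smooth_on (U : set V) (F : V -> W) : Prop :=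
  forall k, Ck_on k U F.

End Smooth.

(* [cmap] and [cinv] are total functions, meaningful only on [cdom] and [ccod]
   respectively. *)
Record chart (R : realType) (n : nat) (X : topologicalType) := Chart {
  cdom : set X;
  ccod : set 'rV[R]_n;
  cmap :> X -> 'rV[R]_n;
  cinv : 'rV[R]_n -> X;
  cdom_open : open cdom;
  ccod_open : open ccod;
  cmap_cod : forall x, cdom x -> ccod (cmap x);
  cinv_dom : forall u, ccod u -> cdom (cinv u);
  cmapK : forall x, cdom x -> cinv (cmap x) = x;
  cinvK : forall u, ccod u -> cmap (cinv u) = u;
  cmap_continuous : forall x, cdom x -> {for x, continuous cmap};
  cinv_continuous : forall u, ccod u -> {for u, continuous cinv}
}.

(* The atlas need not be maximal. [chart_at] only serves to choose coordinates
   on each tangent space. *)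
Record manifold (R : realType) (n : nat) := Manifold {
  carrier :> topologicalType;
  atlas : set (chart R n carrier);
  chart_at : carrier -> chart R n carrier;
  chart_at_atlas : forall x, atlas (chart_at x);
  chart_at_dom : forall x, cdom (chart_at x) x;
  atlas_smooth : forall a b, atlas a -> atlas b ->
    smooth_on [set u | ccod a u /\ cdom b (cinv a u)] (b \o cinv a);
  manifold_hausdorff : hausdorff_space carrier;
  manifold_second_countable : @second_countable carrier
}.

Section Tangent.
Context {R : realType} {n : nat} {M : manifold R n}.

(* A tangent vector at [x] is represented by its coordinates in the chart
   [chart_at x]; [transition] gives the coordinates in any other chart. *)
Definition tangent (x : M) : Type := 'rV[R]_n.
Definition cotangent (x : M) : Type := 'Hom('rV[R]_n, R^o).
HB.instance Definition _ (x : M) := NormedModule.on (tangent x).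

(* From [a]-coordinates to [b]-coordinates of tangent vectors at [x]. *)
Definition transition (a b : chart R n M) (x : M) (v : 'rV[R]_n) : 'rV[R]_n :=
  'd (b \o cinv a) (a x) v.

Definition of_coord (a : chart R n M) (x : M) (v : 'rV[R]_n) : tangent x :=
  transition a (chart_at x) x v.
Definition to_coord (a : chart R n M) (x : M) (xi : tangent x) : 'rV[R]_n :=
  transition (chart_at x) a x xi.

Definition smooth_fun_on (O : set M) (phi : M -> R) : Prop :=
  forall a, atlas a ->
    smooth_on [set u | ccod a u /\ O (cinv a u)] (phi \o cinv a : _ -> R^o).

Definition smooth_fun (phi : M -> R) : Prop := smooth_fun_on setT phi.

Definition vector_field := forall x : M, tangent x.

Definition smooth_vf_on (O : set M) (X : vector_field) : Prop :=
  forall a, atlas a ->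
    smooth_on [set u | ccod a u /\ O (cinv a u)]
              (fun u => to_coord a (X (cinv a u))).

Definition smooth_map_on (V : normedModType R) (U : set V) (F : V -> M) : Prop :=
  (forall p, U p -> {for p, continuous F}) /\
  (forall b, atlas b -> smooth_on [set p | U p /\ cdom b (F p)] (b \o F)).

Definition D (phi : M -> R) (x : M) : cotangent x :=
  linfun ('d (phi \o cinv (chart_at x) : _ -> R^o) (chart_at x x)).

End Tangent.
Arguments tangent {R n} M x.
Arguments cotangent {R n} M x.
Arguments vector_field {R n} M.

(* [nabla Y x xi] is the value at [x] of the covariant derivative of [Y] in the
   direction [xi]. Local vector fields are covered: the axioms constrain [nabla]
   at [x] only for fields that are smooth on some open set containing [x].
   Locality follows from [nabla_leibniz], applied to indicator functions. *)
Record connection (R : realType) (n : nat) (M : manifold R n) := Connection {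
  nabla : vector_field M -> forall x : M, tangent M x -> tangent M x;
  nabla_linear : forall O Y x, open O -> O x -> smooth_vf_on O Y ->
    forall (c : R) (xi eta : tangent M x),
      nabla Y (c *: xi + eta) = c *: nabla Y xi + nabla Y eta;
  nabla_add : forall O Y Z x, open O -> O x ->
    smooth_vf_on O Y -> smooth_vf_on O Z ->
    forall xi : tangent M x,
      nabla (fun y => Y y + Z y) xi = nabla Y xi + nabla Z xi;
  nabla_leibniz : forall O q Y x, open O -> O x ->
    smooth_fun_on O q -> smooth_vf_on O Y ->
    forall xi : tangent M x,
      nabla (fun y => q y *: Y y) xi = D q x xi *: Y x + q x *: nabla Y xi;
  nabla_smooth : forall O X Y, open O ->
    smooth_vf_on O X -> smooth_vf_on O Y ->
    smooth_vf_on O (fun x => nabla Y (X x))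
}.

(* [retr_smooth] is smoothness on the tangent bundle, in the bundle chart
   (u, v) |-> (cinv a u, vector with a-coordinates v). *)
Record retraction (R : realType) (n : nat) (M : manifold R n) := Retraction {
  retr : forall x : M, tangent M x -> M;
  retr_smooth : forall a, atlas a ->
    smooth_map_on [set p : 'rV[R]_n * 'rV[R]_n | ccod a p.1]
      (fun p => retr (of_coord a (cinv a p.1) p.2));
  retr_start : forall (x : M) (xi : tangent M x), retr (0%R *: xi) = x;
  retr_velocity : forall (x : M) (xi : tangent M x),
    is_derive (0 : R^o) 1 (fun t : R^o => chart_at x (retr (t *: xi))) xi
}.

Section Hessian.
Context {R : realType} {n : nat} {M : manifold R n} (nb : connection M).

(* The field with constant coordinates in [chart_at x] and value [eta] at [x]. *)
Definition extend (x : M) (eta : tangent M x) : vector_field M :=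
  fun y => of_coord (chart_at x) y eta.

(* (nabla_xi omega)[eta] = xi (omega(Y)) - omega(nabla_xi Y) for any smooth
   field [Y] near [x] with Y(x) = eta. The Leibniz rule makes the right-hand side
   independent of the choice of [Y], and linear in [eta] when [omega] is smooth,
   so that [linfun] does not alter it. *)
Definition nabla_cov (omega : forall y : M, cotangent M y) (x : M)
    (xi : tangent M x) : cotangent M x :=
  linfun (fun eta : 'rV[R]_n =>
    D (fun y => omega y (extend (eta : tangent M x) y)) x xi
    - omega x (nabla nb (extend (eta : tangent M x)) xi) : R^o).

Definition Hess (phi : M -> R) (x : M) (xi : tangent M x) : cotangent M x :=
  nabla_cov (D phi) xi.

End Hessian.

Section KKT.
Context {R : realType} {n : nat} {M : manifold R n}.
Context (nb : connection M) (Rt : retraction M) {l m : nat}.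
Context (f : M -> R) (h : 'I_l -> M -> R) (g : 'I_m -> M -> R).

Definition KK := (M * 'rV[R]_l * 'rV[R]_m * 'rV[R]_m)%type.
Definition Tangent (w : KK) :=
  (tangent M w.1.1.1 * 'rV[R]_l * 'rV[R]_m * 'rV[R]_m)%type.
Definition Cotangent (w : KK) :=
  (cotangent M w.1.1.1 * 'rV[R]_l * 'rV[R]_m * 'rV[R]_m)%type.

Definition retrK (w : KK) (xi : Tangent w) : KK :=
  (retr Rt xi.1.1.1, w.1.1.2 + xi.1.1.2, w.1.2 + xi.1.2, w.2 + xi.2).

Definition Lagrangian (x : M) (y : 'rV[R]_l) (z : 'rV[R]_m) : R :=
  f x + \sum_i y 0 i * h i x + \sum_j z 0 j * g j x.

Definition KKT_point (w : KK) : Prop :=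
  let: (x, y, z, s) := w in
  [/\ D (fun x' => Lagrangian x' y z) x = 0,
      forall i, h i x = 0,
      forall j, g j x <= 0,
      forall j, 0 <= z 0 j &
      forall j, z 0 j * g j x = 0]
  /\ s = - (\row_j g j x).

Definition active (x : M) : {set 'I_m} := [set j | g j x == 0].

Definition LICQ (x : M) : Prop :=
  free ([seq (D (h i) x : 'Hom(_, _)) | i : 'I_l] ++
        [seq (D (g j) x : 'Hom(_, _)) | j in active x]).

Definition HessL (x : M) (y : 'rV[R]_l) (z : 'rV[R]_m) (xi : tangent M x) :
    cotangent M x :=
  Hess nb f xi + \sum_i y 0 i *: Hess nb (h i) xi
               + \sum_j z 0 j *: Hess nb (g j) xi.

Definition strict_complementarity (w : KK) : Prop :=
  forall j, j \in active w.1.1.1 -> 0 < w.1.2 0 j.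

Definition SOSC (w : KK) : Prop :=
  let: (x, y, z, s) := w in
  forall xi : tangent M x, xi != 0 ->
    (forall i, D (h i) x xi = 0) ->
    (forall j, j \in active x -> D (g j) x xi = 0) ->
    0 < HessL y z xi xi.

Definition AE (x : M) (y : 'rV[R]_l) : cotangent M x :=
  \sum_i y 0 i *: D (h i) x.
Definition AI (x : M) (z : 'rV[R]_m) : cotangent M x :=
  \sum_j z 0 j *: D (g j) x.
Definition AE_adj (x : M) (xi : tangent M x) : 'rV[R]_l := \row_i D (h i) x xi.
Definition AI_adj (x : M) (xi : tangent M x) : 'rV[R]_m := \row_j D (g j) x xi.

Definition zeta (mu : R) (w : KK) : Cotangent w :=
  let x := w.1.1.1 in let y := w.1.1.2 in let z := w.1.2 in let s := w.2 in
  (D f x + AE x y + AI x z,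
   \row_i h i x,
   \row_j g j x + s,
   z *m diag_mx s - const_mx mu).

(* It does not depend on [mu]. *)
Definition Jzeta (w : KK) (xi : Tangent w) : Cotangent w :=
  let x := w.1.1.1 in let y := w.1.1.2 in let z := w.1.2 in let s := w.2 in
  let xix := xi.1.1.1 in let xiy := xi.1.1.2 in
  let xiz := xi.1.2 in let xis := xi.2 in
  (HessL y z xix + AE x xiy + AI x xiz,
   AE_adj xix,
   AI_adj xix + xis,
   xiz *m diag_mx s + xis *m diag_mx z).

Definition newton_step (mu : R) (w w' : KK) : Prop :=
  exists xi : Tangent w, Jzeta xi = - zeta mu w /\ w' = retrK xi.

Section Local.
Variable a : chart R n M.

Definition Kcoord (w : KK) : 'rV[R]_n * 'rV[R]_l * 'rV[R]_m * 'rV[R]_m :=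
  (a w.1.1.1, w.1.1.2, w.1.2, w.2).
Definition dist (w w' : KK) : R := `|Kcoord w - Kcoord w'|.

(* The components of [eta] on the basis of coordinate vectors of [a] at [x]. *)
Definition cov_coord (x : M) (eta : cotangent M x) : 'rV[R]_n :=
  \row_i eta (of_coord a x (delta_mx 0 i)).
Definition zeta_norm (mu : R) (w : KK) : R :=
  let v := zeta mu w in
  `|((cov_coord v.1.1.1, v.1.1.2, v.1.2, v.2) :
     'rV[R]_n * 'rV[R]_l * 'rV[R]_m * 'rV[R]_m)|.

Definition converges_superlinearly (w : nat -> KK) (wbar : KK) : Prop :=
  [/\ cdom a wbar.1.1.1, w @ \oo --> wbar &
      (fun k => dist (w k.+1) wbar : R^o) =o_\oo
      (fun k => dist (w k) wbar : R^o)].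

Definition converges_quadratically (w : nat -> KK) (wbar : KK) : Prop :=
  [/\ cdom a wbar.1.1.1, w @ \oo --> wbar &
      (fun k => dist (w k.+1) wbar : R^o) =O_\oo
      (fun k => dist (w k) wbar ^+ 2 : R^o)].

Definition step_bounded (B : R -> R) (mu : nat -> R) (w : nat -> KK) (k : nat) :
    Prop :=
  0 <= mu k <= B (zeta_norm 0 (w k)) /\ newton_step (mu k) (w k) (w k.+1).

(* The first clause is well-definedness: any run of [k] steps can be continued
   by a uniquely determined step, whatever the next parameter. *)
Definition locally_convergent (B : R -> R) (wbar : KK)
    (cvg_mode : (nat -> KK) -> KK -> Prop) : Prop :=
  \forall w0 \near wbar, forall (mu : nat -> R) (w : nat -> KK), w 0%N = w0 ->
    (forall k, (forall i, (i < k)%N -> step_bounded B mu w i) ->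
       bijective (Jzeta (w := w k)))
    /\ ((forall k, step_bounded B mu w k) -> cvg_mode w wbar).

End Local.
End KKT.
Arguments KK {R n} M l m.
Arguments Jzeta {R n M} nb {l m} f h g w xi.

(* Main.v *)
(* At a KKT point, evaluating the first block of J xi = 0 at xi_x kills all terms
   but the Hessian one, by complementarity; SOSC then gives xi_x = 0 and LICQ the
   rest, so J is nonsingular.

   In a chart, J differs from the derivative of zeta by a Christoffel term bounded
   by the first block of zeta, hence by the distance to any zero wb of zeta_nu, and
   the retraction is R(u, v) = u + v + O(|v|^2). One Newton step with parameter mu
   therefore satisfies |w' - wb| <= K (|w - wb|^2 + |mu - nu|), with K uniform for
   w and wb near w*. Taking nu = mu gives (ii), taking wb = w* and nu = 0 gives
   (iii). *)
From HB Require Import structures.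
Require Import Defs.
From mathcomp Require Import all_boot all_order all_algebra.
From mathcomp Require Import all_classical all_reals all_analysis.
From mathcomp Require Import ring lra.
Import Order.TTheory GRing.Theory Num.Theory.
Import numFieldNormedType.Exports.

Set Implicit Arguments.
Unset Strict Implicit.
Unset Printing Implicit Defensive.

Local Open Scope classical_set_scope.
Local Open Scope ring_scope.

(** * Maps of class C^k *)

(** The parameter enters [zeta] only as a constant in the last block. In a chart all [zeta mu]
    therefore share one map [zetaC], and a zero for [mu] is a preimage of the vector [muC mu]. The
    covector block does not contain [mu], so it vanishes at the zeros for every parameter; this is
    why a single estimate serves both a fixed and a varying parameter. Existence of the perturbed
    zeros in (ii) is obtained from compactness of balls instead of an inverse function theorem.
    Tangent spaces vary with the base point, so every estimate is made in one fixed chart; the price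
    is that the chart means nothing outside its domain, and each Newton step must also be shown to
    remain inside. *)

Section Germs.
Context {R : realType} {V W : normedModType R}.
Implicit Types (f g : V -> W) (x v : V).

Lemma near_eq_diff f g x : (\near x, f x = g x) -> differentiable f x ->
  differentiable g x /\ 'd g x = 'd f x :> (V -> W).
Proof.
move=> fg df; have [dfc dfE] := (diff_locallyP x f).1 df.
have gE : g \o shift x = cst (g x) + 'd f x +o_ 0 id.
  apply/eqaddoP => e e0.
  have /eqaddoP/(_ e e0) := dfE.
  have fgs : \forall h \near (0 : V), f (h + x) = g (h + x).
    by move: fg; rewrite (near_shift 0 x)/=; apply: filterS => h /=; rewrite subr0.
  apply: filter_app; near=> h.
  rewrite /= -(nbhs_singleton fg).
  rewrite -![(_ + _ : _ -> _) _]/(_ + _) -![(- _ : _ -> _) _]/(- _) /=.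
  by rewrite -[g (h + x)](near fgs h).
have dgE := diff_unique dfc gE.
split; last exact: dgE.
by apply/diff_locallyP; rewrite dgE; split; [exact: dfc|exact: gE].
Unshelve. all: by end_near. Qed.

Lemma near_eq_differentiable f g x : (\near x, f x = g x) ->
  differentiable f x -> differentiable g x.
Proof. by move=> fg /(near_eq_diff fg)[]. Qed.

End Germs.

(** The base point [y] is a separate variable because in the uses below it equals [f x] only
    propositionally, as [b x] and [b (cinv a (a x))] do; no rewriting under ['d] is then
    required. *)
Lemma diff_comp_at (R : realType) (U V W : normedModType R) (f : U -> V) (g : V -> W)
    x y : f x = y -> differentiable f x -> differentiable g y ->
  differentiable (g \o f) x /\ 'd (g \o f) x = 'd g y \o 'd f x :> (U -> W).
Proof.
by move=> <- df dg; split; [exact: differentiable_comp|exact: diff_comp].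
Qed.

Section CkClosure.
Context {R : realType}.
Implicit Types V W : normedModType R.

(** Openness of [U] turns equality on [U] into equality of germs, on which continuity and
    derivatives depend. Since the rules for derivatives of sums, products and composites hold only
    on [U], the inductions below go through this lemma. *)
Lemma Ck_eq V W k (U : set V) (F G : V -> W) : open U ->
  (forall x, U x -> F x = G x) -> Ck_on k U F -> Ck_on k U G.
Proof.
move=> oU; elim: k F G => [|k IH] F G FG /=.
  move=> cF x Ux; have nFG : \near x, F x = G x.
    by apply: filterS (open_nbhs_nbhs (conj oU Ux)).
  rewrite /prop_for/continuous_at -(FG _ Ux).
  by apply: cvg_trans (cF x Ux); apply: near_eq_cvg.
case=> dF DF; split=> [x Ux|v].
  apply: near_eq_differentiable (dF _ Ux).
  by apply: filterS (open_nbhs_nbhs (conj oU Ux)).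
apply: IH (DF v) => x Ux; apply: near_eq_derive.
by apply: filterS (open_nbhs_nbhs (conj oU Ux)).
Qed.

Lemma Ck_sub V W k (U U' : set V) (F : V -> W) :
  U `<=` U' -> Ck_on k U' F -> Ck_on k U F.
Proof.
move=> UU'; elim: k F => [|k IH] F /=; first by move=> cF x /UU'/cF.
by case=> dF DF; split=> [x /UU'/dF//|v]; apply: IH.
Qed.

Lemma Ck_S V W k (U : set V) (F : V -> W) : Ck_on k.+1 U F -> Ck_on k U F.
Proof.
elim: k F => [|k IH] F.
  by case=> dF _ x Ux; apply: differentiable_continuous; exact: dF.
by case=> dF DF; split=> // v; apply: IH.
Qed.

Lemma Ck_cst V W k (U : set V) (c : W) : Ck_on k U (cst c).
Proof.
elim: k c => [|k IH] c /=; first by move=> x _; exact: cvg_cst.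
split=> [x _|v]; first exact: differentiable_cst.
rewrite (_ : (fun x => _) = cst 0); first exact: IH.
by apply/funext => x; rewrite derive_cst.
Qed.

Lemma Ck_add V W k (U : set V) (F G : V -> W) : open U ->
  Ck_on k U F -> Ck_on k U G -> Ck_on k U (fun x => F x + G x).
Proof.
move=> oU; elim: k F G => [|k IH] F G /=.
  by move=> cF cG x Ux; apply: cvgD; [exact: cF|exact: cG].
move=> [dF DF] [dG DG]; split=> [x Ux|v].
  by apply: differentiableD; [exact: dF|exact: dG].
apply: (Ck_eq oU) (IH _ _ (DF v) (DG v)) => x Ux.
by rewrite (@deriveD _ _ _ F G) //; apply: diff_derivable; auto.
Qed.

Lemma Ck_mul V k (U : set V) (F G : V -> R^o) : open U ->
  Ck_on k U F -> Ck_on k U G -> Ck_on k U (fun x => F x * G x : R^o).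
Proof.
move=> oU; elim: k F G => [|k IH] F G.
  by move=> cF cG x Ux; apply: cvgM; [exact: cF|exact: cG].
move=> FC GC; move: (FC) (GC) => /= [dF DF] [dG DG]; split=> [x Ux|v].
  by apply: (@differentiableM _ _ F G); auto.
apply: (@Ck_eq _ _ _ _ (fun x => F x * 'D_v G x + G x * 'D_v F x : R^o)) => //.
  move=> x Ux; rewrite (@deriveM _ _ F G) //; apply: diff_derivable; auto.
by apply: Ck_add => //; apply: IH => //; apply: Ck_S.
Qed.

Lemma Ck_sum V W k (U : set V) N (F : 'I_N -> V -> W) : open U ->
  (forall i, Ck_on k U (F i)) -> Ck_on k U (fun x => \sum_i F i x).
Proof.
move=> oU; elim: N F => [|N IH] F FC.
  rewrite (_ : (fun _ => _) = cst 0); first exact: Ck_cst.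
  by apply/funext => x; rewrite big_ord0.
rewrite (_ : (fun _ => _) = fun x => \sum_i F (widen_ord (leqnSn N) i) x + F ord_max x).
  by apply: Ck_add => //; apply: IH.
by apply/funext => x; rewrite big_ord_recr.
Qed.

Lemma differentiable_row V p (F : V -> 'rV[R]_p) x :
  (forall i, differentiable (fun x => F x 0 i : R^o) x) -> differentiable F x.
Proof.
move=> dF.
rewrite (_ : F = \sum_i (fun x => F x 0 i *: delta_mx 0 i : 'rV[R]_p)).
  apply: differentiable_sum => i.
  exact: (@differentiableZl _ _ _ (fun x => F x 0 i : R^o)).
apply/funext => y; rewrite [LHS]row_sum_delta.
by elim/big_ind2: _ => // f1 a1 f2 a2 -> ->.
Qed.

Lemma coord_comp_differentiable V p (F : V -> 'rV[R]_p) x i :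
  differentiable F x -> differentiable (fun x => F x 0 i : R^o) x.
Proof.
by move=> dF; apply: (@differentiable_comp _ _ _ _ F (fun M : 'rV[R]_p => M 0 i : R^o)) => //;
  exact: differentiable_coord.
Qed.

Lemma derive_coord V p (F : V -> 'rV[R]_p) x v i : differentiable F x ->
  'D_v (fun x => F x 0 i : R^o) x = ('D_v F x) 0 i.
Proof. by move=> dF; rewrite derive_mx ?mxE//; exact: diff_derivable. Qed.

Lemma Ck_coord V p k (U : set V) (F : V -> 'rV[R]_p) i : open U ->
  Ck_on k U F -> Ck_on k U (fun x => F x 0 i : R^o).
Proof.
move=> oU; elim: k F => [|k IH] F /=.
  move=> cF x Ux; apply: (@continuous_comp _ _ _ F (fun M : 'rV[R]_p => M 0 i)).
    exact: cF.
  exact: coord_continuous.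
case=> dF DF; split=> [x Ux|v]; first by apply: coord_comp_differentiable; auto.
by apply: (Ck_eq oU) (IH _ (DF v)) => x Ux; rewrite derive_coord; auto.
Qed.

Lemma Ck_row V p k (U : set V) (F : V -> 'rV[R]_p) : open U ->
  (forall i, Ck_on k U (fun x => F x 0 i : R^o)) -> Ck_on k U F.
Proof.
move=> oU; elim: k F => [|k IH] F FC.
  move=> x Ux; rewrite (_ : F = fun x => \sum_i F x 0 i *: delta_mx 0 i); last first.
    by apply/funext => y; rewrite [LHS]row_sum_delta.
  rewrite /prop_for /continuous_at.
  apply: cvg_big => [|i _]; first exact: add_continuous.
  by apply: cvgZr_tmp; exact: FC.
have dF x : U x -> differentiable F x.
  by move=> Ux; apply: differentiable_row => i; case: (FC i) => + _; apply.
split=> // v; apply: IH => i.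
apply: (Ck_eq oU) ((FC i).2 v) => x Ux.
by rewrite derive_coord; auto.
Qed.

Lemma Ck_scale V p k (U : set V) (q : V -> R^o) (F : V -> 'rV[R]_p) :
  open U -> Ck_on k U q -> Ck_on k U F -> Ck_on k U (fun x => q x *: F x).
Proof.
move=> oU qC FC; apply: Ck_row => // i.
apply: (@Ck_eq _ _ _ _ (fun x => q x * F x 0 i)) => //.
  by move=> x _; rewrite mxE.
by apply: Ck_mul => //; exact: Ck_coord.
Qed.

(** The chain rule is expanded along the standard basis because [Ck_on] differentiates in fixed
    directions only, whereas ['D_v F x] varies with [x]. The induction in [Ck_comp] then meets sums
    of products of scalar functions. *)
Lemma derive_comp V p W (F : V -> 'rV[R]_p) (G : 'rV[R]_p -> W) x v :
  differentiable F x -> differentiable G (F x) ->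
  'D_v (G \o F) x = \sum_i ('D_v F x) 0 i *: 'D_(delta_mx 0 i) G (F x).
Proof.
move=> dF dG; rewrite deriveE; last exact: differentiable_comp.
rewrite diff_comp //= -(deriveE v dF) [in LHS](row_sum_delta ('D_v F x)) linear_sum.
by apply: eq_bigr => i _; rewrite (deriveE _ dG); exact: linearZ.
Qed.

Lemma Ck_comp V p k (U : set V) (U' : set 'rV[R]_p)
    (F : V -> 'rV[R]_p) (G : 'rV[R]_p -> R^o) :
  open U -> (forall x, U x -> U' (F x)) ->
  Ck_on k U F -> Ck_on k U' G -> Ck_on k U (G \o F).
Proof.
move=> oU UU'; elim: k G => [|k IH] G.
  move=> cF cG x Ux; apply: continuous_comp; first exact: cF.
  by apply: cG; apply: UU'.
move=> FC GC; move: (FC) (GC) => /= [dF DF] [dG DG]; split=> [x Ux|v].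
  by apply: differentiable_comp; auto.
apply: (@Ck_eq _ _ _ _ (fun x => \sum_i ('D_v F x) 0 i * 'D_(delta_mx 0 i) G (F x))) => //.
  by move=> x Ux; rewrite derive_comp //; auto.
apply: Ck_sum => // i; apply: Ck_mul => //.
  exact: (Ck_coord i oU (DF v)).
by apply: (IH (fun x => 'D_(delta_mx 0 i) G x)) => //; exact: Ck_S.
Qed.

End CkClosure.

(** * Second-order estimates *)

Section C2.
Context {R : realType}.
Implicit Types V W : normedModType R.

(* A [normedModType] carries no [vectType] structure: finite dimension is expressed
   by a spanning family with bounded (not necessarily linear) coordinates. *)
Definition finite_dim V : Prop :=
  exists N (e : 'I_N -> V) (c : 'I_N -> V -> R) (K : R),
    (forall v, v = \sum_i c i v *: e i) /\ forall i v, `|c i v| <= K * `|v|.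

Lemma coord_le_norm p (v : 'rV[R]_p) i : `|v 0 i| <= `|v|.
Proof.
by rewrite [leRHS]/Num.Def.normr/= mx_normrE; apply: (le_bigmax _ _ (0, i)).
Qed.

Lemma rV_norm_le p (v : 'rV[R]_p) (K : R) : 0 <= K ->
  (forall i, `|v 0 i| <= K) -> `|v| <= K.
Proof.
move=> K0 vK; rewrite [leLHS]/Num.Def.normr/= mx_normrE bigmax_le // => -[i j] _.
by rewrite ord1.
Qed.

Lemma finite_dim_rV p : finite_dim 'rV[R]_p.
Proof.
exists p, (fun i => delta_mx 0 i), (fun i (v : 'rV[R]_p) => v 0 i), 1; split=> [v|i v].
  exact: row_sum_delta.
by rewrite mul1r coord_le_norm.
Qed.

Lemma pair_norm_le V W (x : V * W) (K : R) :
  `|x.1| <= K -> `|x.2| <= K -> `|x| <= K.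
Proof. by move=> x1 x2; rewrite prod_normE ge_max x1. Qed.

Lemma fst_norm_le V W (x : V * W) : `|x.1| <= `|x|.
Proof. by rewrite prod_normE le_max lexx. Qed.

Lemma snd_norm_le V W (x : V * W) : `|x.2| <= `|x|.
Proof. by rewrite prod_normE le_max lexx orbT. Qed.

Lemma finite_dim_prod V W : finite_dim V -> finite_dim W -> finite_dim (V * W)%type.
Proof.
move=> [N1 [e1 [c1 [K1 [s1 b1]]]]] [N2 [e2 [c2 [K2 [s2 b2]]]]].
exists (N1 + N2)%N, (fun i : 'I_(N1 + N2) =>
  match fintype.split i with inl j => (e1 j, 0) | inr j => (0, e2 j) end).
exists (fun (i : 'I_(N1 + N2)) (v : V * W) =>
  match fintype.split i with inl j => c1 j v.1 | inr j => c2 j v.2 end).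
exists (Num.max (Num.max K1 K2) 0); split=> [v|i v].
  rewrite big_split_ord /=.
  under eq_bigr do rewrite (unsplitK (inl _)).
  under [X in _ + X]eq_bigr do rewrite (unsplitK (inr _)).
  case: v => v1 v2 /=; rewrite {1}(s1 v1) {1}(s2 v2).
  have -> : \sum_i c1 i v1 *: ((e1 i, 0) : V * W) = (\sum_i c1 i v1 *: e1 i, 0).
    apply: (big_rec2 (fun (x : V * W) y => x = (y, 0))) => // i y1 y2 _ ->.
    by congr pair; rewrite /= scaler0 addr0.
  have -> : \sum_i c2 i v2 *: ((0, e2 i) : V * W) = (0, \sum_i c2 i v2 *: e2 i).
    apply: (big_rec2 (fun (x : V * W) y => x = (0, y))) => // i y1 y2 _ ->.
    by congr pair; rewrite /= scaler0 addr0.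
  by congr pair; rewrite /= ?addr0 ?add0r.
set K := Num.max _ _.
have K10 : K1 <= K by rewrite /K !le_max lexx.
have K20 : K2 <= K by rewrite /K !le_max lexx orbT.
have K0 : 0 <= K by rewrite /K le_max lexx orbT.
case: (fintype.split i) => j.
  apply: le_trans (b1 _ _) _; apply: le_trans (ler_wpM2r _ K10) _ => //.
  by rewrite ler_wpM2l// fst_norm_le.
apply: le_trans (b2 _ _) _; apply: le_trans (ler_wpM2r _ K20) _ => //.
by rewrite ler_wpM2l// snd_norm_le.
Qed.

Lemma finite_dim_linear_bounded V W (B : {linear V -> W}) : finite_dim V ->
  exists2 K, 0 < K & forall v, `|B v| <= K * `|v|.
Proof.
move=> [N [e [c [K [s b]]]]]; exists (`|K| * (\sum_i `|B (e i)|) + 1).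
  by rewrite ltr_wpDl// mulr_ge0// sumr_ge0.
move=> v; rewrite {1}(s v) linear_sum.
apply: le_trans (ler_norm_sum _ _ _) _.
apply: (@le_trans _ _ (\sum_i (`|K| * `|v|) * `|B (e i)|)).
  apply: ler_sum => i _; rewrite linearZ normrZ ler_wpM2r//.
  by apply: le_trans (b _ _) _; rewrite ler_wpM2r// ler_norm.
by rewrite -mulr_sumr mulrAC ler_wpM2r// lerDl.
Qed.

(* [DF] plays the role of the derivative. These estimates hold for C^2 maps and
   pass to sums, products and pairs, so that no calculus is needed on the product
   space in which the Newton iteration takes place. *)
Definition c2_on r K V W (p : V) (F : V -> W) (DF : V -> V -> W) : Prop :=
  forall u v, `|u - p| < r -> `|v - p| < r ->
  [/\ linear (DF u), `|F u| <= K, forall d, `|DF u d| <= K * `|d|,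
      forall d, `|DF u d - DF v d| <= K * `|u - v| * `|d| &
      `|F u - F v| <= K * `|u - v| /\
      `|F u - F v - DF v (u - v)| <= K * `|u - v| ^+ 2].

Definition c2_at V W (p : V) (F : V -> W) (DF : V -> V -> W) : Prop :=
  exists r K, [/\ 0 < r, 0 <= K & c2_on r K p F DF].

Lemma c2_on_le r K r' K' V W (p : V) (F : V -> W) DF :
  r' <= r -> K <= K' -> c2_on r K p F DF -> c2_on r' K' p F DF.
Proof.
move=> rr KK c u v ur vr.
have [l b1 b2 b3 [b4 b5]] := c u v (lt_le_trans ur rr) (lt_le_trans vr rr).
split=> //; first exact: le_trans KK.
- by move=> d; apply: le_trans (b2 d) _; rewrite ler_wpM2r.
- by move=> d; apply: le_trans (b3 d) _; rewrite !ler_wpM2r.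
- by split; [apply: le_trans b4 _|apply: le_trans b5 _]; rewrite ler_wpM2r// exprn_ge0.
Qed.

Lemma c2_at_common V W1 W2 (p : V) (F1 : V -> W1) (F2 : V -> W2) D1 D2 :
  c2_at p F1 D1 -> c2_at p F2 D2 ->
  exists r K, [/\ 0 < r, 0 <= K, c2_on r K p F1 D1 & c2_on r K p F2 D2].
Proof.
move=> [r1 [K1 [r10 K10 c1]]] [r2 [K2 [r20 K20 c2]]].
exists (Num.min r1 r2), (Num.max K1 K2); split.
- by rewrite lt_min r10.
- by rewrite le_max K10.
- by apply: c2_on_le c1; rewrite ?ge_min ?le_max ?lexx.
- by apply: c2_on_le c2; rewrite ?ge_min ?le_max ?lexx ?orbT.
Qed.

Lemma c2_pair V W1 W2 (p : V) (F1 : V -> W1) (F2 : V -> W2) D1 D2 :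
  c2_at p F1 D1 -> c2_at p F2 D2 ->
  c2_at p (fun u => (F1 u, F2 u)) (fun u d => (D1 u d, D2 u d)).
Proof.
move=> h1 h2; have [r [K [r0 K0 c1 c2]]] := c2_at_common h1 h2.
exists r, K; split=> // u v ur vr.
have [l1 a1 a2 a3 [a4 a5]] := c1 u v ur vr.
have [l2 b1 b2 b3 [b4 b5]] := c2 u v ur vr.
split; first by move=> k d d'; rewrite l1 l2.
- exact: pair_norm_le.
- by move=> d; apply: pair_norm_le; [exact: a2|exact: b2].
- by move=> d; apply: pair_norm_le; [exact: a3|exact: b3].
- by split; apply: pair_norm_le.
Qed.

Lemma c2_row V p (x : V) (F : 'I_p -> V -> R^o) D :
  (forall i, c2_at x (F i) (D i)) ->
  c2_at x (fun u => \row_i F i u) (fun u d => \row_i D i u d).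
Proof.
move=> h.
have [r [K [r0 K0 c]]] : exists r K, [/\ 0 < r, 0 <= K & forall i, c2_on r K x (F i) (D i)].
  have rK i := cid (h i); pose rr i := sval (rK i).
  have KK i := cid (svalP (rK i)); pose K i := sval (KK i).
  have P i : [/\ 0 < rr i, 0 <= K i & c2_on (rr i) (K i) x (F i) (D i)] := svalP (KK i).
  (* The defaults [1] and [0] keep the radius positive and the constant nonnegative when [p = 0]. *)
  exists (\big[Num.min/1]_i rr i), (\big[Num.max/0]_i K i); split.
  - by apply: lt_bigmin => // i _; case: (P i).
  - by apply: bigmax_ge_id.
  move=> i; case: (P i) => ri Ki; apply: c2_on_le; first exact: bigmin_le_cond.
  exact: le_bigmax.
exists r, K; split=> // u v ur vr.
split; first by move=> k d d'; apply/rowP => i; rewrite !mxE;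
  have [l _ _ _ _] := c i u v ur vr; exact: l.
- by apply: rV_norm_le => // i; rewrite mxE; have [] := c i u v ur vr.
- move=> d; apply: rV_norm_le; first by rewrite mulr_ge0.
  by move=> i; rewrite mxE; have [_ _ + _ _] := c i u v ur vr; apply.
- move=> d; apply: rV_norm_le; first by rewrite !mulr_ge0.
  by move=> i; rewrite !mxE; have [_ _ _ + _] := c i u v ur vr; apply.
- split; (apply: rV_norm_le; first by rewrite mulr_ge0// exprn_ge0).
  + by move=> i; rewrite !mxE; have [_ _ _ _ []] := c i u v ur vr.
  + by move=> i; rewrite !mxE; have [_ _ _ _ []] := c i u v ur vr.
Qed.

Lemma c2_cst V W (p : V) (w : W) : c2_at p (cst w) (fun _ _ => 0).
Proof.
exists 1, `|w|; split=> // u v _ _; split => //=.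
- by move=> k d d'; rewrite scaler0 addr0.
- by move=> d; rewrite normr0 mulr_ge0.
- by move=> d; rewrite subrr normr0 !mulr_ge0.
- by rewrite !subrr normr0 !mulr_ge0.
Qed.

Lemma c2_add V W (p : V) (F1 F2 : V -> W) D1 D2 :
  c2_at p F1 D1 -> c2_at p F2 D2 ->
  c2_at p (fun u => F1 u + F2 u) (fun u d => D1 u d + D2 u d).
Proof.
move=> h1 h2; have [r [K [r0 K0 c1 c2]]] := c2_at_common h1 h2.
exists r, (K + K); split=> //; first by rewrite addr_ge0.
move=> u v ur vr.
have [l1 a1 a2 a3 [a4 a5]] := c1 u v ur vr.
have [l2 b1 b2 b3 [b4 b5]] := c2 u v ur vr.
split; first by move=> k d d'; rewrite l1 l2 scalerDr addrACA.
- by apply: le_trans (ler_normD _ _) _; exact: lerD.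
- by move=> d; apply: le_trans (ler_normD _ _) _; rewrite mulrDl; exact: lerD.
- move=> d; rewrite opprD addrACA; apply: le_trans (ler_normD _ _) _.
  by rewrite !mulrDl; exact: lerD.
- rewrite opprD addrACA; split; first by apply: le_trans (ler_normD _ _) _;
    rewrite mulrDl; exact: lerD.
  rewrite opprD [X in `|X|]addrACA; apply: le_trans (ler_normD _ _) _.
  by rewrite mulrDl; exact: lerD.
Qed.

Lemma c2_sum V W N (p : V) (F : 'I_N -> V -> W) D :
  (forall i, c2_at p (F i) (D i)) ->
  c2_at p (fun u => \sum_i F i u) (fun u d => \sum_i D i u d).
Proof.
elim: N F D => [|N IH] F D h.
  rewrite (_ : (fun _ => _) = cst 0); last by apply/funext => u; rewrite big_ord0.
  rewrite (_ : (fun _ _ => _) = fun _ _ => 0); last first.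
    by apply/funext => u; apply/funext => d; rewrite big_ord0.
  exact: c2_cst.
have -> : (fun u => \sum_i F i u) =
    fun u => \sum_i F (widen_ord (leqnSn N) i) u + F ord_max u.
  by apply/funext => u; rewrite big_ord_recr.
have -> : (fun u d => \sum_i D i u d) =
    fun u d => \sum_i D (widen_ord (leqnSn N) i) u d + D ord_max u d.
  by apply/funext => u; apply/funext => d; rewrite big_ord_recr.
by apply: c2_add => //; apply: (IH (fun i => F (widen_ord (leqnSn N) i))).
Qed.

Lemma c2_mul V (p : V) (F1 F2 : V -> R^o) D1 D2 :
  c2_at p F1 D1 -> c2_at p F2 D2 ->
  c2_at p (fun u => F1 u * F2 u : R^o)
          (fun u d => D1 u d * F2 u + F1 u * D2 u d : R^o).
Proof.
move=> h1 h2; have [r [K [r0 K0 c1 c2]]] := c2_at_common h1 h2.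
(* The worst of the bounds is the one for the difference of the derivatives, which telescopes into
   four products of size [K * K]. *)
exists r, (4 * (K * K) + K * K); split=> //; first by rewrite addr_ge0// !mulr_ge0.
have prod (x y a b : R) : `|x| <= a -> `|y| <= b -> `|x * y| <= a * b.
  by move=> xa yb; rewrite normrM; apply: ler_pM.
move=> u v ur vr.
have [l1 a1 a2 a3 [a4 a5]] := c1 u v ur vr.
have [l2 b1 b2 b3 [b4 b5]] := c2 u v ur vr.
have [_ a1' a2' _ _] := c1 v u vr ur.
have [_ b1' b2' _ _] := c2 v u vr ur.
have KK : 0 <= K * K by rewrite mulr_ge0.
have uv : 0 <= `|u - v| by [].
split.
- have sc (x y : R^o) : x *: y = x * y by [].
  move=> k d d'; rewrite l1 l2 !sc; ring.
- apply: le_trans (prod _ _ _ _ a1 b1) _; lra.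
- move=> d; apply: le_trans (ler_normD _ _) _.
  have x1 := prod _ _ _ _ (a2 d) b1.
  have x2 := prod _ _ _ _ a1 (b2 d).
  have : 0 <= `|d| by []. nra.
- move=> d.
  have -> : D1 u d * F2 u + F1 u * D2 u d - (D1 v d * F2 v + F1 v * D2 v d) =
    (D1 u d - D1 v d) * F2 u + D1 v d * (F2 u - F2 v)
    + ((F1 u - F1 v) * D2 u d + F1 v * (D2 u d - D2 v d)) by ring.
  have x1 := prod _ _ _ _ (a3 d) b1.
  have x2 := prod _ _ _ _ (a2' d) b4.
  have x3 := prod _ _ _ _ a4 (b2 d).
  have x4 := prod _ _ _ _ a1' (b3 d).
  have y1 := ler_normD ((D1 u d - D1 v d) * F2 u + D1 v d * (F2 u - F2 v))
    ((F1 u - F1 v) * D2 u d + F1 v * (D2 u d - D2 v d)).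
  have y2 := ler_normD ((D1 u d - D1 v d) * F2 u) (D1 v d * (F2 u - F2 v)).
  have y3 := ler_normD ((F1 u - F1 v) * D2 u d) (F1 v * (D2 u d - D2 v d)).
  have z : 0 <= K * K * `|u - v| * `|d| by rewrite !mulr_ge0.
  lra.
- split.
    have -> : F1 u * F2 u - F1 v * F2 v = (F1 u - F1 v) * F2 u + F1 v * (F2 u - F2 v)
      by ring.
    have x1 := prod _ _ _ _ a4 b1.
    have x2 := prod _ _ _ _ a1' b4.
    have y1 := ler_normD ((F1 u - F1 v) * F2 u) (F1 v * (F2 u - F2 v)).
    have z : 0 <= K * K * `|u - v| by rewrite !mulr_ge0.
    lra.
  have -> : F1 u * F2 u - F1 v * F2 v - (D1 v (u - v) * F2 v + F1 v * D2 v (u - v)) =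
    (F1 u - F1 v - D1 v (u - v)) * F2 v + (F1 u - F1 v) * (F2 u - F2 v)
    + F1 v * (F2 u - F2 v - D2 v (u - v)) by ring.
  have x1 := prod _ _ _ _ a5 b1'.
  have x2 := prod _ _ _ _ a4 b4.
  have x3 := prod _ _ _ _ a1' b5.
  have y1 := ler_normD
    ((F1 u - F1 v - D1 v (u - v)) * F2 v + (F1 u - F1 v) * (F2 u - F2 v))
    (F1 v * (F2 u - F2 v - D2 v (u - v))).
  have y2 := ler_normD ((F1 u - F1 v - D1 v (u - v)) * F2 v)
    ((F1 u - F1 v) * (F2 u - F2 v)).
  have z : 0 <= K * K * `|u - v| ^+ 2 by rewrite !mulr_ge0// exprn_ge0.
  lra.
Qed.

Lemma linear_sub V W (L : V -> W) : linear L -> forall u v, L u - L v = L (u - v).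
Proof. by move=> Ll u v; rewrite [in RHS]addrC -(scaleN1r v) Ll scaleN1r addrC. Qed.

Lemma linear_opp V W (L : V -> W) x : linear L -> L (- x) = - L x.
Proof.
move=> Ll; have L0 : L 0 = 0 by have := linear_sub Ll 0 0; rewrite !subrr => <-.
by rewrite -[- x]add0r -(linear_sub Ll) L0 add0r.
Qed.

Lemma c2_lin V W (p : V) (L : V -> W) (k : R) : linear L ->
  (forall v, `|L v| <= k * `|v|) -> c2_at p L (fun _ d => L d).
Proof.
(* On the ball of radius [1] one has |u| <= |p| + 1, which bounds the values of [L]; the same
   constant dominates [k]. *)
move=> Ll Lk; exists 1, (`|k| * (`|p| + 1)); split => //.
have Lk' v : `|L v| <= `|k| * `|v|.
  by apply: le_trans (Lk v) _; rewrite ler_wpM2r// ler_norm.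
have kp : `|k| <= `|k| * (`|p| + 1) by rewrite ler_peMr// lerDr.
have K0 : 0 <= `|k| * (`|p| + 1) by rewrite mulr_ge0// addr_ge0.
move=> u v up vp; split=> //.
- apply: le_trans (Lk' u) _; rewrite ler_wpM2l// -[u](subrK p) addrC.
  by apply: le_trans (ler_normD _ _) _; rewrite lerD2l ltW.
- by move=> d; apply: le_trans (Lk' d) _; rewrite ler_wpM2r.
- by move=> d; rewrite subrr normr0 !mulr_ge0.
- rewrite (linear_sub Ll) subrr normr0; split; last by rewrite mulr_ge0// exprn_ge0.
  by apply: le_trans (Lk' _) _; rewrite ler_wpM2r.
Qed.

(** Meant for projections [L] of a product: a function of the manifold variable becomes a function
    of all four variables. As [L] does not increase norms, radius and constant stay the same. *)
Lemma c2_comp_lin V V' W (p : V) (L : V -> V') (F : V' -> W) D : linear L ->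
  (forall v, `|L v| <= `|v|) -> c2_at (L p) F D ->
  c2_at p (fun u => F (L u)) (fun u d => D (L u) (L d)).
Proof.
move=> Ll Lk [r [K [r0 K0 c]]]; exists r, K; split=> // u v ur vr.
have LB x y : `|L x - L y| <= `|x - y| by rewrite (linear_sub Ll).
have [l b1 b2 b3 [b4 b5]] :=
  c (L u) (L v) (le_lt_trans (LB _ _) ur) (le_lt_trans (LB _ _) vr).
split.
- by move=> k d d'; rewrite Ll l.
- by [].
- by move=> d; apply: le_trans (b2 _) _; rewrite ler_wpM2l.
- by move=> d; apply: le_trans (b3 _) _; apply: ler_pM; rewrite ?mulr_ge0// ler_wpM2l.
- split; first by apply: le_trans b4 _; rewrite ler_wpM2l.
  rewrite -(linear_sub Ll); apply: le_trans b5 _.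
  by rewrite ler_wpM2l// lerXn2r ?nnegrE.
Qed.

End C2.

(** * Second-order estimates for C^2 functions *)

Section C2analysis.
Context {R : realType} {V : normedModType R}.

Lemma line_derive (f : V -> R^o) (v d : V) (t : R) :
  derivable f (t *: d + v) d ->
  is_derive (t : R^o) 1 (fun s : R^o => f (s *: d + v) : R^o) ('D_d f (t *: d + v)).
Proof.
have E : (fun s : R => s^-1 *:
      (((fun s : R^o => f (s *: d + v)) \o shift t) (s *: 1) - f (t *: d + v)))
  = (fun s : R => s^-1 *: ((f \o shift (t *: d + v)) (s *: d) - f (t *: d + v))).
  apply/funext => s /=; congr (_ *: (f _ - _)).
  by rewrite [_ *: 1]mulr1 scalerDl addrA.
by move=> df; split; rewrite ?/derivable ?/derive E.
Qed.

(** The mean value theorem on the segment from [v] to [u], which lies in the ball by convexity. The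
    bound on |c - v| is what later makes the Taylor remainder quadratic. *)
Lemma mvt_ball (f : V -> R^o) (p u v : V) (r : R) :
  (forall x, `|x - p| < r -> differentiable f x) ->
  `|u - p| < r -> `|v - p| < r ->
  exists c, [/\ `|c - p| < r, `|c - v| <= `|u - v| & f u - f v = 'D_(u - v) f c].
Proof.
move=> df ur vr.
have seg t : 0 <= t <= 1 -> `|t *: (u - v) + v - p| < r.
  move=> /andP[t0 t1].
  have -> : t *: (u - v) + v - p = t *: (u - p) + (1 - t) *: (v - p).
    have -> : u - v = (u - p) - (v - p) by rewrite opprB addrA subrK.
    by rewrite -(addrA _ v) scalerBr [in RHS]scalerBl scale1r -addrA
       [in RHS](addrC (v - p)).
  apply: le_lt_trans (ler_normD _ _) _;
    rewrite !normrZ ger0_norm// [`|1 - t|]ger0_norm ?subr_ge0//.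
  apply: (@le_lt_trans _ _ (Num.max `|u - p| `|v - p|)); last by rewrite gt_max ur.
  set m := Num.max _ _; rewrite [leRHS](_ : m = t * m + (1 - t) * m); last by ring.
  by apply: lerD; apply: ler_wpM2l; rewrite ?subr_ge0// /m le_max lexx ?orbT.
have drv t : 0 <= t <= 1 ->
    is_derive (t : R^o) 1 (fun s : R^o => f (s *: (u - v) + v) : R^o)
    ('D_(u - v) f (t *: (u - v) + v)).
  by move=> t01; apply: line_derive; apply: diff_derivable; apply: df; exact: seg.
have [||c] := @MVT R (fun s => f (s *: (u - v) + v))
  (fun t => 'D_(u - v) f (t *: (u - v) + v)) 0 1 ltr01.
- move=> t; rewrite in_itv /= => /andP[t0 t1]; apply: drv; rewrite !ltW//.
- apply: derivable_within_continuous => t; rewrite in_itv/= => t01.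
  by have [] := drv t t01.
rewrite in_itv/= => /andP[c0 c1]; rewrite scale1r scale0r subrK add0r subr0 mulr1 => E.
exists (c *: (u - v) + v); split=> //; first by apply: seg; rewrite !ltW.
by rewrite addrK normrZ gtr0_norm// ler_piMl// ltW.
Qed.

Lemma derive_coord_le N (e : 'I_N -> V) (c : 'I_N -> V -> R) (k b : R) (f : V -> R^o)
    (x d : V) : differentiable f x ->
  (forall v, v = \sum_i c i v *: e i) -> (forall i v, `|c i v| <= k * `|v|) ->
  0 <= k -> (forall i, `|'D_(e i) f x| <= b) -> `|'D_d f x| <= (N%:R * (k * b)) * `|d|.
Proof.
move=> df ce ck k0 fb.
have -> : 'D_d f x = \sum_i c i d * 'D_(e i) f x.
  rewrite deriveE// {1}(ce d) linear_sum; apply: eq_bigr => i _.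
  by rewrite (deriveE _ df); exact: linearZ.
apply: le_trans (ler_norm_sum _ _ _) _.
apply: le_trans (_ : \sum_(i < N) (k * `|d| * b) <= _).
  by apply: ler_sum => i _; rewrite normrM; apply: ler_pM.
rewrite sumr_const card_ord -mulr_natl le_eqVlt; apply/orP; left; apply/eqP; ring.
Qed.

Lemma near_ball_bound N (f : 'I_N -> V -> R^o) (U : set V) (p : V) : open U -> U p ->
  (forall i, {for p, continuous (f i)}) ->
  exists r K, [/\ 0 < r, 0 <= K & forall u, `|u - p| < r -> U u /\ forall i, `|f i u| <= K].
Proof.
move=> oU Up fc.
have nU : nbhs p U by exact: open_nbhs_nbhs.
have nf : \forall u \near p, forall i, `|f i u - f i p| < 1.
  apply: filter_forall => i.
  have /cvgrPdist_lt/(_ 1 ltr01) := fc i.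
  by apply: filterS => u; rewrite distrC.
have : nbhs p (U `&` [set u | forall i, `|f i u - f i p| < 1]) by exact: filterI.
move=> /nbhs_ballP[r /= r0 rb].
exists r, (\sum_i `|f i p| + 1); split=> //; first by rewrite addr_ge0// sumr_ge0.
move=> u up; have [|Uu fu] := rb u; first by rewrite -ball_normE /ball_ /= distrC.
split=> // i; rewrite -[f i u](subrK (f i p)) addrC; apply: le_trans (ler_normD _ _) _.
rewrite lerD// ?(ltW (fu i))// (bigD1 i)//= lerDl sumr_ge0//.
Qed.

(** Continuity of the derivative is known for each fixed direction separately. Finitely many
    spanning directions make its bound uniform in [d], and the mean value theorem turns that bound
    into a Lipschitz estimate. *)
Lemma C1_lipschitz (f : V -> R^o) (U : set V) (p : V) : finite_dim V -> open U -> U p ->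
  Ck_on 1 U f ->
  exists r K, [/\ 0 < r, 0 <= K,
    forall u d, `|u - p| < r -> U u /\ `|'D_d f u| <= K * `|d| &
    forall u v, `|u - p| < r -> `|v - p| < r -> `|f u - f v| <= K * `|u - v|].
Proof.
move=> [N [e [c [k [ce ck]]]]] oU Up [df cf].
have [r [b [r0 b0 rb]]] := near_ball_bound oU Up (fun i => cf (e i) p Up).
have ck' i v : `|c i v| <= `|k| * `|v|.
  by apply: le_trans (ck i v) _; rewrite ler_wpM2r// ler_norm.
have D u d : `|u - p| < r -> U u /\ `|'D_d f u| <= N%:R * (`|k| * b) * `|d|.
  move=> ur; have [Uu fb] := rb u ur; split=> //.
  by apply: derive_coord_le ce ck' _ fb => //; exact: df.
exists r, (N%:R * (`|k| * b)); split=> //; first by rewrite !mulr_ge0.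
move=> u v ur vr.
have dfr x : `|x - p| < r -> differentiable f x.
  by move=> xr; apply: df; exact: (D x 0 xr).1.
have [x [xr _ ->]] := mvt_ball dfr ur vr; exact: (D _ _ xr).2.
Qed.

(** [C1_lipschitz], applied to the derivatives along a spanning family, makes the derivative itself
    Lipschitz. By the mean value theorem the remainder at [v] is the difference of the derivatives
    at [c] and at [v] in the direction [u - v], with [c] no farther from [v] than [u]; it is thus of
    second order. *)
Lemma Ck2_c2_at (f : V -> R^o) (U : set V) (p : V) : finite_dim V -> open U -> U p ->
  Ck_on 2 U f -> c2_at p f (fun u d => 'D_d f u).
Proof.
move=> fV oU Up f2; have [r1 [K1 [r10 K10 D1 L1]]] := C1_lipschitz fV oU Up (Ck_S f2).
have [N [e [c [k [ce ck]]]]] := fV.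
have ck' i v : `|c i v| <= `|k| * `|v|.
  by apply: le_trans (ck i v) _; rewrite ler_wpM2r// ler_norm.
have [r2 [K2 [r20 K20 L2]]] : exists r K, [/\ 0 < r, 0 <= K &
    forall i u v, `|u - p| < r -> `|v - p| < r ->
      `|'D_(e i) f u - 'D_(e i) f v| <= K * `|u - v|].
  have h i := C1_lipschitz fV oU Up (f2.2 (e i)).
  have rK i := cid (h i); pose rr i := sval (rK i).
  have KK i := cid (svalP (rK i)); pose K i := sval (KK i).
  have P i : [/\ 0 < rr i, 0 <= K i, _ & _] := svalP (KK i).
  exists (\big[Num.min/1]_i rr i), (\big[Num.max/0]_i K i); split.
  - by apply: lt_bigmin => // i _; case: (P i).
  - by apply: bigmax_ge_id.
  move=> i u v ur vr; case: (P i) => _ _ _ /(_ u v) L.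
  apply: le_trans (L _ _) _.
  - by apply: lt_le_trans ur _; exact: bigmin_le_cond.
  - by apply: lt_le_trans vr _; exact: bigmin_le_cond.
  - by rewrite ler_wpM2r//; exact: le_bigmax.
pose r := Num.min r1 r2; pose B := N%:R * (`|k| * K2).
have B0 : 0 <= B by rewrite !mulr_ge0.
have rr1 x : `|x - p| < r -> `|x - p| < r1 by rewrite lt_min => /andP[].
have rr2 x : `|x - p| < r -> `|x - p| < r2 by rewrite lt_min => /andP[].
have dfr x : `|x - p| < r -> differentiable f x.
  by move=> /rr1 xr; apply: f2.1; exact: (D1 x 0 xr).1.
have DD u v d : `|u - p| < r -> `|v - p| < r ->
    `|'D_d f u - 'D_d f v| <= B * `|u - v| * `|d|.
  move=> ur vr.
  have E x : `|x - p| < r -> 'D_d f x = \sum_i c i d * 'D_(e i) f x.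
    move=> xr; rewrite deriveE; last exact: dfr.
    rewrite {1}(ce d) linear_sum; apply: eq_bigr => i _.
    by rewrite deriveE; [exact: linearZ|exact: dfr].
  rewrite (E _ ur) (E _ vr) -sumrB; apply: le_trans (ler_norm_sum _ _ _) _.
  apply: le_trans (_ : \sum_(i < N) (`|k| * `|d| * (K2 * `|u - v|)) <= _).
    apply: ler_sum => i _; rewrite -mulrBr normrM; apply: ler_pM => //.
    by apply: L2; exact: rr2.
  rewrite sumr_const card_ord -mulr_natl /B le_eqVlt; apply/orP; left; apply/eqP; ring.
have r0 : 0 < r by rewrite lt_min r10.
(* The first two summands bound the values of [f], [K1] bounds the derivative and the Lipschitz
   constant, and [B] bounds the variation of the derivative and the remainder. *)
exists r, (K1 * r + `|f p| + K1 + B); split=> //.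
  by rewrite !addr_ge0// mulr_ge0// ltW.
have [K1r fp] : 0 <= K1 * r /\ 0 <= `|f p| by rewrite mulr_ge0// ltW.
move=> u v ur vr; have uv : 0 <= `|u - v| by [].
split.
- move=> a d d'; rewrite !deriveE; do ?exact: dfr.
  exact: linearP.
- rewrite -[f u](subrK (f p)); apply: le_trans (ler_normD _ _) _.
  have : `|f u - f p| <= K1 * r.
    apply: le_trans (L1 _ _ (rr1 _ ur) _) _; first by rewrite subrr normr0.
    by rewrite ler_wpM2l// ltW.
  lra.
- move=> d; apply: le_trans (D1 u d (rr1 _ ur)).2 _; rewrite ler_wpM2r//; lra.
- move=> d; apply: le_trans (DD _ _ _ ur vr) _; rewrite !ler_wpM2r//; lra.
- split; first by apply: le_trans (L1 _ _ (rr1 _ ur) (rr1 _ vr)) _;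
    rewrite ler_wpM2r//; lra.
  have [x [xr xv ->]] := mvt_ball dfr ur vr.
  apply: le_trans (DD _ _ _ xr vr) _.
  rewrite expr2 mulrA ler_wpM2r// ; apply: ler_pM => //; lra.
Qed.

End C2analysis.

(** * Tangent vectors and fields in coordinates *)

Section Coordinates.
Context {R : realType} {n : nat} {M : manifold R n}.
Implicit Types (a b c : chart R n M) (x y : M) (v : 'rV[R]_n).

Lemma transition_is_linear a b x : linear (transition a b x).
Proof. by move=> k u v; rewrite /transition linearP. Qed.

HB.instance Definition _ a b x :=
  GRing.isLinear.Build R 'rV[R]_n 'rV[R]_n *:%R (transition a b x)
    (transition_is_linear a b x).

Lemma open_pullback a (O : set M) : open O ->
  open [set u | ccod a u /\ O (cinv a u)].
Proof.
move=> oO; rewrite openE => u [au Ou]; rewrite /interior.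
apply: filterI; first exact: open_nbhs_nbhs (conj (@ccod_open _ _ _ a) au).
exact: (cinv_continuous au) (open_nbhs_nbhs (conj oO Ou)).
Qed.

Lemma chart_near a x (P : set M) : cdom a x -> nbhs x P ->
  \forall u \near a x, ccod a u /\ P (cinv a u).
Proof.
move=> ax xP; have au := cmap_cod ax.
apply: filterI; first exact: open_nbhs_nbhs (conj (@ccod_open _ _ _ a) au).
by apply: (cinv_continuous au); rewrite cmapK.
Qed.

Lemma cdom_nbhs a x : cdom a x -> nbhs x (cdom a).
Proof. by move=> ax; apply: open_nbhs_nbhs; split=> //; exact: cdom_open. Qed.

Lemma transition_diff a b x : atlas a -> atlas b -> cdom a x -> cdom b x ->
  differentiable (b \o cinv a) (a x).
Proof.
move=> aa ab ax bx; have [] := atlas_smooth aa ab 1%N; move=> + _; apply.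
by rewrite /= cmapK //; split=> //; exact: cmap_cod.
Qed.

Lemma transition_comp a b c x v : atlas a -> atlas b -> atlas c ->
  cdom a x -> cdom b x -> cdom c x ->
  transition b c x (transition a b x v) = transition a c x v.
Proof.
move=> aa ab ac ax bx cx; rewrite /transition.
have dab := transition_diff aa ab ax bx.
have dbc := transition_diff ab ac bx cx.
have E : (b \o cinv a) (a x) = b x by rewrite /= cmapK.
have [dG dE] := diff_comp_at E dab dbc.
rewrite -[LHS]/(('d (c \o cinv b) (b x) \o 'd (b \o cinv a) (a x)) v) -dE.
have N : \forall u \near a x, (c \o cinv a) u = ((c \o cinv b) \o (b \o cinv a)) u.
  by apply: filterS (chart_near ax (cdom_nbhs bx)) => u [au bu] /=; rewrite cmapK.
have [_ E2] := near_eq_diff N (transition_diff aa ac ax cx).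
exact: (congr1 (fun F => F v) E2).
Qed.

Lemma transition_id a x v : cdom a x -> transition a a x v = v.
Proof.
move=> ax; rewrite /transition.
have N : \forall u \near a x, id u = (a \o cinv a) u.
  by apply: filterS (chart_near ax (cdom_nbhs ax)) => u [au bu] /=; rewrite cinvK.
have [_ E] := near_eq_diff N (@ex_diff _ _ _ _ _ _ _ (is_diff_id (a x))).
rewrite E; exact: (congr1 (fun F => F v) (@diff_val _ _ _ _ _ _ _ (is_diff_id (a x)))).
Qed.

Lemma of_coordK a x v : atlas a -> cdom a x -> to_coord a (of_coord a x v) = v.
Proof.
move=> aa ax; rewrite /to_coord /of_coord transition_comp ?transition_id//.
- exact: chart_at_atlas.
- exact: chart_at_dom.
Qed.

Lemma to_coordK a x (xi : tangent M x) : atlas a -> cdom a x ->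
  of_coord a x (to_coord a xi) = xi.
Proof.
have := chart_at_atlas x; have := chart_at_dom x.
by move=> *; rewrite /to_coord /of_coord transition_comp ?transition_id.
Qed.

Lemma D_of_coord a (phi : M -> R) x v : atlas a -> cdom a x ->
  differentiable (phi \o cinv a : _ -> R^o) (a x) ->
  D phi x (of_coord a x v) = 'D_v (phi \o cinv a : _ -> R^o) (a x).
Proof.
move=> aa ax dphi; rewrite /D lfunE /= deriveE// /of_coord /transition.
set b := chart_at x.
have bx : cdom b x by exact: chart_at_dom.
have ab : atlas b by exact: chart_at_atlas.
have dab := transition_diff ab aa bx ax.
have E : (a \o cinv b) (b x) = a x by rewrite /= cmapK.
have [dG dE] := diff_comp_at E dab dphi.
have N : \forall u \near b x,
    ((phi \o cinv a) \o (a \o cinv b)) u = (phi \o cinv b : _ -> R^o) u.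
  by apply: filterS (chart_near bx (cdom_nbhs ax)) => u [bu au] /=; rewrite cmapK.
have [_ E2] := near_eq_diff N dG.
have T : 'd (a \o cinv b) (b x) (transition a b x v) = v.
  by apply: etrans (transition_comp v aa ab aa ax bx ax) _; exact: transition_id.
apply: etrans (congr1 (fun F => F (transition a b x v)) E2) _.
apply: etrans (congr1 (fun F => F (transition a b x v)) dE) _.
exact: (congr1 ('d (phi \o cinv a : _ -> R^o) (a x)) T).
Qed.

End Coordinates.

Section Frames.
Context {R : realType} {n : nat} {M : manifold R n}.
Implicit Types (a b c : chart R n M) (x y : M) (v : 'rV[R]_n) (O : set M).

Definition frame a v : vector_field M := fun y => of_coord a y v.

Lemma chart_comp_smooth a b : atlas a -> atlas b ->
  smooth_on [set u | ccod b u /\ cdom a (cinv b u)] (a \o cinv b).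
Proof. by move=> aa ab k; exact: (atlas_smooth ab aa). Qed.

Lemma smooth_fun_on_chart a O (G : 'rV[R]_n -> R^o) (U : set 'rV[R]_n) :
  atlas a -> open O -> (forall x, O x -> cdom a x /\ U (a x)) ->
  smooth_on U G -> smooth_fun_on O (G \o a).
Proof.
move=> aa oO OU GU b ab k.
pose U' := [set u | ccod b u /\ O (cinv b u)].
have oU' : open U' by exact: open_pullback.
apply: (@Ck_comp _ _ _ k U' U (a \o cinv b) G) => //.
- by move=> u [bu Ou] /=; exact: (OU _ Ou).2.
- apply: Ck_sub (chart_comp_smooth aa ab k) => u [bu Ou]; split=> //.
  exact: (OU _ Ou).1.
Qed.

Lemma transition_coord_smooth a b v i : atlas a -> atlas b ->
  smooth_on [set u | ccod a u /\ cdom b (cinv a u)]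
    (fun u => 'D_v (b \o cinv a) u 0 i : R^o).
Proof.
move=> aa ab k; apply: Ck_coord.
  by apply: open_pullback; exact: cdom_open.
exact: (chart_comp_smooth ab aa k.+1).2.
Qed.

Lemma transition_derive a b x v : atlas a -> atlas b -> cdom a x -> cdom b x ->
  transition a b x v = 'D_v (b \o cinv a) (a x).
Proof. by move=> aa ab ax bx; rewrite deriveE//; exact: transition_diff. Qed.

Lemma transition_smooth a b v i : atlas a -> atlas b ->
  smooth_fun_on (cdom a `&` cdom b) (fun y => transition a b y v 0 i).
Proof.
move=> aa ab c ac k.
have oO : open (cdom a `&` cdom b) by apply: openI; exact: cdom_open.
apply: (@Ck_eq _ _ _ _ _ ((fun u => 'D_v (b \o cinv a) u 0 i : R^o) \o a \o cinv c)).
- exact: open_pullback.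
- by move=> u [cu [au bu]] /=; rewrite transition_derive.
apply: (smooth_fun_on_chart (U := [set u | ccod a u /\ cdom b (cinv a u)])) => //.
- by move=> x [ax bx]; split=> //=; rewrite cmapK//; split => //; exact: cmap_cod.
- exact: transition_coord_smooth.
Qed.

Lemma frame_smooth a v : atlas a -> smooth_vf_on (cdom a) (frame a v).
Proof.
move=> aa b ab k; apply: Ck_row => [|i].
  by apply: open_pullback; exact: cdom_open.
apply: (@Ck_eq _ _ _ _ _ ((fun y => transition a b y v 0 i) \o cinv b)).
- by apply: open_pullback; exact: cdom_open.
- move=> u [bu au] /=; rewrite /to_coord /frame /of_coord transition_comp//.
  + exact: chart_at_atlas.
  + exact: chart_at_dom.
  + exact: cinv_dom.
apply: Ck_sub (transition_smooth v i aa ab ab k) => u [bu au]; split=> //=.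
by split=> //; exact: cinv_dom.
Qed.

Lemma smooth_vf_on_sub O O' (Y : vector_field M) : O `<=` O' ->
  smooth_vf_on O' Y -> smooth_vf_on O Y.
Proof.
by move=> OO' q' a aa k; apply: Ck_sub (q' a aa k) => u [au Ou]; split=> //; exact: OO'.
Qed.

Lemma smooth_vf_on_eq O (Y Y' : vector_field M) : open O ->
  (forall y, O y -> Y y = Y' y) -> smooth_vf_on O Y -> smooth_vf_on O Y'.
Proof.
move=> oO YY' sY a aa k; apply: Ck_eq (sY a aa k); first exact: open_pullback.
by move=> u [au Ou]; rewrite YY'.
Qed.

Lemma smooth_fun_on_eq O (q q' : M -> R) : open O ->
  (forall y, O y -> q y = q' y) -> smooth_fun_on O q -> smooth_fun_on O q'.
Proof.
move=> oO YY' sY a aa k; apply: Ck_eq (sY a aa k); first exact: open_pullback.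
by move=> u [au Ou] /=; rewrite YY'.
Qed.

Lemma smooth_fun_on_cst O (r : R) : smooth_fun_on O (fun _ => r).
Proof. by move=> a aa k; exact: Ck_cst. Qed.

Lemma smooth_vf_scale O (q : M -> R) (Y : vector_field M) : open O ->
  smooth_fun_on O q -> smooth_vf_on O Y -> smooth_vf_on O (fun y => q y *: Y y).
Proof.
move=> oO sq sY a aa k; have oU := open_pullback (a := a) oO.
apply: Ck_eq (Ck_scale oU (sq a aa k) (sY a aa k)) => // u _.
by rewrite /to_coord linearZ.
Qed.

Lemma smooth_vf_0 O : smooth_vf_on O (fun y => 0 : tangent M y).
Proof.
move=> a aa k; rewrite (_ : (fun u => _) = cst 0); first exact: Ck_cst.
by apply/funext => u; rewrite /to_coord linear0.
Qed.

Lemma smooth_vf_sum N O (Y : 'I_N -> vector_field M) : open O ->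
  (forall i, smooth_vf_on O (Y i)) -> smooth_vf_on O (fun y => \sum_i Y i y).
Proof.
move=> oO sY a aa k; have oU := open_pullback (a := a) oO.
apply: Ck_eq (Ck_sum (F := fun i u => to_coord a (Y i (cinv a u))) oU
  (fun i => sY i a aa k)) => // u _.
by rewrite /to_coord linear_sum.
Qed.

Lemma smooth_fun_on_differentiable O a (q : M -> R) x : smooth_fun_on O q ->
  atlas a -> cdom a x -> O x -> differentiable (q \o cinv a : _ -> R^o) (a x).
Proof.
move=> sq aa ax Ox; have [+ _] := sq a aa 1%N; apply.
by rewrite /= cmapK//; split=> //; exact: cmap_cod.
Qed.

Lemma D_to_coord a O (q : M -> R) x (xi : tangent M x) : smooth_fun_on O q ->
  atlas a -> cdom a x -> O x ->
  D q x xi = 'D_(to_coord a xi) (q \o cinv a : _ -> R^o) (a x).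
Proof.
move=> sq aa ax Ox; rewrite -{1}(to_coordK xi aa ax) D_of_coord//.
exact: smooth_fun_on_differentiable sq _ _ _.
Qed.

Lemma D_locally_cst O (q : M -> R) x (xi : tangent M x) (r : R) : open O -> O x ->
  (forall y, O y -> q y = r) -> D q x xi = 0.
Proof.
move=> oO Ox qr.
rewrite (@D_to_coord (chart_at x) O q x xi) //.
- rewrite (_ : 'D__ _ _ = 'D_(to_coord (chart_at x) xi) (cst r : _ -> R^o) (chart_at x x)).
    by rewrite derive_cst.
  apply: near_eq_derive.
  have Ox' : nbhs x O by exact: open_nbhs_nbhs.
  by apply: filterS (chart_near (chart_at_dom x) Ox') => u [_ /qr].
- by apply: (smooth_fun_on_eq oO) (smooth_fun_on_cst _ r) => y /qr.
- exact: chart_at_atlas.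
- exact: chart_at_dom.
Qed.

End Frames.

Section Nabla.
Context {R : realType} {n : nat} {M : manifold R n} (nb : connection M).
Implicit Types (a b c : chart R n M) (x y : M) (v : 'rV[R]_n) (O : set M).

(* Multiply both fields by the indicator function of [O]. *)
Lemma nabla_eq O (Y Y' : vector_field M) x (xi : tangent M x) : open O -> O x ->
  smooth_vf_on O Y -> (forall y, O y -> Y y = Y' y) ->
  nabla nb Y xi = nabla nb Y' xi.
Proof.
move=> oO Ox sY YY'.
pose q y : R := if `[< O y >] then 1 else 0.
have q1 y : O y -> q y = 1 by move=> Oy; rewrite /q asboolT.
have sq : smooth_fun_on O q.
  by apply: (smooth_fun_on_eq oO) (smooth_fun_on_cst _ 1) => y /q1.
have qnabla Z : smooth_vf_on O Z -> nabla nb (fun y => q y *: Z y) xi = nabla nb Z xi.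
  move=> sZ; rewrite (nabla_leibniz _ oO Ox sq sZ) (D_locally_cst _ oO Ox q1) q1//.
  by rewrite scale0r add0r scale1r.
rewrite -(qnabla Y)// -(qnabla Y'); last exact: smooth_vf_on_eq sY.
congr (nabla nb _ xi); apply: functional_extensionality_dep => y.
by rewrite /q; case: asboolP => [/YY' ->//|_]; rewrite !scale0r.
Qed.

Lemma nabla0 x (xi : tangent M x) : nabla nb (fun y => 0 : tangent M y) xi = 0.
Proof.
have /= := nabla_leibniz nb openT I (smooth_fun_on_cst _ 0) (smooth_vf_0 setT) xi.
rewrite !scale0r scaler0 addr0 => E; rewrite -[RHS]E; congr (nabla nb _ xi).
by apply: functional_extensionality_dep => y; rewrite scaler0.
Qed.

Lemma nabla_sum N O (q : 'I_N -> M -> R) (Y : 'I_N -> vector_field M) x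
    (xi : tangent M x) : open O -> O x ->
  (forall i, smooth_fun_on O (q i)) -> (forall i, smooth_vf_on O (Y i)) ->
  nabla nb (fun y => \sum_i q i y *: Y i y) xi =
  \sum_i (D (q i) x xi *: Y i x + q i x *: nabla nb (Y i) xi).
Proof.
move=> oO Ox; elim: N q Y => [|N IH] q Y sq sY.
  rewrite big_ord0 -[RHS](nabla0 xi); congr (nabla nb _ xi).
  by apply: functional_extensionality_dep => y; rewrite big_ord0.
rewrite big_ord_recr /= -IH// -(nabla_leibniz nb oO Ox)//.
rewrite -(nabla_add nb oO Ox).
- congr (nabla nb _ xi).
  by apply: functional_extensionality_dep => y; rewrite big_ord_recr.
- by apply: smooth_vf_sum => // i; exact: smooth_vf_scale.
- exact: smooth_vf_scale.
Qed.

Lemma nabla_sum_dir N O (Y : vector_field M) x (v : 'I_N -> R) (xi : 'I_N -> tangent M x) :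
  open O -> O x -> smooth_vf_on O Y ->
  nabla nb Y (\sum_i v i *: xi i) = \sum_i v i *: nabla nb Y (xi i).
Proof.
move=> oO Ox sY; have lin := nabla_linear nb oO Ox sY.
have n0 : nabla nb Y (0 : tangent M x) = 0.
  have := lin 1 0 0; rewrite !scale1r addr0 => /eqP.
  by rewrite -subr_eq subrr eq_sym => /eqP.
apply: (big_rec2 (fun (a b : 'rV[R]_n) => nabla nb Y (a : tangent M x) = b)) => //.
by move=> i y1 y2 _ <-; exact: lin.
Qed.

End Nabla.

(** * Hessian in coordinates *)

Section HessianCoordinates.
Context {R : realType} {n : nat} {M : manifold R n} (nb : connection M).
Implicit Types (a b c : chart R n M) (x y : M) (v : 'rV[R]_n) (O : set M).

Definition pder a (phi : M -> R) (i : 'I_n) (u : 'rV[R]_n) : R^o :=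
  'D_(delta_mx 0 i) (phi \o cinv a : _ -> R^o) u.

Definition christoffel a (i j : 'I_n) (u : 'rV[R]_n) : 'rV[R]_n :=
  to_coord a (nabla nb (frame a (delta_mx 0 j)) (frame a (delta_mx 0 i) (cinv a u))).

Lemma chart_fun_smooth a (phi : M -> R) : atlas a -> smooth_fun phi ->
  smooth_on (ccod a) (phi \o cinv a : _ -> R^o).
Proof. by move=> aa sphi k; apply: Ck_sub (sphi a aa k) => u au; split. Qed.

Lemma pder_smooth a (phi : M -> R) i : atlas a -> smooth_fun phi ->
  smooth_on (ccod a) (pder a phi i).
Proof. by move=> aa sphi k; exact: (chart_fun_smooth aa sphi k.+1).2. Qed.

Lemma chart_fun_differentiable a (phi : M -> R) u : atlas a -> smooth_fun phi ->
  ccod a u -> differentiable (phi \o cinv a : _ -> R^o) u.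
Proof. by move=> aa sphi; apply: (chart_fun_smooth aa sphi 1%N).1. Qed.

Lemma D_coord a (phi : M -> R) x v : atlas a -> smooth_fun phi -> cdom a x ->
  D phi x (of_coord a x v) = 'D_v (phi \o cinv a : _ -> R^o) (a x).
Proof.
move=> aa sphi ax; apply: D_of_coord => //.
by apply: chart_fun_differentiable => //; exact: cmap_cod.
Qed.

Lemma D_frame a (phi : M -> R) x i : atlas a -> smooth_fun phi -> cdom a x ->
  D phi x (frame a (delta_mx 0 i) x) = pder a phi i (a x).
Proof. exact: D_coord. Qed.

Lemma of_coord_sum a x v : of_coord a x v = \sum_i v 0 i *: frame a (delta_mx 0 i) x.
Proof.
rewrite {1}(row_sum_delta v) /of_coord linear_sum; apply: eq_bigr => i _.
by rewrite linearZ.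
Qed.

Lemma D_coord_sum a (phi : M -> R) x v : atlas a -> smooth_fun phi -> cdom a x ->
  D phi x (of_coord a x v) = \sum_i v 0 i * pder a phi i (a x).
Proof.
move=> aa sphi ax; rewrite of_coord_sum linear_sum; apply: eq_bigr => i _.
by rewrite linearZ /= D_frame.
Qed.

Lemma extend_frame a x y (eta : tangent M x) : atlas a -> cdom a y ->
  cdom (chart_at x) y -> extend eta y =
  \sum_j transition (chart_at x) a y eta 0 j *: frame a (delta_mx 0 j) y.
Proof.
move=> aa ay xy; rewrite -of_coord_sum /extend /of_coord transition_comp//;
  by [exact: chart_at_atlas|exact: chart_at_dom].
Qed.

Lemma extend_smooth x (eta : tangent M x) :
  smooth_vf_on (cdom (chart_at x)) (extend eta).
Proof. by apply: frame_smooth; exact: chart_at_atlas. Qed.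

(* Tensoriality in [eta]: in the frame of [a] the derivatives of the coefficients
   of [extend eta] cancel between the two terms. *)
Lemma nabla_cov_frame a (phi : M -> R) x v (eta : tangent M x) :
  atlas a -> smooth_fun phi -> cdom a x ->
  D (fun y => D phi y (extend eta y)) x (of_coord a x v)
  - D phi x (nabla nb (extend eta) (of_coord a x v)) =
  \sum_j to_coord a eta 0 j *
     ('D_v (pder a phi j) (a x)
      - D phi x (nabla nb (frame a (delta_mx 0 j)) (of_coord a x v))).
Proof.
move=> aa sphi ax.
pose b := chart_at x.
have ab : atlas b by exact: chart_at_atlas.
have bx : cdom b x by exact: chart_at_dom.
pose O := cdom a `&` cdom b.
have oO : open O by apply: openI; exact: cdom_open.
have Ox : O x by [].
pose q j y : R := transition b a y eta 0 j.
have sq j : smooth_fun_on O (q j) by rewrite /O setIC; exact: transition_smooth.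
have dq j : differentiable (q j \o cinv a : _ -> R^o) (a x).
  exact: smooth_fun_on_differentiable (sq j) aa ax Ox.
have dp j : differentiable (pder a phi j) (a x).
  by have [+ _] := pder_smooth j aa sphi 1%N; apply; exact: cmap_cod.
pose E j := frame a (delta_mx 0 j).
have sE j : smooth_vf_on O (E j).
  by apply: smooth_vf_on_sub (frame_smooth _ aa); exact: subIsetl.
have exE y : O y -> extend eta y = \sum_j q j y *: E j y.
  by move=> [ay bay]; exact: extend_frame.
have nE : nabla nb (extend eta) (of_coord a x v) =
    \sum_j (D (q j) x (of_coord a x v) *: E j x + q j x *: nabla nb (E j) (of_coord a x v)).
  rewrite -(nabla_sum nb _ oO Ox sq sE); apply: (nabla_eq _ _ oO Ox) => //.
  by apply: smooth_vf_on_sub (@extend_smooth x eta); exact: subIsetr.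
pose psi u : R^o := \sum_j (q j \o cinv a) u * pder a phi j u.
have N : \forall u \near a x, psi u = ((fun y => D phi y (extend eta y)) \o cinv a) u.
  have nO : nbhs x O by exact: open_nbhs_nbhs.
  apply: filterS (chart_near ax nO) => u [au Ou] /=.
  rewrite exE// linear_sum; apply: eq_bigr => j _.
  by rewrite linearZ /= D_frame ?cinvK//; exact: Ou.1.
have dpsi : differentiable psi (a x).
  rewrite (_ : psi = \sum_j (fun u => (q j \o cinv a) u * pder a phi j u : R^o)).
    by apply: differentiable_sum => j;
      exact: (@differentiableM _ _ (q j \o cinv a) (pder a phi j)).
  by apply/funext => u; rewrite fct_sumE.
have psiE : 'D_v psi (a x) =
    \sum_j (q j x * 'D_v (pder a phi j) (a x)
            + pder a phi j (a x) * D (q j) x (of_coord a x v)).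
  rewrite (_ : psi = \sum_j (fun u => (q j \o cinv a) u * pder a phi j u : R^o));
    last first.
    by apply/funext => u; rewrite fct_sumE.
  rewrite derive_sum => [|j]; last first.
    by apply: diff_derivable; exact: (@differentiableM _ _ (q j \o cinv a) (pder a phi j)).
  apply: eq_bigr => j _.
  rewrite (@deriveM _ _ (q j \o cinv a) (pder a phi j));
    [|exact: diff_derivable|exact: diff_derivable].
  by rewrite /= cmapK// D_of_coord.
have E1 := etrans (D_of_coord v aa ax (near_eq_differentiable N dpsi))
  (etrans (esym (near_eq_derive v N)) psiE).
have E2 : D phi x (nabla nb (extend eta) (of_coord a x v)) =
    \sum_j (D (q j) x (of_coord a x v) * pder a phi j (a x)
            + q j x * D phi x (nabla nb (E j) (of_coord a x v))).
  apply: etrans (congr1 (D phi x) nE) _; apply: etrans (linear_sum (D phi x) _ _ _) _.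
  apply: eq_bigr => j _; apply: etrans (linearD (D phi x) _ _) _.
  apply: etrans (congr2 +%R (linearZ _ _) (linearZ _ _)) _.
  by congr (_ * _ + _); exact: D_frame.
apply: etrans (congr2 (fun s t : R => s - t) E1 E2) _.
rewrite -sumrB; apply: eq_bigr => j _.
rewrite mulrBr -[to_coord a eta 0 j]/(q j x).
by rewrite [D (q j) _ _ * _]mulrC opprD addrA addrK.
Qed.

(** [Hess] is wrapped in [linfun], which leaves its argument unchanged only when that is linear. The
    right-hand side of [nabla_cov_frame] makes the linearity in [eta] visible. *)
Lemma Hess_frame a (phi : M -> R) x v (eta : tangent M x) :
  atlas a -> smooth_fun phi -> cdom a x ->
  Hess nb phi (of_coord a x v) eta =
  \sum_j to_coord a eta 0 j *
     ('D_v (pder a phi j) (a x)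
      - D phi x (nabla nb (frame a (delta_mx 0 j)) (of_coord a x v))).
Proof.
move=> aa sphi ax; rewrite /Hess /nabla_cov.
set F := fun _ => _.
have FE : F = fun eta : 'rV[R]_n => \sum_j to_coord a (eta : tangent M x) 0 j *
     ('D_v (pder a phi j) (a x)
      - D phi x (nabla nb (frame a (delta_mx 0 j)) (of_coord a x v))) : R^o.
  by apply/funext => e; exact: nabla_cov_frame.
have Flin : linear F.
  rewrite FE => k e e'; rewrite scaler_sumr -big_split /=; apply: eq_bigr => j _.
  rewrite /to_coord linearP !mxE -[_ *: (_ : R^o)]/(_ * _); ring.
pose FL : {linear 'rV[R]_n -> R^o} := HB.pack F (GRing.isLinear.Build _ _ _ _ F Flin).
by rewrite -[F]/(FL : _ -> _) lfunE /= FE.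
Qed.

Lemma Hess_linear (phi : M -> R) x (k : R) (xi xi' : tangent M x) : smooth_fun phi ->
  Hess nb phi (k *: xi + xi') = k *: Hess nb phi xi + Hess nb phi xi'.
Proof.
move=> sphi; pose a := chart_at x.
have aa : atlas a by exact: chart_at_atlas.
have ax : cdom a x by exact: chart_at_dom.
pose F j := frame a (delta_mx 0 j).
have GL j e e' : 'D_(k *: e + e') (pder a phi j) (a x)
      - D phi x (nabla nb (F j) (of_coord a x (k *: e + e'))) =
    k * ('D_e (pder a phi j) (a x) - D phi x (nabla nb (F j) (of_coord a x e)))
    + ('D_e' (pder a phi j) (a x) - D phi x (nabla nb (F j) (of_coord a x e'))).
  have dp : differentiable (pder a phi j) (a x).
    by have [+ _] := pder_smooth j aa sphi 1%N; apply; exact: cmap_cod.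
  have dP : 'D_(k *: e + e') (pder a phi j) (a x) =
      k * 'D_e (pder a phi j) (a x) + 'D_e' (pder a phi j) (a x).
    by rewrite !deriveE//; exact: linearP.
  have S1 : of_coord a x (k *: e + e') = k *: of_coord a x e + of_coord a x e'.
    exact: linearP.
  have S2 : nabla nb (F j) (of_coord a x (k *: e + e')) =
      k *: nabla nb (F j) (of_coord a x e) + nabla nb (F j) (of_coord a x e').
    apply: etrans (congr1 (fun t => nabla nb (F j) (t : tangent M x)) S1) _.
    exact: (nabla_linear nb (cdom_open a) ax (frame_smooth (delta_mx 0 j) aa)).
  have DP : D phi x (nabla nb (F j) (of_coord a x (k *: e + e'))) =
      k * D phi x (nabla nb (F j) (of_coord a x e))
      + D phi x (nabla nb (F j) (of_coord a x e')).
    by apply: etrans (congr1 (D phi x) S2) _; exact: linearP.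
  apply: etrans (congr2 (fun s t : R => s - t) dP DP) _.
  have alg (r A B C D : R) : r * A + B - (r * C + D) = r * (A - C) + (B - D) by ring.
  exact: alg.
have xiE : k *: xi + xi' = of_coord a x (k *: to_coord a xi + to_coord a xi').
  rewrite -[in LHS](to_coordK xi aa ax) -[in LHS](to_coordK xi' aa ax).
  by apply: esym; exact: linearP.
apply/lfunP => eta; rewrite add_lfunE scale_lfunE xiE.
rewrite -[in RHS](to_coordK xi aa ax) -[in RHS](to_coordK xi' aa ax).
rewrite !Hess_frame// scaler_sumr -big_split; apply: eq_bigr => j _ /=.
apply: etrans (congr1 (fun t => to_coord a eta 0 j * t) (GL j _ _)) _.
have alg (q A B : R) : q * (k * A + B) = k * (q * A) + q * B by ring.
exact: alg.
Qed.

(** The classical formula: second partial derivatives minus Christoffel symbols times first ones.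
    The connection may have torsion, so the order of indices matters: in [christoffel a j i] the
    direction of differentiation comes first. *)
Lemma Hess_coord a (phi : M -> R) x v i :
  atlas a -> smooth_fun phi -> cdom a x ->
  Hess nb phi (of_coord a x v) (of_coord a x (delta_mx 0 i)) =
  'D_v (pder a phi i) (a x)
  - \sum_j \sum_k v 0 j * christoffel a j i (a x) 0 k * pder a phi k (a x).
Proof.
move=> aa sphi ax; rewrite Hess_frame// of_coordK// (bigD1 i)//= big1 ?addr0; last first.
  by move=> j ji; rewrite mxE (negbTE ji) andbF mul0r.
rewrite mxE !eqxx mul1r; congr (_ - _).
rewrite {1}of_coord_sum (nabla_sum_dir _ _ _ (cdom_open a) ax (frame_smooth _ aa)).
rewrite linear_sum; apply: eq_bigr => j _.
rewrite linearZ -[LHS]/(v 0 j * D phi x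
  (nabla nb (frame a (delta_mx 0 i)) (frame a (delta_mx 0 j) x))).
rewrite -[nabla _ _ _](to_coordK _ aa ax) D_coord_sum// mulr_sumr; apply: eq_bigr => k _.
by rewrite /christoffel cmapK// mulrA.
Qed.

Lemma christoffel_continuous a i j u : atlas a -> ccod a u ->
  {for u, continuous (christoffel a i j)}.
Proof.
move=> aa au.
have := nabla_smooth nb (cdom_open a)
  (frame_smooth (delta_mx 0 i) aa) (frame_smooth (delta_mx 0 j) aa).
by move=> /(_ a aa 0%N) /(_ u); apply; split=> //; exact: cinv_dom.
Qed.

End HessianCoordinates.

(** * KKT vector field in coordinates *)

Section KKTCoordinates.
Context {R : realType} {n : nat} {M : manifold R n} (nb : connection M).
Context {l m : nat} (f : M -> R) (h : 'I_l -> M -> R) (g : 'I_m -> M -> R).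
Context (f_smooth : smooth_fun f) (h_smooth : forall i, smooth_fun (h i))
  (g_smooth : forall j, smooth_fun (g j)).
Context (a : chart R n M) (aa : atlas a).

Local Notation E := ('rV[R]_n * 'rV[R]_l * 'rV[R]_m * 'rV[R]_m)%type.

Definition lagr_pder (i : 'I_n) (p : E) : R^o :=
  pder a f i p.1.1.1 + \sum_r p.1.1.2 0 r * pder a (h r) i p.1.1.1
  + \sum_j p.1.2 0 j * pder a (g j) i p.1.1.1.

Definition lagr_pder' (i : 'I_n) (p d : E) : R^o :=
  'D_(d.1.1.1) (pder a f i) p.1.1.1
  + \sum_r (d.1.1.2 0 r * pder a (h r) i p.1.1.1
            + p.1.1.2 0 r * 'D_(d.1.1.1) (pder a (h r) i) p.1.1.1)
  + \sum_j (d.1.2 0 j * pder a (g j) i p.1.1.1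
            + p.1.2 0 j * 'D_(d.1.1.1) (pder a (g j) i) p.1.1.1).

(* The suffix C marks the expression of an object in the chart [a]; primed and
   d-prefixed functions are derivatives in the direction [d]. *)
Definition zetaC (p : E) : E :=
  (\row_i lagr_pder i p, \row_i h i (cinv a p.1.1.1),
   \row_j (g j (cinv a p.1.1.1) + p.2 0 j), \row_j (p.1.2 0 j * p.2 0 j)).

Definition dzetaC (p d : E) : E :=
  (\row_i lagr_pder' i p d,
   \row_i 'D_(d.1.1.1) (h i \o cinv a : _ -> R^o) p.1.1.1,
   \row_j ('D_(d.1.1.1) (g j \o cinv a : _ -> R^o) p.1.1.1 + d.2 0 j),
   \row_j (d.1.2 0 j * p.2 0 j + p.1.2 0 j * d.2 0 j)).

Lemma smooth_c2 (U : set 'rV[R]_n) (phi : 'rV[R]_n -> R^o) (p : E) : open U ->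
  smooth_on U phi -> U p.1.1.1 ->
  c2_at p (fun q : E => phi q.1.1.1) (fun q d => 'D_(d.1.1.1) phi q.1.1.1).
Proof.
move=> oU sphi Up.
apply: (@c2_comp_lin _ _ _ _ p (fun q : E => q.1.1.1) phi (fun u d => 'D_d phi u)).
- by [].
- move=> v; do 2 (apply: le_trans (fst_norm_le _) _); exact: fst_norm_le.
- exact: Ck2_c2_at (finite_dim_rV n) oU Up (sphi 2%N).
Qed.

Lemma c2_coord_lin q (p : E) (L : E -> 'rV[R]_q) i : linear L ->
  (forall v, `|L v| <= `|v|) ->
  c2_at p (fun u : E => L u 0 i : R^o) (fun _ d => L d 0 i).
Proof.
move=> Ll Lk; apply: (@c2_lin _ _ _ p (fun u => L u 0 i : R^o) 1).
  by move=> k u v; rewrite Ll !mxE.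
by move=> v; rewrite mul1r; apply: le_trans (coord_le_norm _ _) (Lk v).
Qed.

Lemma zetaC_c2 p : ccod a p.1.1.1 -> c2_at p zetaC dzetaC.
Proof.
move=> ap; have oa := @ccod_open _ _ _ a.
have cy r : c2_at p (fun q : E => q.1.1.2 0 r : R^o) (fun _ d => d.1.1.2 0 r).
  apply: (@c2_coord_lin _ p (fun q => q.1.1.2)) => // v.
  by do 2 (apply: le_trans _ (fst_norm_le _)); exact: snd_norm_le.
have cz r : c2_at p (fun q : E => q.1.2 0 r : R^o) (fun _ d => d.1.2 0 r).
  apply: (@c2_coord_lin _ p (fun q => q.1.2)) => // v.
  by apply: le_trans _ (fst_norm_le _); exact: snd_norm_le.
have cs r : c2_at p (fun q : E => q.2 0 r : R^o) (fun _ d => d.2 0 r).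
  apply: (@c2_coord_lin _ p (fun q => q.2)) => // v; exact: snd_norm_le.
apply: c2_pair; first (apply: c2_pair; first apply: c2_pair).
- apply: (@c2_row _ _ _ p lagr_pder lagr_pder') => i.
  apply: c2_add; first apply: c2_add.
  + apply: smooth_c2 oa (pder_smooth i aa f_smooth) ap.
  + apply: c2_sum => r; apply: (c2_mul (cy r)).
    exact: smooth_c2 oa (pder_smooth i aa (h_smooth r)) ap.
  + apply: c2_sum => r; apply: (c2_mul (cz r)).
    exact: smooth_c2 oa (pder_smooth i aa (g_smooth r)) ap.
- apply: (@c2_row _ _ _ p (fun i (q : E) => h i (cinv a q.1.1.1) : R^o)
    (fun i (q d : E) => 'D_(d.1.1.1) (h i \o cinv a : _ -> R^o) q.1.1.1)) => i.
  exact: (smooth_c2 oa (chart_fun_smooth aa (h_smooth i)) ap).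
- apply: (@c2_row _ _ _ p (fun i (q : E) => g i (cinv a q.1.1.1) + q.2 0 i : R^o)
    (fun i (q d : E) => 'D_(d.1.1.1) (g i \o cinv a : _ -> R^o) q.1.1.1 + d.2 0 i)) => i.
  by apply: c2_add (cs i); exact: (smooth_c2 oa (chart_fun_smooth aa (g_smooth i)) ap).
- apply: (@c2_row _ _ _ p (fun i (q : E) => q.1.2 0 i * q.2 0 i : R^o)
    (fun i (q d : E) => d.1.2 0 i * q.2 0 i + q.1.2 0 i * d.2 0 i)) => i.
  exact: c2_mul.
Qed.

(** The covector with components Gamma^k_{ji} v^j w_k, summed over [j] and [k]. Here [w] will be the
    differential of the Lagrangian. *)
Definition gammaC (v w u : 'rV[R]_n) : 'rV[R]_n :=
  \row_i \sum_k (\sum_j v 0 j * christoffel nb a j i u 0 k) * w 0 k.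

(* [Jzeta] is the derivative of [zeta] up to a Christoffel term which is linear in
   the first component of [zeta], hence vanishes at its zeros. *)
Definition JzetaC (p d : E) : E :=
  dzetaC p d - (gammaC d.1.1.1 (zetaC p).1.1.1 p.1.1.1, 0, 0, 0).

Lemma gammaC_bound u : ccod a u ->
  exists r K, [/\ 0 < r, 0 <= K &
    forall u' v w, `|u' - u| < r -> `|gammaC v w u'| <= K * `|v| * `|w|].
Proof.
move=> au.
pose I := ('I_n * 'I_n * 'I_n)%type.
(* The index triples are enumerated by one ordinal, so that a single application of
   [near_ball_bound] controls all Christoffel symbols at once. *)
pose F (i : 'I_#|{: I}|) (u' : 'rV[R]_n) : R^o :=
  let t := enum_val i in christoffel nb a t.1.1 t.1.2 u' 0 t.2.
have cF i : {for u, continuous (F i)}.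
  apply: (@continuous_comp _ _ _
    (christoffel nb a (enum_val i).1.1 (enum_val i).1.2)
    (fun M : 'rV[R]_n => M 0 (enum_val i).2)).
    exact: christoffel_continuous.
  exact: coord_continuous.
have [r [K [r0 K0 b]]] := near_ball_bound (@ccod_open _ _ _ a) au cF.
exists r, (n%:R * n%:R * K); split=> //; first by rewrite !mulr_ge0.
move=> u' v w /b[_ bK].
have bb j i k : `|christoffel nb a j i u' 0 k| <= K.
  by have := bK (enum_rank (j, i, k)); rewrite /F enum_rankK.
apply: rV_norm_le => [|i]; first by rewrite !mulr_ge0.
rewrite mxE; apply: le_trans (ler_norm_sum _ _ _) _.
apply: (@le_trans _ _ (\sum_(k < n) (\sum_(j < n) `|v| * K) * `|w|)).
  apply: ler_sum => k _; rewrite normrM; apply: ler_pM => //; last exact: coord_le_norm.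
  apply: le_trans (ler_norm_sum _ _ _) _; apply: ler_sum => j _.
  by rewrite normrM; apply: ler_pM => //; exact: coord_le_norm.
rewrite !sumr_const !card_ord -[_ *+ n]mulr_natl -[X in n%:R * (X * _)]mulr_natl.
by rewrite le_eqVlt; apply/orP; left; apply/eqP; ring.
Qed.

Definition covC (w : KK M l m) (v : Cotangent w) : E :=
  (cov_coord a v.1.1.1, v.1.1.2, v.1.2, v.2).

Definition muC (mu : R) : E := (0, 0, 0, const_mx mu).

Definition tangentC (w : KK M l m) (xi : Tangent w) : E :=
  (to_coord a xi.1.1.1, xi.1.1.2, xi.1.2, xi.2).

Lemma zeta_coord (w : KK M l m) mu : cdom a w.1.1.1 ->
  covC (zeta f h g mu w) = zetaC (Kcoord a w) - muC mu.
Proof.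
move=> aw; case: w aw => [[[x y] z] s] /= ax.
rewrite /covC /zeta /zetaC /muC /Kcoord /=.
rewrite -[RHS]/((_ - 0, _ - 0, _ - 0, _ - const_mx mu)) !subr0 !cmapK//.
congr (_, _, _, _).
- apply/rowP => i; rewrite !mxE add_lfunE add_lfunE /AE /AI !sum_lfunE.
  rewrite !D_frame// /lagr_pder /=; congr (_ + _ + _); apply: eq_bigr => r _;
    by rewrite scale_lfunE -/(frame a _ x) D_frame.
- by apply/rowP => j; rewrite !mxE.
- by rewrite mul_mx_diag; congr (_ - _); apply/rowP => j; rewrite !mxE.
Qed.

(** Regroups the Christoffel terms: contracting the differential of the Lagrangian is the same as
    contracting those of [f], [h] and [g] and then weighting with the multipliers. *)
Lemma big_lin3 (C A : 'I_n -> R) (y : 'I_l -> R) B (z : 'I_m -> R) G :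
  \sum_k C k * (A k + \sum_r y r * B r k + \sum_j z j * G j k) =
  \sum_k C k * A k + \sum_r y r * (\sum_k C k * B r k) + \sum_j z j * (\sum_k C k * G j k).
Proof.
under eq_bigr do rewrite !mulrDr !mulr_sumr.
rewrite !big_split /=; congr (_ + _ + _); rewrite exchange_big; apply: eq_bigr => r _;
  by rewrite mulr_sumr; apply: eq_bigr => k _; rewrite mulrCA.
Qed.

Lemma Hess_gamma (phi : M -> R) x (xi : tangent M x) i : smooth_fun phi -> cdom a x ->
  Hess nb phi xi (of_coord a x (delta_mx 0 i)) =
  'D_(to_coord a xi) (pder a phi i) (a x)
  - \sum_k (\sum_j to_coord a xi 0 j * christoffel nb a j i (a x) 0 k) * pder a phi k (a x).
Proof.
move=> sphi ax; rewrite -{1}(to_coordK xi aa ax) Hess_coord//; congr (_ - _).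
by rewrite exchange_big; apply: eq_bigr => k _; rewrite mulr_suml.
Qed.

(** Each Hessian carries a Christoffel correction contracted with the differential of its own
    function. Weighted by the multipliers, these corrections add up to a contraction with the
    differential of the Lagrangian, the first block of [zetaC]. The other blocks contain no Hessian
    and need no correction. *)
Lemma Jzeta_coord (w : KK M l m) (xi : Tangent w) : cdom a w.1.1.1 ->
  covC (Jzeta nb f h g w xi) = JzetaC (Kcoord a w) (tangentC xi).
Proof.
move=> aw; case: w aw xi => [[[x y] z] s] /= ax [[[xix xiy] xiz] xis].
rewrite /covC /Jzeta /JzetaC /dzetaC /zetaC /tangentC /Kcoord /=.
rewrite -[RHS]/((_ - _, _ - 0, _ - 0, _ - 0)) !subr0.
congr (_, _, _, _).
- apply/rowP => i; rewrite !mxE /HessL /AE /AI.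
  rewrite !add_lfunE !sum_lfunE /=.
  pose C k := \sum_j to_coord a xix 0 j * christoffel nb a j i (a x) 0 k.
  under [in RHS]eq_bigr do rewrite mxE.
  rewrite [X in _ = _ - X](big_lin3 C).
  under eq_bigr do rewrite scale_lfunE Hess_gamma//.
  under [X in _ + X + _ + _ = _]eq_bigr do rewrite scale_lfunE Hess_gamma//.
  under [X in _ + X + _ = _]eq_bigr do rewrite scale_lfunE D_coord//.
  under [X in _ + X = _]eq_bigr do rewrite scale_lfunE D_coord//.
  rewrite Hess_gamma//.
  have sc (r : R) (t : R^o) : r *: t = r * t by [].
  under eq_bigr do rewrite sc mulrBr.
  under [X in _ + X + _ + _ = _]eq_bigr do rewrite sc mulrBr.
  rewrite /lagr_pder' /=.
  rewrite !big_split /= !sumrN.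
  have alg (A S B Sh Z Sg H G : R) : A - S + (B - Sh) + (Z - Sg) + H + G =
    A + (H + B) + (G + Z) - (S + Sh + Sg) by ring.
  exact: alg.
- by apply/rowP => j; rewrite !mxE (D_to_coord _ (h_smooth j) aa ax).
- by apply/rowP => j; rewrite !mxE (D_to_coord _ (g_smooth j) aa ax).
- by rewrite !mul_mx_diag; apply/rowP => j; rewrite !mxE [xis 0 j * _]mulrC.
Qed.

End KKTCoordinates.

(** * Retraction in coordinates *)

Section RetractionCoordinates.
Context {R : realType} {n : nat} {M : manifold R n} (Rt : retraction M).
Context (a : chart R n M) (aa : atlas a).

Local Notation P := ('rV[R]_n * 'rV[R]_n)%type.

Definition retrC (p : P) : M := retr Rt (of_coord a (cinv a p.1) p.2).

Lemma retrC_smooth : smooth_map_on [set p : P | ccod a p.1] retrC.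
Proof. exact: retr_smooth. Qed.

Lemma retrC0 u : retrC (u, 0) = cinv a u.
Proof.
rewrite /retrC /=; rewrite -[X in of_coord _ _ X](scale0r (0 : 'rV[R]_n)).
rewrite /of_coord linearZ; exact: retr_start.
Qed.

Lemma retrC_dom_open : open [set p : P | ccod a p.1 /\ cdom a (retrC p)].
Proof.
rewrite openE => p [ap Fp]; rewrite /interior.
have op : nbhs p [set p : P | ccod a p.1].
  have := open_nbhs_nbhs (conj (@ccod_open _ _ _ a) ap).
  exact: (@cvg_fst _ _ (nbhs p.1) (nbhs p.2)).
apply: filterI => //.
by apply: (retrC_smooth.1 p ap); exact: cdom_nbhs.
Qed.

(** [retr_velocity] is stated in the chart [chart_at x]; the chain rule carries it over to [a],
    where the transition map undoes [of_coord]. The change of chart is legitimate for small [t]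
    only, when the curve is still in the domain of [chart_at x]. *)
Lemma retr_curve_derive u v : ccod a u ->
  is_derive (0 : R^o) 1 (fun t : R^o => a (retrC (u, t *: v))) v.
Proof.
move=> au; pose x := cinv a u; pose b := chart_at x.
have ab : atlas b by exact: chart_at_atlas.
have bx : cdom b x by exact: chart_at_dom.
have ax : cdom a x by exact: cinv_dom.
pose xi : tangent M x := of_coord a x v.
pose c (t : R^o) := b (retr Rt (t *: xi)).
have E t : retrC (u, t *: v) = retr Rt (t *: xi).
  by rewrite /retrC /= /of_coord linearZ.
have [dc cE] := retr_velocity Rt xi; rewrite -/b -/c in dc cE.
have dc1 : differentiable c 0 by apply/derivable1_diffP.
have c0 : c 0 = b x by rewrite /c retr_start.
have [dG dE] := diff_comp_at c0 dc1 (transition_diff ab aa bx ax).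
have cont : {for 0, continuous (fun t : R^o => retrC (u, t *: v))}.
  apply: (@continuous_comp _ _ _ (fun t : R^o => (u, t *: v))).
    have c1 : (fun t : R^o => t *: v) @ (0 : R^o) --> (0 : R^o) *: v.
      exact: scalel_continuous.
    exact: (cvg_pair (cvg_cst u) c1).
  by apply: retrC_smooth.1; exact: au.
have N : \forall t \near (0 : R^o), ((a \o cinv b) \o c) t = a (retrC (u, t *: v)).
  have : \forall t \near (0 : R^o), cdom b (retrC (u, t *: v)).
    by apply: cont; rewrite scale0r retrC0; exact: cdom_nbhs.
  by apply: filterS => t; rewrite E /c /= => bt; rewrite cmapK.
have [dH HE] := near_eq_diff N dG.
split; first by apply: diff_derivable.
apply: etrans (deriveE _ dH) _.
apply: etrans (congr1 (fun F => F 1) HE) _.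
apply: etrans (congr1 (fun F => F 1) dE) _.
have cE' : 'd c 0 1 = xi by apply: etrans (esym (deriveE _ dc1)) cE.
apply: etrans (congr1 ('d (a \o cinv b) (b x)) cE') _.
exact: (of_coordK v aa ax).
Qed.

Lemma retrC_derive u v : ccod a u ->
  'D_((0, v) : P) (a \o retrC) (u, 0) = v.
Proof.
move=> au; have [_ {2}<-] := retr_curve_derive v au.
rewrite /derive; apply: (congr1 (fun F : R -> 'rV[R]_n => lim (F @ 0^')));
  apply/funext => t.
have E s : s *: ((0, v) : P) + (u, 0) = (u, s *: v).
  by congr pair; rewrite /= ?scaler0 ?add0r ?addr0.
by rewrite /= E scale0r addr0 [_ *: 1]mulr1.
Qed.

(** The second-order estimate is used between [(u, v)] and [(u, 0)]. At [(u, 0)] the value is [u]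
    and the derivative along [(0, v)] is [v], so what remains is quadratic in [v], with a constant
    uniform in the base point [u]. *)
Lemma retrC_estimate u0 : ccod a u0 ->
  exists r K, [/\ 0 < r, 0 <= K & forall u v, `|u - u0| < r -> `|v| < r ->
    [/\ ccod a u, cdom a (retrC (u, v)) & `|a (retrC (u, v)) - u - v| <= K * `|v| ^+ 2]].
Proof.
move=> au0; pose U := [set p : P | ccod a p.1 /\ cdom a (retrC p)].
have oU : open U by exact: retrC_dom_open.
have U0 : U (u0, 0) by rewrite /U /= retrC0; split=> //; exact: cinv_dom.
have sF : smooth_on U (a \o retrC) by exact: retrC_smooth.2.
have cF i : c2_at (u0, 0) (fun p : P => a (retrC p) 0 i : R^o)
    (fun p d => 'D_d (fun p : P => a (retrC p) 0 i : R^o) p).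
  apply: (Ck2_c2_at _ oU U0); first by apply: finite_dim_prod; exact: finite_dim_rV.
  exact: (Ck_coord i oU (sF 2%N)).
have [r [K [r0 K0 c]]] := c2_row cF.
have : nbhs ((u0, 0) : P) U by exact: open_nbhs_nbhs.
move=> /nbhs_ballP[r' /= r'0 r'U].
exists (Num.min r r'), K; split=> //; first by rewrite lt_min r0.
move=> u v; rewrite !lt_min => /andP[ur ur'] /andP[vr vr'].
have dist w : `|((u, w) : P) - (u0, 0)| = Num.max `|u - u0| `|w|.
  by rewrite prod_normE /= subr0.
have inU w : `|w| < r' -> U (u, w).
  by move=> wr; apply: r'U; rewrite -ball_normE /ball_ /= distrC dist gt_max ur'.
have Uu0 : U (u, 0) by apply: inU; rewrite normr0.
have [au Fu] := inU v vr'; split=> //.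
have dv : `|((u, v) : P) - (u0, 0)| < r by rewrite dist gt_max ur.
have d0 : `|((u, 0) : P) - (u0, 0)| < r by rewrite dist gt_max ur normr0.
have [_ _ _ _ [_]] := c (u, v) (u, 0) dv d0.
have -> : ((u, v) : P) - (u, 0) = (0, v) by congr pair; rewrite /= ?subrr ?subr0.
have -> : `|((0, v) : P)| = `|v| by rewrite prod_normE /= normr0 max_r.
congr (`|_| <= _); apply/rowP => i; rewrite !mxE retrC0 cinvK//; congr (_ - _ - _).
have dF : differentiable (a \o retrC) (u, 0) by apply: (sF 1%N).1.
by rewrite (@derive_coord _ _ _ (a \o retrC))// retrC_derive.
Qed.

End RetractionCoordinates.

(** * Nonsingularity *)

Section LinearAlgebra.
Context {K : fieldType}.

Lemma injective_linear_bijective (U V : vectType K) (L : U -> V) :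
  linear L -> dim U = dim V -> (forall u, L u = 0 -> u = 0) -> bijective L.
Proof.
move=> Llin dUV Linj.
pose F := linfun (HB.pack L (GRing.isLinear.Build _ _ _ _ L Llin) : {linear U -> V}).
have FE u : F u = L u by rewrite lfunE.
have kF : lker F == 0%VS.
  apply/eqP/vspaceP => u; rewrite memv_ker memv0 FE.
  apply/eqP/eqP => [/Linj//|->].
  by have := Llin (-1) 0 0; rewrite scaleN1r oppr0 addr0 scaleN1r addNr.
have imF : limg F = fullv.
  apply/eqP; rewrite eqEdim subvf /= limg_dim_eq ?(eqP kF) ?capv0//.
  by rewrite !dimvf dUV.
exists (F^-1)%VF => v; rewrite -FE; first exact: lker0_lfunK.
by apply: limg_lfunVK; rewrite imF memvf.
Qed.

Lemma free_map_coef (V : vectType K) (T : eqType) (s : seq T) (F : T -> V)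
    (c : T -> K) : free [seq F i | i <- s] ->
  \sum_(i <- s) c i *: F i = 0 -> forall i, i \in s -> c i = 0.
Proof.
move=> frs sum0 i is_.
have := @freeP _ _ _ (in_tuple [seq F j | j <- s]) frs (fun j => c (nth i s j)).
have -> : \sum_(j < size [seq F j | j <- s])
    c (nth i s j) *: (in_tuple [seq F j | j <- s])`_j = 0.
  rewrite -[RHS]sum0 [RHS](big_nth i)
    -(big_mkord xpredT (fun j => c (nth i s j) *: [seq F j0 | j0 <- s]`_j)).
  rewrite size_map big_nat [RHS]big_nat; apply: eq_bigr => j /andP[_ js].
  by rewrite (nth_map i).
have isz : (index i s < size [seq F j | j <- s])%N by rewrite size_map index_mem.
by move=> /(_ erefl (Ordinal isz)) /=; rewrite nth_index.
Qed.

(** Adapted to the form of [LICQ]. The spans of the two families meet only in [0], so each of the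
    two sums vanishes by itself. *)
Lemma free_cat_coef (V : vectType K) (T1 T2 : eqType) (s1 : seq T1) (s2 : seq T2)
    (F1 : T1 -> V) (F2 : T2 -> V) (c1 : T1 -> K) (c2 : T2 -> K) :
  free ([seq F1 i | i <- s1] ++ [seq F2 i | i <- s2]) ->
  \sum_(i <- s1) c1 i *: F1 i + \sum_(i <- s2) c2 i *: F2 i = 0 ->
  (forall i, i \in s1 -> c1 i = 0) /\ (forall i, i \in s2 -> c2 i = 0).
Proof.
rewrite cat_free => /and3P[fr1 fr2 /directv_addP dir] /eqP.
have mem (T : eqType) (s : seq T) (F : T -> V) (c : T -> K) :
    \sum_(i <- s) c i *: F i \in <<[seq F i | i <- s]>>%VS.
  by rewrite big_seq; apply: memv_suml => i si; apply/memvZ/memv_span/map_f.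
rewrite addr_eq0 => /eqP E.
have S1 : \sum_(i <- s1) c1 i *: F1 i = 0.
  apply/eqP; rewrite -memv0 -dir memv_cap mem /= E rpredN; exact: mem.
have S2 : \sum_(i <- s2) c2 i *: F2 i = 0.
  by apply/eqP; rewrite -oppr_eq0 -E S1.
by split; apply: free_map_coef; eauto.
Qed.

End LinearAlgebra.

Section Nonsingular.
Context {R : realType} {n : nat} {M : manifold R n} (nb : connection M).
Context {l m : nat} (f : M -> R) (h : 'I_l -> M -> R) (g : 'I_m -> M -> R).
Context (f_smooth : smooth_fun f) (h_smooth : forall i, smooth_fun (h i))
  (g_smooth : forall j, smooth_fun (g j)).

Lemma HessL_linear x y z (k : R) (xi xi' : tangent M x) :
  HessL nb f h g y z (k *: xi + xi') = k *: HessL nb f h g y z xi + HessL nb f h g y z xi'.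
Proof.
rewrite /HessL Hess_linear// !scalerDr !scaler_sumr.
under eq_bigr do rewrite Hess_linear// scalerDr scalerA mulrC -scalerA.
under [X in _ + X = _]eq_bigr do rewrite Hess_linear// scalerDr scalerA mulrC -scalerA.
rewrite !big_split /= [RHS]addrACA; congr (_ + _); exact: addrACA.
Qed.

Lemma Jzeta_linear (w : KK M l m) (k : R) (xi xi' : Tangent w) :
  Jzeta nb f h g w (k *: xi + xi') = k *: Jzeta nb f h g w xi + Jzeta nb f h g w xi'.
Proof.
case: w xi xi' => [[[x y] z] s] [[[xx xy] xz] xs] [[[xx' xy'] xz'] xs'].
rewrite /Jzeta /=; congr (_, _, _, _).
- rewrite HessL_linear /AE /AI.
  under eq_bigr do rewrite !mxE scalerDl -scalerA.
  under [X in _ + X = _]eq_bigr do rewrite !mxE scalerDl -scalerA.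
  rewrite !big_split /= -!scaler_sumr !scalerDr [RHS]addrACA; congr (_ + _); exact: addrACA.
- by apply/rowP => i; rewrite !mxE; exact: linearP.
- apply/rowP => i; rewrite !mxE mulrDr [RHS]addrACA; congr (_ + _); exact: linearP.
- rewrite !mul_mx_diag; apply/rowP => j; rewrite !mxE; ring.
Qed.

(** Injectivity suffices because the dual of the tangent space has its dimension, so that both sides
    of [Jzeta] have equal dimension. *)
Lemma Jzeta_bijective (w : KK M l m) :
  (forall xi, Jzeta nb f h g w xi = 0 -> xi = 0) -> bijective (Jzeta nb f h g w).
Proof.
move=> inj.
apply: (@injective_linear_bijective R ('rV[R]_n * 'rV[R]_l * 'rV[R]_m * 'rV[R]_m)%type
  ('Hom('rV[R]_n, R^o) * 'rV[R]_l * 'rV[R]_m * 'rV[R]_m)%type) => //.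
- by move=> k xi xi'; exact: Jzeta_linear.
- by do 6 rewrite ?/dim /=; rewrite ?mul1n ?muln1.
Qed.

Lemma KKT_nonsingular (w : KK M l m) : KKT_point f h g w -> LICQ h g w.1.1.1 ->
  strict_complementarity g w -> SOSC nb f h g w ->
  forall xi, Jzeta nb f h g w xi = 0 -> xi = 0.
Proof.
case: w => [[[x y] z] s] /= [[_ _ gle0 z0 comp] sE] licq sc sosc.
case=> [[[xx xy] xz] xs]; rewrite /Jzeta /= => -[] J1 J2 J3 J4.
rewrite /strict_complementarity /= in sc.
have J2' i : D (h i) x xx = 0 by move/rowP : J2 => /(_ i); rewrite !mxE.
have J3' j : D (g j) x xx + xs 0 j = 0 by move/rowP : J3 => /(_ j); rewrite !mxE.
have J4' j : xz 0 j * - g j x + xs 0 j * z 0 j = 0.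
  by move/rowP : J4 => /(_ j); rewrite sE !mul_mx_diag !mxE.
(* On the active set the slack is zero, so the fourth block reduces to [xs 0 j * z 0 j = 0] with a
   positive multiplier. Off it, complementarity makes the multiplier zero while the slack is not,
   and the same block gives [xz 0 j = 0]. *)
have act j : j \in active g x -> xs 0 j = 0.
  move=> ja; have := J4' j; move: (ja); rewrite inE => /eqP ->.
  rewrite oppr0 mulr0 add0r => /eqP; rewrite mulf_eq0 => /orP[/eqP//|/eqP zj].
  by have := sc j ja; rewrite zj ltxx.
have inact j : j \notin active g x -> xz 0 j = 0.
  rewrite inE => gj; have /eqP := comp j; rewrite mulf_eq0 (negbTE gj) orbF => /eqP zj.
  have := J4' j; rewrite zj mulr0 addr0 => /eqP; rewrite mulf_eq0 oppr_eq0 (negbTE gj) orbF.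
  by move/eqP.
have Dact j : j \in active g x -> D (g j) x xx = 0.
  by move=> ja; have := J3' j; rewrite act// addr0.
have xx0 : xx = 0.
  (* By [J2'] and [Dact], [xx] lies in the critical subspace on which SOSC is positive. *)
  apply/eqP; apply: contraT => xxn0; have := sosc xx xxn0 J2' Dact.
  suff -> : HessL nb f h g y z xx xx = 0 by rewrite ltxx.
  have := congr1 (fun F : 'Hom(_, _) => F xx) J1; rewrite !add_lfunE zero_lfunE.
  have -> : AE h x xy xx = 0.
    by rewrite /AE sum_lfunE big1// => i _; rewrite scale_lfunE J2' scaler0.
  have -> : AI g x xz xx = 0.
    rewrite /AI sum_lfunE big1// => j _; rewrite scale_lfunE.
    by have [/Dact ->|/inact ->] := boolP (j \in active g x); rewrite ?scaler0 ?scale0r.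
  by rewrite !addr0.
have xs0 : xs = 0.
  by apply/rowP => j; have := J3' j; rewrite xx0 linear0 add0r mxE.
have H0 : HessL nb f h g y z (0 : tangent M x) = 0.
  have := HessL_linear y z 1 (0 : tangent M x) 0; rewrite !scale1r addr0 => /eqP.
  by rewrite -subr_eq subrr eq_sym => /eqP.
move: J1; rewrite xx0 H0 add0r /AE /AI => J1.
(* Inactive components of [xz] vanish, so the sum involves only the covectors that [LICQ] declares
   independent. *)
have E : \sum_(j <- enum (active g x)) xz 0 j *: D (g j) x = \sum_j xz 0 j *: D (g j) x.
  rewrite big_enum /= [RHS](bigID (fun j => j \in active g x)) /=
    [X in _ = _ + X]big1 ?addr0//.
  by move=> j /inact ->; rewrite scale0r.
have E' : \sum_(i <- enum 'I_l) xy 0 i *: D (h i) x = \sum_i xy 0 i *: D (h i) x.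
  by rewrite big_enum.
have [c1 c2] := @free_cat_coef _ _ _ _ (enum 'I_l) (enum (active g x))
  (fun i => D (h i) x : 'Hom('rV[R]_n, R^o))
  (fun j => D (g j) x : 'Hom('rV[R]_n, R^o)) (fun i => xy 0 i) (fun j => xz 0 j) licq
  (etrans (congr2 +%R E' E) J1).
have xy0 : xy = 0 by apply/rowP => i; rewrite mxE c1// mem_enum.
have xz0 : xz = 0.
  apply/rowP => j; rewrite mxE.
  have [ja|/inact//] := boolP (j \in active g x); by rewrite c2// mem_enum.
by rewrite xy0 xz0 xs0.
Qed.

End Nonsingular.

(** * Newton iteration in a normed space *)

Section Newton.
Context {R : realType} {V : normedModType R}.

(* [rho] is the retraction and [Z] the set of points at which [J] is the exact
   derivative of [F]; the residual [t] accounts for the change of parameter. *)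
Lemma newton_estimate (F : V -> V) (DF J rho : V -> V -> V) (Z : set V) (p0 : V)
    (c r1 K2 K3 : R) :
  c2_at p0 F DF -> 0 < c -> (forall d, c * `|d| <= `|DF p0 d|) ->
  0 < r1 -> 0 <= K2 -> 0 <= K3 -> Z p0 ->
  (forall p, `|p - p0| < r1 -> linear (J p)) ->
  (forall p q d, `|p - p0| < r1 -> `|q - p0| < r1 -> Z q ->
     `|J p d - DF p d| <= K2 * `|p - q| * `|d|) ->
  (forall p v, `|p - p0| < r1 -> `|v| < r1 -> `|rho p v - p - v| <= K3 * `|v| ^+ 2) ->
  exists r K, [/\ 0 < r, 0 <= K,
    forall p d, `|p - p0| < r -> c / 2 * `|d| <= `|J p d| &
    forall p q v t, `|p - p0| < r -> `|q - p0| < r -> Z q -> `|t| <= r ->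
      J p v = F q - F p + t ->
      `|v| < r1 /\ `|rho p v - q| <= K * (`|p - q| ^+ 2 + `|t|)].
Proof.
move=> [r2 [K1 [r20 K10 c2]]] c0 DF0 r10 K20 K30 Zp0 Jlin JDF rhoE.
(* The factor [2 / c] inverts [J p]; [K1], [K2] and [1] account for the Taylor remainder, for the
   difference between [J] and the derivative, and for the residual [t]. *)
pose C0 := 2 / c * (K1 + K2 + 1).
have C00 : 0 < C0 by rewrite /C0 mulr_gt0 ?divr_gt0//; lra.
(* Below [b1], [J p] differs from [DF p0] by at most [c / 2], so half of the lower bound survives.
   Below [b2], the error of the plain step is at most [1] and [r1 / 2]; the [5] comes from e^2 + |t|
   <= 4 r^2 + r <= 5 r, where e = |p - q| < 2 r and r <= 1. *)
pose b1 := c / 2 / (K1 + K2 + 1).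
have b10 : 0 < b1 by rewrite /b1 !divr_gt0//; lra.
pose b2 := Num.min 1 (r1 / 2) / (5 * C0).
have b20 : 0 < b2 by rewrite /b2 divr_gt0 ?lt_min ?ltr01 ?divr_gt0// mulr_gt0.
pose r := Num.min (Num.min r2 (r1 / 4)) (Num.min (Num.min b1 b2) 1).
have r0 : 0 < r by rewrite /r !lt_min r20 b10 b20 ltr01 divr_gt0.
have [rr2 rr1 rb1 rb2 r_1] : [/\ r <= r2, r <= r1 / 4, r <= b1, r <= b2 & r <= 1].
  by rewrite /r !ge_min !lexx !orbT.
have rr1' : r <= r1 by lra.
have rb1' : (K1 + K2) * r <= c / 2.
  have : r * (K1 + K2 + 1) <= c / 2 by rewrite -ler_pdivlMr//; lra.
  have : 0 <= r by exact: ltW. nra.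
have rb2' : C0 * (5 * r) <= Num.min 1 (r1 / 2).
  by rewrite mulrCA mulrA [X in X <= _]mulrC -ler_pdivlMr// mulr_gt0.
have inj p d : `|p - p0| < r -> c / 2 * `|d| <= `|J p d|.
  move=> pr; have pr2 := lt_le_trans pr rr2.
  have p00 x : 0 < x -> `|p0 - p0| < x by rewrite subrr normr0.
  have [_ _ _ /(_ d) h1 _] := c2 p p0 pr2 (p00 _ r20).
  have h2 := JDF p p0 d (lt_le_trans pr rr1') (p00 _ r10) Zp0.
  have h3 := DF0 d.
  have -> : J p d = DF p0 d - ((DF p0 d - DF p d) - (J p d - DF p d)).
    by rewrite opprB addrCA subKr subrK.
  have t1 := lerB_normD (DF p0 d) (- (DF p0 d - DF p d - (J p d - DF p d))).
  have t2 := ler_normB (DF p0 d - DF p d) (J p d - DF p d).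
  rewrite normrN in t1; rewrite [`|DF p0 d - DF p d|]distrC in t2.
  have t3 : K1 * `|p - p0| * `|d| + K2 * `|p - p0| * `|d| <= c / 2 * `|d|.
    rewrite -mulrDl ler_wpM2r// -mulrDl; apply: le_trans rb1'.
    by rewrite ler_wpM2l ?addr_ge0// ltW.
  lra.
(* With S = e^2 + |t|, the retraction contributes at most [K3 * (2 * S + 2 * (C0 * S))] and the
   plain step [C0 * S]. *)
exists r, (2 * K3 + (2 * K3 + 1) * C0); split=> //.
  by have := mulr_ge0 K30 (ltW C00); lra.
move=> p q v t pr qr Zq tr Jv.
have [_ _ _ _ [_ h1]] := c2 q p (lt_le_trans qr rr2) (lt_le_trans pr rr2).
have [DFlin _ _ _ _] := c2 p p (lt_le_trans pr rr2) (lt_le_trans pr rr2).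
have h2 := JDF p q (p - q) (lt_le_trans pr rr1') (lt_le_trans qr rr1') Zq.
set e := `|p - q| in h2 *.
rewrite distrC in h1; rewrite [`|q - p|]distrC -/e in h1.
have Jpl := Jlin p (lt_le_trans pr rr1').
(* [p - q + v] is the error of the plain step [p + v]. Its image under [J p] consists of three small
   terms: the inexactness of [J] on [p - q], a Taylor remainder, and [t]. *)
have JE : J p (p - q + v) = (J p (p - q) - DF p (p - q)) - (DF p (q - p) - (F q - F p)) + t.
  have -> : DF p (q - p) = - DF p (p - q) by rewrite -(opprB p q) (linear_opp _ DFlin).
  have := Jpl 1 (p - q) v; rewrite !scale1r => ->.
  by rewrite Jv -opprD opprK !addrA subrK.
have en : 0 <= e by exact: normr_ge0.
have B : `|p - q + v| <= C0 * (e ^+ 2 + `|t|).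
  have := inj p (p - q + v) pr; rewrite JE => h3.
  have t1 := ler_normD (J p (p - q) - DF p (p - q) - (DF p (q - p) - (F q - F p))) t.
  have t2 := ler_normB (J p (p - q) - DF p (p - q)) (DF p (q - p) - (F q - F p)).
  have h2' : `|J p (p - q) - DF p (p - q)| <= K2 * e ^+ 2 by rewrite expr2 mulrA.
  have h4 : c / 2 * `|p - q + v| <= (K1 + K2 + 1) * (e ^+ 2 + `|t|).
    have : 0 <= e ^+ 2 by rewrite exprn_ge0.
    have : 0 <= `|t| by []. nra.
  rewrite /C0 -mulrA -ler_pdivrMl ?divr_gt0// invf_div; lra.
have e2r : e < 2 * r.
  have : e <= `|p - p0| + `|q - p0|.
    by rewrite /e [`|q - p0|]distrC; exact: ler_distD.
  lra.
have BB : C0 * (e ^+ 2 + `|t|) <= Num.min 1 (r1 / 2).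
  apply: le_trans rb2'; rewrite ler_wpM2l ?(ltW C00)//; nra.
move: BB; rewrite le_min => /andP[BB1 BB2].
have vE : v = (p - q + v) - (p - q) by rewrite [p - q + v]addrC addrK.
have vn : `|v| <= `|p - q + v| + e by rewrite {1}vE; exact: ler_normB.
have vr1 : `|v| < r1 by lra.
split=> //.
have h5 := rhoE p v (lt_le_trans pr rr1') vr1.
have -> : rho p v - q = (rho p v - p - v) + (p - q + v).
  by rewrite [p - q + v]addrC addrA subrK addrA subrK.
apply: le_trans (ler_normD _ _) _.
set S := e ^+ 2 + `|t| in B BB1 BB2 *.
set y := `|p - q + v| in B vn *.
have y0 : 0 <= y by exact: normr_ge0.
(* From |v| <= y + e one gets |v|^2 <= 2 e^2 + 2 y^2, and y <= 1 makes y^2 <= y. *)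
have v2 : `|v| ^+ 2 <= 2 * e ^+ 2 + 2 * y.
  have y1 : y <= 1 by exact: le_trans B BB1.
  have h6 : `|v| ^+ 2 <= (y + e) ^+ 2 by rewrite lerXn2r ?nnegrE ?addr_ge0.
  have h7 : 0 <= (y - e) ^+ 2 by exact: sqr_ge0.
  have h8 : 0 <= y * (1 - y) by rewrite mulr_ge0 ?subr_ge0.
  lra.
have eS : e ^+ 2 <= S by rewrite /S lerDl.
have : K3 * `|v| ^+ 2 <= K3 * (2 * S + 2 * (C0 * S)) by rewrite ler_wpM2l//; lra.
lra.
Qed.

(* Minimise [`|F p - b|] over a small compact ball: a simplified Newton step, taken
   with the derivative at [p0], stays in the ball and halves this quantity. *)
Lemma perturbed_zero (F : V -> V) (DF : V -> V -> V) (p0 : V) (c : R) :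
  c2_at p0 F DF -> F p0 = 0 -> 0 < c -> (forall d, c * `|d| <= `|DF p0 d|) ->
  (forall t, exists d, DF p0 d = t) ->
  (forall s, 0 < s -> compact [set p | `|p - p0| <= s]) ->
  forall r, 0 < r -> exists2 delta, 0 < delta &
    forall b, `|b| <= delta -> exists2 p, `|p - p0| < r & F p = b.
Proof.
move=> [r2 [K [r20 K0 c2]]] F0 c0 DF0 DFs cpt r r0.
(* [r / 2] places the minimiser in the prescribed ball, [r2 / 2] keeps the [c2_on] estimates valid
   on it, and the last bound gives 6 K s <= c, from which the halving follows. *)
pose s := Num.min (Num.min (r / 2) (r2 / 2)) (c / (6 * (K + 1))).
have s0 : 0 < s.
  by rewrite /s !lt_min !divr_gt0// mulr_gt0//; lra.
have [sr sr2 sc] : [/\ s <= r / 2, s <= r2 / 2 & s <= c / (6 * (K + 1))].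
  by rewrite /s !ge_min !lexx !orbT.
have Ks : 6 * K * s <= c.
  have : s * (6 * (K + 1)) <= c by rewrite -ler_pdivlMr//; lra.
  lra.
(* Half of the budget [c * s] is left for [b]; the other half absorbs the Taylor remainder in
   [Tp]. *)
exists (c * s / 2); first by rewrite divr_gt0// mulr_gt0.
move=> b bd; pose A := [set p | `|p - p0| <= s].
have inr2 p : A p -> `|p - p0| < r2 by rewrite /A /= => ?; lra.
have p0A : A p0 by rewrite /A /= subrr normr0 ltW.
have Fcont : {in A, continuous (fun p => `|F p - b|)}.
  move=> p; rewrite inE => Ap; apply/cvgrPdist_le => e e0.
  have nb : \forall q \near p, `|q - p0| < r2 /\ `|q - p| < e / (K + 1).
    have pr2 : 0 < r2 - `|p - p0| by have := inr2 p Ap; lra.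
    have e1 : 0 < e / (K + 1) by rewrite divr_gt0//; lra.
    apply/nbhs_ballP; exists (Num.min (r2 - `|p - p0|) (e / (K + 1))) => /=;
      first by rewrite lt_min pr2.
    move=> q; rewrite -ball_normE /ball_ /= lt_min distrC => /andP[h1 h2]; split=> //.
    by have := ler_distD p q p0; lra.
  apply: filterS nb => q [qr2 qp].
  apply: le_trans (ler_dist_dist _ _) _.
  rewrite opprB addrA subrK.
  have [_ _ _ _ [h _]] := c2 p q (inr2 p Ap) qr2.
  apply: le_trans h _; rewrite distrC in qp *.
  have : `|p - q| * (K + 1) < e by rewrite -ltr_pdivlMr//; lra.
  have : 0 <= `|p - q| by []. lra.
have Acpt : compact A by exact: cpt.
have A0 : A !=set0 by exists p0.
have [p /[!inE] Ap pmin] := compact_EVT_min A0 Acpt (continuous_in_subspaceT Fcont).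
have [d dE] := DFs (b - F p).
have [lin0 _ _ _ _] := c2 p0 p0 (inr2 _ p0A) (inr2 _ p0A).
have d1 : c * `|d| <= `|F p - b| by have := DF0 d; rewrite dE distrC.
have Tp : A (p + d).
  rewrite /A /=.
  (* The first-order parts in [p] cancel, so the distance of the new point to [p0] is governed by
     [b] and a quadratic remainder. *)
  have E : DF p0 (p + d - p0) = b - (F p - F p0 - DF p0 (p - p0)).
    have linD x y : DF p0 (x + y) = DF p0 x + DF p0 y.
      by have := lin0 1 x y; rewrite !scale1r.
    by rewrite [p + d]addrC -addrA linD dE F0 subr0 opprB addrA addrAC.
  have := DF0 (p + d - p0); rewrite E => h.
  have h1 := ler_normB b (F p - F p0 - DF p0 (p - p0)).
  have [_ _ _ _ [_ h2]] := c2 p p0 (inr2 _ Ap) (inr2 _ p0A).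
  have Ap' : `|p - p0| <= s by [].
  have h3 : K * `|p - p0| ^+ 2 <= c * s / 2.
    have : K * `|p - p0| ^+ 2 <= K * s ^+ 2.
      by rewrite ler_wpM2l// lerXn2r ?nnegrE// ltW.
    have : 6 * K * s * s <= c * s by rewrite ler_wpM2r// ltW.
    have : 0 <= K * s * s by rewrite !mulr_ge0// ltW.
    lra.
  have : c * `|p + d - p0| <= c * s by lra.
  by rewrite ler_pM2l.
have h1 := pmin (p + d) (mem_set Tp).
(* Both errors, the Taylor remainder at [p] and the use of the derivative at [p0], are at most a
   multiple of K s |d|: together 3 K s |d| <= c |d| / 2, since |d| <= 2 s. *)
have h2 : `|F (p + d) - b| <= `|F p - b| / 2.
  have pd : p + d - p = d by rewrite addrAC subrr add0r.
  have E : F (p + d) - b =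
      (F (p + d) - F p - DF p (p + d - p)) + (DF p (p + d - p) - DF p0 (p + d - p)).
    by rewrite pd addrA subrK dE opprB addrA subrK.
  rewrite E; have t1 := ler_normD (F (p + d) - F p - DF p (p + d - p))
    (DF p (p + d - p) - DF p0 (p + d - p)).
  have [_ _ _ _ [_ h3]] := c2 (p + d) p (inr2 _ Tp) (inr2 _ Ap).
  have [_ _ _ /(_ (p + d - p)) h4 _] := c2 p p0 (inr2 _ Ap) (inr2 _ p0A).
  rewrite pd in h3 h4 t1 *.
  have d2 : `|d| <= 2 * s.
    have := ler_distD p0 (p + d) p; rewrite pd [`|p0 - p|]distrC => ?.
    have Ap' : `|p - p0| <= s by [].
    have Tp' : `|p + d - p0| <= s by [].
    lra.
  have Ap' : `|p - p0| <= s by [].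
  have h5 : K * `|d| ^+ 2 <= K * (2 * s) * `|d|.
    by rewrite expr2 [leLHS]mulrA ler_wpM2r// ler_wpM2l.
  have h6 : K * `|p - p0| * `|d| <= K * s * `|d| by rewrite ler_wpM2r// ler_wpM2l.
  have h7 : 6 * K * s * `|d| <= c * `|d| by rewrite ler_wpM2r.
  lra.
exists p; first by have Ap' : `|p - p0| <= s by []; lra.
(* Minimality and halving give |F p - b| <= |F p - b| / 2, which forces equality. *)
apply/eqP; rewrite -subr_eq0 -normr_le0.
lra.
Qed.

End Newton.

(** * Newton iteration on the manifold *)

Lemma linear_bijective_bound (R : realType) (V : normedModType R) (L : V -> V) :
  finite_dim V -> linear L -> bijective L ->
  exists2 c, 0 < c & forall d, c * `|d| <= `|L d|.
Proof.
move=> fV Llin [G LG GL].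
have Glin : linear G.
  by move=> k u v; rewrite -{1}(GL u) -{1}(GL v) -Llin LG.
pose GLn : {linear V -> V} := HB.pack G (GRing.isLinear.Build _ _ _ _ G Glin).
have [K K0 KG] := finite_dim_linear_bounded GLn fV.
exists K^-1; first by rewrite invr_gt0.
by move=> d; rewrite -{1}(LG d) ler_pdivrMl//; exact: KG.
Qed.

Section LocalStep.
Context {R : realType} {n : nat} {M : manifold R n}.
Context (nb : connection M) (Rt : retraction M) {l m : nat}.
Context (f : M -> R) (h : 'I_l -> M -> R) (g : 'I_m -> M -> R).
Context (f_smooth : smooth_fun f) (h_smooth : forall i, smooth_fun (h i))
  (g_smooth : forall j, smooth_fun (g j)).
Context (a : chart R n M) (aa : atlas a).

Local Notation E := ('rV[R]_n * 'rV[R]_l * 'rV[R]_m * 'rV[R]_m)%type.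
Local Notation zC := (zetaC f h g a).
Local Notation dzC := (dzetaC f h g a).
Local Notation JC := (JzetaC nb f h g a).

Lemma finite_dim_E : finite_dim E.
Proof. by do !apply: finite_dim_prod; exact: finite_dim_rV. Qed.

Lemma gammaC_linear w u : linear (fun v => gammaC nb a v w u).
Proof.
move=> k v v'; apply/rowP => i; rewrite !mxE mulr_sumr -big_split; apply: eq_bigr => j _ /=.
rewrite mulrA -mulrDl; congr (_ * _); rewrite mulr_sumr -big_split;
  apply: eq_bigr => i' _ /=.
by rewrite !mxE mulrDl mulrA.
Qed.

Lemma gammaC0 v u : gammaC nb a v 0 u = 0.
Proof. by apply/rowP => i; rewrite !mxE big1// => k _; rewrite mxE mulr0. Qed.

Lemma cov_coord_eq0 x (eta : cotangent M x) : cdom a x -> cov_coord a eta = 0 -> eta = 0.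
Proof.
move=> ax e0; apply/lfunP => xi; rewrite zero_lfunE.
rewrite -(to_coordK (xi : tangent M x) aa ax) of_coord_sum.
apply: etrans (linear_sum eta _ _ _) _; apply: big1 => i _.
apply: etrans (linearZ _ _) _.
have := congr1 (fun v : 'rV[R]_n => v 0 i) e0; rewrite !mxE => E0.
by apply: etrans (congr1 (fun t : R^o => to_coord a xi 0 i *: t) E0) _; rewrite scaler0.
Qed.

Lemma covC_eq0 (w : KK M l m) (v : Cotangent w) : cdom a w.1.1.1 -> covC a v = 0 -> v = 0.
Proof.
case: w v => [[[x y] z] s] [[[v1 v2] v3] v4] /= ax [] /(cov_coord_eq0 ax) -> v20 v30 v40.
by rewrite v20 v30 v40.
Qed.

Lemma covCN (w : KK M l m) (v : Cotangent w) : covC (w := w) a (- v) = - covC a v.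
Proof.
by congr (_, _, _, _); apply/rowP => i; rewrite !mxE ?opp_lfunE.
Qed.

Lemma tangentC_onto (w : KK M l m) (d : E) : cdom a w.1.1.1 ->
  exists xi : Tangent w, tangentC a xi = d.
Proof.
case: w d => [[[x y] z] s] [[[d1 d2] d3] d4] ax.
by exists (of_coord a x d1, d2, d3, d4); rewrite /tangentC /= of_coordK.
Qed.

Lemma tangentC_eq0 (w : KK M l m) (xi : Tangent w) : cdom a w.1.1.1 ->
  tangentC a xi = 0 -> xi = 0.
Proof.
case: w xi => [[[x y] z] s] [[[xx xy] xz] xs] /= ax [] x0 y0 z0 s0.
rewrite y0 z0 s0; congr (_, _, _, _); rewrite -(to_coordK xx aa ax) x0.
exact: linear0.
Qed.

(** The work is in the first block: [KKT_point] speaks of the differential of the Lagrangian, [zeta]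
    of a combination of differentials. They are compared in the chart at [x], where smoothness
    allows the sum to be differentiated termwise. *)
Lemma KKT_zeta0 (w : KK M l m) : KKT_point f h g w -> zeta f h g 0 w = 0.
Proof.
case: w => [[[x y] z] s] /= [[DL hx _ _ zg] sE]; rewrite /zeta /=.
have LE : D f x + AE h x y + AI g x z = D (fun x' => Lagrangian f h g x' y z) x.
  pose b := chart_at x.
  have ab : atlas b by exact: chart_at_atlas.
  have bx : cdom b x by exact: chart_at_dom.
  have db phi : smooth_fun phi -> differentiable (phi \o cinv b : _ -> R^o) (b x).
    by move=> sp; apply: chart_fun_differentiable => //; exact: cmap_cod.
  have dsum N (c : 'I_N -> R) (F : 'I_N -> M -> R) v : (forall i, smooth_fun (F i)) ->
      differentiable (fun u => \sum_i c i * F i (cinv b u) : R^o) (b x) /\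
      'D_v (fun u => \sum_i c i * F i (cinv b u) : R^o) (b x) =
      \sum_i c i * 'D_v (F i \o cinv b : _ -> R^o) (b x).
    move=> sF.
    have -> : (fun u => \sum_i c i * F i (cinv b u) : R^o) =
        \sum_i (c i \*: (F i \o cinv b : _ -> R^o)).
      by apply/funext => u; rewrite fct_sumE.
    have d1 i : differentiable (c i \*: (F i \o cinv b : _ -> R^o)) (b x).
      by apply: differentiableZ; exact: db.
    split; first exact: differentiable_sum.
    rewrite derive_sum => [|i]; last exact: diff_derivable.
    by apply: eq_bigr => i _; rewrite deriveZ//; exact: diff_derivable (db _ (sF i)).
  have L1 := fun v => dsum _ (fun i => y 0 i) h v h_smooth.
  have L2 := fun v => dsum _ (fun i => z 0 i) g v g_smooth.
  apply/lfunP => xi; rewrite !add_lfunE /AE /AI !sum_lfunE.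
  rewrite -(to_coordK (xi : tangent M x) ab bx); set v := to_coord b _.
  apply: etrans (congr1 (fun t : R => t + _ + _) (D_of_coord v ab bx (db _ f_smooth))) _.
  have LD : differentiable ((fun x' => Lagrangian f h g x' y z) \o cinv b : _ -> R^o) (b x).
    apply: (@differentiableD _ _ _
      (fun u => f (cinv b u) + \sum_i y 0 i * h i (cinv b u) : R^o)
      (fun u => \sum_j z 0 j * g j (cinv b u) : R^o)); last exact: (L2 0).1.
    by apply: (@differentiableD _ _ _ (f \o cinv b : _ -> R^o));
      [exact: db|exact: (L1 0).1].
  rewrite [RHS](D_of_coord v ab bx LD).
  have -> : 'D_v ((fun x' => Lagrangian f h g x' y z) \o cinv b : _ -> R^o) (b x) =
    'D_v (f \o cinv b : _ -> R^o) (b x)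
    + \sum_i y 0 i * 'D_v (h i \o cinv b : _ -> R^o) (b x)
    + \sum_j z 0 j * 'D_v (g j \o cinv b : _ -> R^o) (b x).
    rewrite -(L1 v).2 -(L2 v).2.
    have d1 : derivable (f \o cinv b : _ -> R^o) (b x) v.
      by apply: diff_derivable; exact: db.
    have d2 : derivable (fun u => \sum_i y 0 i * h i (cinv b u) : R^o) (b x) v.
      by apply: diff_derivable; exact: (L1 v).1.
    have d3 : derivable (fun u => \sum_j z 0 j * g j (cinv b u) : R^o) (b x) v.
      by apply: diff_derivable; exact: (L2 v).1.
    rewrite -(deriveD d1 d2).
    by rewrite -(deriveD (derivableD d1 d2) d3).
  congr (_ + _ + _); apply: eq_bigr => i _; rewrite scale_lfunE.
    by congr (_ *: _); exact: (D_of_coord v ab bx (db _ (h_smooth i))).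
  by congr (_ *: _); exact: (D_of_coord v ab bx (db _ (g_smooth i))).
rewrite LE DL; congr (_, _, _, _).
- by apply/rowP => i; rewrite !mxE hx.
- by rewrite sE addrN.
- by apply/rowP => j; rewrite mul_mx_diag sE !mxE mulrN zg !oppr0 addr0.
Qed.

Definition retrE (p v : E) : E :=
  (a (retrC Rt a (p.1.1.1, v.1.1.1)), p.1.1.2 + v.1.1.2, p.1.2 + v.1.2, p.2 + v.2).

Lemma retrK_coord (w : KK M l m) (xi : Tangent w) : cdom a w.1.1.1 ->
  Kcoord a (retrK Rt xi) = retrE (Kcoord a w) (tangentC a xi) /\
  (retrK Rt xi).1.1.1 = retrC Rt a (a w.1.1.1, to_coord a xi.1.1.1).
Proof.
move=> ax.
have E1 : (retrK Rt xi).1.1.1 = retrC Rt a (a w.1.1.1, to_coord a xi.1.1.1).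
  by rewrite /retrC /= cmapK// to_coordK.
by split=> //; rewrite /Kcoord E1.
Qed.

Lemma muC_dist mu nu : `|muC mu - muC nu : E| <= `|mu - nu|.
Proof.
apply: pair_norm_le; [apply: pair_norm_le; [apply: pair_norm_le|]|];
  rewrite /= ?subrr ?normr0//.
by apply: rV_norm_le => // i; rewrite !mxE.
Qed.

(** The parameter moves to the right-hand side, so that zeros for all [mu] are preimages under one
    and the same map; this is the form in which [perturbed_zero] supplies them. *)
Lemma zeta_eq0 (w : KK M l m) mu : cdom a w.1.1.1 ->
  zC (Kcoord a w) = muC mu <-> zeta f h g mu w = 0.
Proof.
move=> ax; have E0 := zeta_coord f_smooth h_smooth g_smooth aa mu ax; split=> [zw|z0].
  by apply: covC_eq0 => //; rewrite E0 zw subrr.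
apply/eqP; rewrite -subr_eq0 -E0 z0; apply/eqP.
by congr (_, _, _, _); apply/rowP => i; rewrite !mxE ?zero_lfunE.
Qed.

End LocalStep.

Section LocalStep.
Context {R : realType} {n : nat} {M : manifold R n}.
Context (nb : connection M) (Rt : retraction M) {l m : nat}.
Context (f : M -> R) (h : 'I_l -> M -> R) (g : 'I_m -> M -> R).
Context (f_smooth : smooth_fun f) (h_smooth : forall i, smooth_fun (h i))
  (g_smooth : forall j, smooth_fun (g j)).
Context (a : chart R n M) (aa : atlas a).
Context (ws : KK M l m) (a_ws : cdom a ws.1.1.1).
Context (zeta_ws : zeta f h g 0 ws = 0).
Context (J_inj : forall xi, Jzeta nb f h g ws xi = 0 -> xi = 0).

Local Notation E := ('rV[R]_n * 'rV[R]_l * 'rV[R]_m * 'rV[R]_m)%type.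
Local Notation zC := (zetaC f h g a).
Local Notation dzC := (dzetaC f h g a).
Local Notation JC := (JzetaC nb f h g a).
Local Notation p0 := (Kcoord a ws).
Local Notation z_coord := (zeta_coord f_smooth h_smooth g_smooth aa).

Let p0_cod : ccod a p0.1.1.1. Proof. exact: cmap_cod. Qed.

Lemma zetaC_ws : zC p0 = 0.
Proof.
have /(zeta_eq0 f_smooth h_smooth g_smooth aa 0 a_ws) -> := zeta_ws.
by congr (_, _, _, _); apply/rowP => i; rewrite !mxE.
Qed.

Lemma JC_ws d : JC p0 d = dzC p0 d.
Proof.
rewrite /JzetaC -/(zetaC _ _ _ _ _) zetaC_ws gammaC0; exact: subr0.
Qed.

(** At [ws] the Christoffel term vanishes, so the derivative of [zetaC] is [Jzeta] read in the chart
    and inherits its injectivity. *)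
Lemma dzetaC_ws_bijective : bijective (dzC p0).
Proof.
have [r [K [r0 _ c2]]] := zetaC_c2 f_smooth h_smooth g_smooth aa p0_cod.
have p00 : `|p0 - p0| < r by rewrite subrr normr0.
have [lin _ _ _ _] := c2 p0 p0 p00 p00.
apply: (@injective_linear_bijective R ('rV[R]_n * 'rV[R]_l * 'rV[R]_m * 'rV[R]_m)%type
  ('rV[R]_n * 'rV[R]_l * 'rV[R]_m * 'rV[R]_m)%type) => //.
move=> d d0; have [xi xid] := tangentC_onto aa d a_ws.
have J0 : covC a (Jzeta nb f h g ws xi) = 0.
  rewrite (Jzeta_coord nb f_smooth h_smooth g_smooth aa xi a_ws).
  by apply: etrans (congr1 (JC p0) xid) _; rewrite JC_ws d0.
have xi0 := J_inj (covC_eq0 aa a_ws J0).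
rewrite -xid xi0; congr (_, _, _, _); exact: linear0.
Qed.

(** The target [wb] and its parameter [nu] stay free, with [r] and [K] chosen before them.
    Membership of [w'] in the chart domain is part of the conclusion because [dist] is meaningful
    only there. *)
Lemma local_step : exists r K, [/\ 0 < r, 0 <= K,
  (forall w : KK M l m, cdom a w.1.1.1 -> dist a w ws < r -> bijective (Jzeta nb f h g w)) &
  forall (w wb w' : KK M l m) mu nu, cdom a w.1.1.1 -> cdom a wb.1.1.1 ->
    dist a w ws < r -> dist a wb ws < r -> zeta f h g nu wb = 0 -> `|mu - nu| <= r ->
    newton_step nb Rt f h g mu w w' ->
    cdom a w'.1.1.1 /\ dist a w' wb <= K * (dist a w wb ^+ 2 + `|mu - nu|)].
Proof.
have c2_at_F := zetaC_c2 f_smooth h_smooth g_smooth aa p0_cod.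
have [r1 [K1 [r10 K10 c2]]] := c2_at_F.
have [r2 [K2 [r20 K20 gb]]] := gammaC_bound nb aa p0_cod.
have [r3 [K3 [r30 K30 rb]]] := retrC_estimate Rt aa p0_cod.
have p00 : `|p0 - p0| < r1 by rewrite subrr normr0.
have [lin0 _ _ _ _] := c2 p0 p0 p00 p00.
have [c c0 cb] := linear_bijective_bound (@finite_dim_E R n l m) lin0 dzetaC_ws_bijective.
pose r4 := Num.min r1 (Num.min r2 r3).
have r40 : 0 < r4 by rewrite !lt_min r10 r20.
have [r41 r42 r43] : [/\ r4 <= r1, r4 <= r2 & r4 <= r3].
  by rewrite /r4 !ge_min !lexx !orbT.
(* The first block does not contain the parameter, so [Z] contains the zeros of [zeta nu] for every
   [nu]. *)
pose Z := [set q : E | (zC q).1.1.1 = 0].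
have n1 (x y : E) : `|x.1.1.1 - y.1.1.1| <= `|x - y|.
  have := fst_norm_le (x - y).1.1; have := fst_norm_le (x - y).1;
  have := fst_norm_le (x - y).
  by move=> h1 h2 h3; exact: le_trans h3 (le_trans h2 h1).
have n1' (x : E) : `|x.1.1.1| <= `|x| by have := n1 x 0; rewrite !subr0.
have e1 (x : 'rV[R]_n) : `|(x, 0, 0, 0) : E| <= `|x|.
  by apply: pair_norm_le; [apply: pair_norm_le; [apply: pair_norm_le|]|];
    rewrite /= ?normr0.
have Jlin p : `|p - p0| < r4 -> linear (JC p).
  move=> pr; have pr1 := lt_le_trans pr r41; have [lin _ _ _ _] := c2 p p pr1 pr1.
  move=> k d d'; rewrite /JzetaC lin.
  have -> : ((gammaC nb a (k *: d + d').1.1.1 (zC p).1.1.1 p.1.1.1, 0, 0, 0) : E) =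
    k *: ((gammaC nb a d.1.1.1 (zC p).1.1.1 p.1.1.1, 0, 0, 0) : E)
    + (gammaC nb a d'.1.1.1 (zC p).1.1.1 p.1.1.1, 0, 0, 0).
    by congr (_, _, _, _); rewrite /= ?scaler0 ?addr0//; exact: gammaC_linear.
  by rewrite scalerBr opprD addrACA.
(* The Christoffel bound [K2] is multiplied by the Lipschitz constant [K1] of the first block, which
   vanishes at [q]. *)
have JDF p q d : `|p - p0| < r4 -> `|q - p0| < r4 -> Z q ->
    `|JC p d - dzC p d| <= (K2 * K1) * `|p - q| * `|d|.
  move=> pr qr Zq; rewrite /JzetaC addrAC subrr add0r normrN.
  apply: le_trans (e1 _) _.
  have pr2 : `|p.1.1.1 - p0.1.1.1| < r2 by apply: le_lt_trans (n1 _ _) (lt_le_trans pr r42).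
  apply: le_trans (gb _ _ _ pr2) _.
  have [_ _ _ _ [hh _]] := c2 p q (lt_le_trans pr r41) (lt_le_trans qr r41).
  have h1 : `|(zC p).1.1.1| <= K1 * `|p - q|.
    by apply: le_trans hh; have := n1 (zC p) (zC q); rewrite Zq subr0.
  rewrite -!mulrA ler_wpM2l//.
  by rewrite mulrC mulrA; apply: ler_pM.
(* The updates of [y], [z] and [s] are exact; only the manifold component has an error. *)
have rE p v : `|p - p0| < r4 -> `|v| < r4 -> `|retrE Rt a p v - p - v| <= K3 * `|v| ^+ 2.
  move=> pr vr.
  have pr3 : `|p.1.1.1 - p0.1.1.1| < r3 by apply: le_lt_trans (n1 _ _) (lt_le_trans pr r43).
  have vr3 : `|v.1.1.1| < r3 by apply: le_lt_trans (n1' _) (lt_le_trans vr r43).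
  have [_ _ h1] := rb _ _ pr3 vr3.
  have -> : retrE Rt a p v - p - v =
      (a (retrC Rt a (p.1.1.1, v.1.1.1)) - p.1.1.1 - v.1.1.1, 0, 0, 0).
    by congr (_, _, _, _); rewrite /= addrAC addrK subrr.
  apply: le_trans (e1 _) (le_trans h1 _).
  by rewrite ler_wpM2l// lerXn2r ?nnegrE.
have Zp0 : Z p0 by exact: (congr1 (fun t : E => t.1.1.1) zetaC_ws).
have [r [K [r0 K0 inj step]]] :=
  newton_estimate c2_at_F c0 cb r40 (mulr_ge0 K20 K10) K30 Zp0 Jlin JDF rE.
exists (Num.min r r4), K; split=> //.
- by rewrite lt_min r0.
- move=> w aw; rewrite lt_min => /andP[wr wr4]; apply: Jzeta_bijective => // xi J0.
  have JC0 : JC (Kcoord a w) (tangentC a xi) = 0.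
    rewrite -(Jzeta_coord nb f_smooth h_smooth g_smooth aa xi aw) J0.
    by congr (_, _, _, _); apply/rowP => i; rewrite !mxE ?zero_lfunE.
  have := inj _ (tangentC a xi) wr; rewrite JC0 normr0 => h0.
  apply: (tangentC_eq0 aa aw); apply/eqP; rewrite -normr_le0.
  by rewrite -(ler_pM2l (divr_gt0 c0 (ltr0n _ 2))) mulr0.
move=> w wb w' mu nu aw awb w_r wb_r zb mu_r [xi [Jxi ->]].
have rr : Num.min r r4 <= r by rewrite ge_min lexx.
have rr4 : Num.min r r4 <= r4 by rewrite ge_min lexx orbT.
have wr := lt_le_trans w_r rr; have wr4 := lt_le_trans w_r rr4.
have wbr := lt_le_trans wb_r rr; have mr := le_trans mu_r rr.
have zbC : zC (Kcoord a wb) = muC nu.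
  by apply/(zeta_eq0 f_smooth h_smooth g_smooth aa nu awb).
have Zb : Z (Kcoord a wb) by exact: (congr1 (fun t : E => t.1.1.1) zbC).
(* Since [zC] takes the value [muC nu] at [wb], the Newton equation for [mu] is the one aimed at
   [wb] with residual [t]. *)
pose t : E := muC mu - muC nu.
have tn : `|t| <= `|mu - nu| by exact: muC_dist.
have JE : JC (Kcoord a w) (tangentC a xi) = zC (Kcoord a wb) - zC (Kcoord a w) + t.
  rewrite -(Jzeta_coord nb f_smooth h_smooth g_smooth aa xi aw) Jxi covCN z_coord//.
  by rewrite zbC /t opprB [RHS]addrC addrA subrK.
have [vr le] := step _ _ _ _ wr wbr Zb (le_trans tn mr) JE.
have [KE xE] := retrK_coord Rt aa xi aw.
split.
  rewrite xE.
  have pr3 : `|(Kcoord a w).1.1.1 - p0.1.1.1| < r3.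
    by apply: le_lt_trans (n1 (Kcoord a w) p0) (lt_le_trans wr4 r43).
  have vr3 : `|(tangentC a xi).1.1.1| < r3.
    by apply: le_lt_trans (n1' (tangentC a xi)) (lt_le_trans vr r43).
  by have [] := rb _ _ pr3 vr3.
rewrite /dist KE; apply: le_trans le _.
by rewrite ler_wpM2l// lerD2l.
Qed.

End LocalStep.

Lemma compact_ball_rV (R : realType) n (p : 'rV[R]_n) (s : R) : 0 < s ->
  compact [set x | `|x - p| <= s].
Proof.
move=> s0; apply: bounded_closed_compact.
  exists (`|p| + s); split; first exact: num_real.
  move=> K pK x /= xs; apply: ltW; apply: le_lt_trans pK.
  by rewrite -[x](subrK p) addrC; apply: le_trans (ler_normD _ _) _; rewrite lerD2l.
rewrite (_ : [set _ | _] = closed_ball p s); first exact: closed_ball_closed.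
by rewrite closed_ballE//; apply/seteqP; split=> x /=; rewrite /closed_ball_ /= distrC.
Qed.

Lemma compact_ball_prod (R : realType) (V W : normedModType R) (p : V * W) (s : R) :
  compact [set x | `|x - p.1| <= s] -> compact [set x | `|x - p.2| <= s] ->
  compact [set x | `|x - p| <= s].
Proof.
move=> c1 c2; have := compact_setX c1 c2; congr compact.
by apply/seteqP; split=> x /=; rewrite prod_normE ge_max => /andP.
Qed.

(** * Rates of convergence of real sequences *)

Section Sequences.
Context {R : realType}.

Lemma halving_cvg0 (e : nat -> R) : (forall k, 0 <= e k) ->
  (forall k, e k.+1 <= e k / 2) -> e @ \oo --> (0 : R).
Proof.
move=> e0 eh; have le k : e k <= geometric (e 0%N) (2^-1) k.
  elim: k => [|k IH]; first by rewrite /geometric /= expr0 mulr1.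
  apply: le_trans (eh k) _; rewrite /geometric /= exprSr mulrA ler_wpM2r//.
have := @cvg_geometric R (e 0%N) 2^-1; rewrite gtr0_norm// invf_lt1// ltr1n => /(_ isT) g0.
apply: (squeeze_cvgr _ (cvg_cst 0) g0).
by apply: nearW => k; apply/andP; split; [exact: e0|exact: le].
Qed.

Lemma quadratic_half (K e : R) : 0 <= K -> 0 <= e -> e <= 1 / (2 * (K + 1)) ->
  K * e ^+ 2 <= e / 2.
Proof.
move=> K0 e0; rewrite ler_pdivlMr; last by lra.
move=> /(ler_wpM2r e0) h1; have h2 : 0 <= e ^+ 2 by rewrite exprn_ge0.
lra.
Qed.

Lemma little_o_succ (e : nat -> R) : e @ \oo --> (0 : R) ->
  (forall k, 0 <= e k) ->
  (forall eps, 0 < eps -> exists2 d, 0 < d & forall k, e k < d -> e k.+1 <= eps * e k) ->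
  (fun k => e k.+1 : R^o) =o_\oo (fun k => e k : R^o).
Proof.
move=> ecvg e0 H; apply/eqoP => eps eps0; have [d d0 Hd] := H eps eps0.
have N : \forall k \near \oo, `|0 - e k| < d by exact: (cvgrPdist_lt _ _).1 ecvg d d0.
apply: filterS N => k.
by rewrite sub0r normrN !ger0_norm// => /Hd.
Qed.

Lemma big_O_succ (e : nat -> R) (K : R) :
  (forall k, 0 <= e k) -> (forall k, e k.+1 <= K * e k ^+ 2) ->
  (fun k => e k.+1 : R^o) =O_\oo (fun k => e k ^+ 2 : R^o).
Proof.
move=> e0 H; apply/eqO_exP; exists (`|K| + 1); first by rewrite ltr_wpDl.
apply: nearW => k; rewrite (ger0_norm (e0 _)) (ger0_norm (exprn_ge0 2 (e0 k))).
apply: le_trans (H k) _.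
rewrite ler_wpM2r ?exprn_ge0//; apply: le_trans (ler_norm _) _; by rewrite lerDl.
Qed.

End Sequences.

(** * Topology of the product space in a chart *)

Section KKTopology.
Context {R : realType} {n : nat} {M : manifold R n} {l m : nat}.
Context (a : chart R n M).

Local Notation E := ('rV[R]_n * 'rV[R]_l * 'rV[R]_m * 'rV[R]_m)%type.

Definition Kinv (p : E) : KK M l m := (cinv a p.1.1.1, p.1.1.2, p.1.2, p.2).

Lemma KcoordK (w : KK M l m) : cdom a w.1.1.1 -> Kinv (Kcoord a w) = w.
Proof. by case: w => [[[x y] z] s] /= ax; rewrite /Kinv /= cmapK. Qed.

Lemma KinvK (p : E) : ccod a p.1.1.1 -> Kcoord a (Kinv p) = p.
Proof. by case: p => [[[x y] z] s] /= ax; rewrite /Kcoord /= cinvK. Qed.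

Lemma fst3_continuous (A B C D : topologicalType) :
  continuous (fun w : A * B * C * D => w.1.1.1).
Proof.
move=> w; have c3 : (fun w : A * B * C * D => w.1) @ w --> w.1 by exact: cvg_fst.
have c2 : (fun w : A * B * C * D => w.1.1) @ w --> w.1.1.
  by apply: cvg_comp c3 _; exact: cvg_fst.
by apply: cvg_comp c2 _; exact: cvg_fst.
Qed.

Lemma pair4_continuous (A A' B C D : topologicalType) (phi : A -> A')
    (w : A * B * C * D) : {for w.1.1.1, continuous phi} ->
  {for w, continuous (fun w : A * B * C * D => (phi w.1.1.1, w.1.1.2, w.1.2, w.2))}.
Proof.
move=> cphi.
have c3 : (fun w : A * B * C * D => w.1) @ w --> w.1 by exact: cvg_fst.
have c2 : (fun w : A * B * C * D => w.1.1) @ w --> w.1.1.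
  by apply: cvg_comp c3 _; exact: cvg_fst.
have d1 : (fun w : A * B * C * D => phi w.1.1.1) @ w --> phi w.1.1.1.
  exact: cvg_comp (@fst3_continuous A B C D w) cphi.
have d2 : (fun w : A * B * C * D => w.1.1.2) @ w --> w.1.1.2.
  by apply: cvg_comp c2 _; exact: cvg_snd.
have d3 : (fun w : A * B * C * D => w.1.2) @ w --> w.1.2.
  by apply: cvg_comp c3 _; exact: cvg_snd.
have d4 : (fun w : A * B * C * D => w.2) @ w --> w.2 by exact: cvg_snd.
exact: (cvg_pair (cvg_pair (cvg_pair d1 d2) d3) d4).
Qed.

Lemma dist_near (w : KK M l m) (r : R) : cdom a w.1.1.1 -> 0 < r ->
  \forall w' \near w, cdom a w'.1.1.1 /\ dist a w' w < r.
Proof.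
move=> aw r0; apply: filterI.
  by apply: (@fst3_continuous M 'rV[R]_l 'rV[R]_m 'rV[R]_m w); exact: cdom_nbhs.
have cK : Kcoord a @ w --> Kcoord a w.
  exact: (@pair4_continuous M 'rV[R]_n 'rV[R]_l 'rV[R]_m 'rV[R]_m a w (cmap_continuous aw)).
have N : \forall w' \near w, `|Kcoord a w - Kcoord a w'| < r.
  by exact: (cvgrPdist_lt _ _).1 cK r r0.
by apply: filterS N => w'; rewrite /dist distrC.
Qed.

Lemma Kinv_continuous (p : E) : ccod a p.1.1.1 -> {for p, continuous Kinv}.
Proof.
move=> ap.
exact: (@pair4_continuous 'rV[R]_n M 'rV[R]_l 'rV[R]_m 'rV[R]_m (cinv a) p
  (cinv_continuous ap)).
Qed.

Lemma nbhs_Kinv (w : KK M l m) (N : set (KK M l m)) : cdom a w.1.1.1 -> nbhs w N ->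
  exists2 r, 0 < r & forall p, `|p - Kcoord a w| < r -> ccod a p.1.1.1 /\ N (Kinv p).
Proof.
move=> aw wN; have aw' : ccod a (Kcoord a w).1.1.1 by exact: cmap_cod.
have n1 : nbhs (Kcoord a w) [set p : E | ccod a p.1.1.1].
  apply: (@fst3_continuous 'rV[R]_n 'rV[R]_l 'rV[R]_m 'rV[R]_m).
  by apply: open_nbhs_nbhs; split=> //; exact: ccod_open.
have n2 : nbhs (Kcoord a w) [set p : E | N (Kinv p)].
  by apply: (Kinv_continuous aw'); rewrite KcoordK.
have : nbhs (Kcoord a w) ([set p : E | ccod a p.1.1.1] `&` [set p : E | N (Kinv p)]).
  exact: filterI.
move=> /nbhs_ballP[r /= r0 rb]; exists r => // p pr.
by apply: rb; rewrite -ball_normE /ball_ /= distrC.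
Qed.

Lemma dist_cvg (w : nat -> KK M l m) (wb : KK M l m) : cdom a wb.1.1.1 ->
  (forall k, cdom a (w k).1.1.1) -> (fun k => dist a (w k) wb) @ \oo --> (0 : R) ->
  w @ \oo --> wb.
Proof.
move=> awb aw d0.
have aw' : ccod a (Kcoord a wb).1.1.1 by exact: cmap_cod.
have cK : (fun k => Kcoord a (w k)) @ \oo --> Kcoord a wb.
  apply/cvgrPdist_lt => e e0.
  have N : \forall k \near \oo, `|0 - dist a (w k) wb| < e.
    by exact: (cvgrPdist_lt _ _).1 d0 e e0.
  by apply: filterS N => k; rewrite sub0r normrN /dist normr_id distrC.
rewrite (_ : w = fun k => Kinv (Kcoord a (w k))); last first.
  by apply/funext => k; rewrite KcoordK.
rewrite -(KcoordK awb).
by apply: cvg_comp cK _; exact: Kinv_continuous.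
Qed.

End KKTopology.

(** * Local convergence for fixed and for varying parameters *)

Section Convergence.
Context {R : realType} {n : nat} {M : manifold R n}.
Context (nb : connection M) (Rt : retraction M) {l m : nat}.
Context (f : M -> R) (h : 'I_l -> M -> R) (g : 'I_m -> M -> R).
Context (f_smooth : smooth_fun f) (h_smooth : forall i, smooth_fun (h i))
  (g_smooth : forall j, smooth_fun (g j)).
Context (a : chart R n M) (aa : atlas a).
Context (ws : KK M l m) (a_ws : cdom a ws.1.1.1).
Context (zeta_ws : zeta f h g 0 ws = 0).
Context (J_inj : forall xi, Jzeta nb f h g ws xi = 0 -> xi = 0).

Local Notation E := ('rV[R]_n * 'rV[R]_l * 'rV[R]_m * 'rV[R]_m)%type.

Lemma dist_ge0 (w w' : KK M l m) : 0 <= dist a w w'.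
Proof. exact: normr_ge0. Qed.

Lemma dist_triangle (w1 w2 w3 : KK M l m) : dist a w1 w3 <= dist a w1 w2 + dist a w2 w3.
Proof. exact: ler_distD. Qed.

Lemma superlinear_cvg (w : nat -> KK M l m) (wb : KK M l m) : cdom a wb.1.1.1 ->
  (forall k, cdom a (w k).1.1.1) ->
  (forall k, dist a (w k.+1) wb <= dist a (w k) wb / 2) ->
  (forall eps, 0 < eps -> exists2 d, 0 < d &
     forall k, dist a (w k) wb < d -> dist a (w k.+1) wb <= eps * dist a (w k) wb) ->
  converges_superlinearly a w wb.
Proof.
move=> awb aw half sup.
have c0 := halving_cvg0 (fun k => dist_ge0 (w k) wb) half.
split=> //; first exact: (dist_cvg awb aw c0).
exact: (little_o_succ c0 (fun k => dist_ge0 (w k) wb)).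
Qed.

Lemma quadratic_cvg (w : nat -> KK M l m) (wb : KK M l m) (K : R) : cdom a wb.1.1.1 ->
  (forall k, cdom a (w k).1.1.1) ->
  (forall k, dist a (w k.+1) wb <= dist a (w k) wb / 2) ->
  (forall k, dist a (w k.+1) wb <= K * dist a (w k) wb ^+ 2) ->
  converges_quadratically a w wb.
Proof.
move=> awb aw half quad.
have c0 := halving_cvg0 (fun k => dist_ge0 (w k) wb) half.
split=> //; first exact: (dist_cvg awb aw c0).
exact: (big_O_succ (fun k => dist_ge0 (w k) wb) quad).
Qed.

(** Converts a bound on [mu k] in terms of [zeta_norm] into one in terms of the distance to [ws]:
    [zetaC] is Lipschitz and vanishes at [ws]. *)
Lemma zeta_norm_bound : exists r L, [/\ 0 < r, 0 <= L &
  forall w : KK M l m, cdom a w.1.1.1 -> dist a w ws < r ->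
    zeta_norm f h g a 0 w <= L * dist a w ws].
Proof.
have p0_cod : ccod a (Kcoord a ws).1.1.1 by exact: cmap_cod.
have [r [L [r0 L0 c2]]] := zetaC_c2 f_smooth h_smooth g_smooth aa p0_cod.
exists r, L; split=> // w aw wr.
have z0 := zetaC_ws f_smooth h_smooth g_smooth aa a_ws zeta_ws.
have p00 : `|Kcoord a ws - Kcoord a ws| < r by rewrite subrr normr0.
have [_ _ _ _ [+ _]] := c2 (Kcoord a w) (Kcoord a ws) wr p00.
rewrite z0 subr0.
have -> : zeta_norm f h g a 0 w = `|covC a (zeta f h g 0 w)| by [].
rewrite (zeta_coord f_smooth h_smooth g_smooth aa 0 aw).
by have -> : muC 0 = 0 :> E;
  [congr (_, _, _, _); apply/rowP => i; rewrite !mxE|rewrite subr0].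
Qed.

(** The common property of [theta] and of [C * t ^+ 2] on which contraction rests. The value [t = 0]
    is included, so that [B 0 <= 0] and the parameter is zero as soon as [zeta 0] vanishes. *)
Definition superlinear_bound (B : R -> R) : Prop :=
  forall eps, 0 < eps -> exists2 d, 0 < d & forall t, 0 <= t < d -> B t <= eps * t.

(** [K] and [L] are fixed before [B] and [eps]. The choice [eps = 1/2] will keep the iterates near
    [ws], arbitrary [eps] gives the superlinear rate, and the bound with [K] gives the quadratic
    one. *)
Lemma newton_contraction : exists r K L, [/\ 0 < r, 0 <= K & 0 <= L] /\
  (forall w : KK M l m, cdom a w.1.1.1 -> dist a w ws < r ->
    bijective (Jzeta nb f h g w)) /\
  forall B, superlinear_bound B -> forall eps, 0 < eps ->
  exists d, [/\ 0 < d, d <= r &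
    forall (w w' : KK M l m) mu, cdom a w.1.1.1 -> dist a w ws < d ->
    0 <= mu <= B (zeta_norm f h g a 0 w) -> newton_step nb Rt f h g mu w w' ->
    [/\ cdom a w'.1.1.1, dist a w' ws <= eps * dist a w ws,
        dist a w' ws <= K * (dist a w ws ^+ 2 + mu) &
        zeta_norm f h g a 0 w <= L * dist a w ws]].
Proof.
have [r [K [r0 K0 Jbij step]]] :=
  local_step Rt f_smooth h_smooth g_smooth aa a_ws zeta_ws J_inj.
have [r1 [L [r10 L0 zn]]] := zeta_norm_bound.
exists r, K, L; split=> //; split=> // B sB eps eps0.
(* With this choice the parameter accounts for at most half of the target: (K + 1) mu <= eps / 2 *
   e. *)
pose e1 := eps / (2 * (K + 1) * (L + 1)).
have e10 : 0 < e1 by rewrite divr_gt0// !mulr_gt0//; lra.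
have [d1 d10 Bd1] := sB e1 e10.
(* In order: validity of [local_step] and of [zeta_norm_bound]; [zeta_norm] below [d1]; [mu] at most
   [r]; and K e^2 at most half of eps * e. *)
pose d := Num.min (Num.min r r1)
  (Num.min (d1 / (L + 1)) (Num.min (r / (eps + 1)) (eps / (2 * (K + 1))))).
have d0 : 0 < d by rewrite !lt_min r0 r10 !divr_gt0// ?mulr_gt0//; lra.
have dr : d <= r by rewrite /d !ge_min lexx.
have dr1 : d <= r1 by rewrite /d !ge_min lexx ?orbT.
have dd1 : d <= d1 / (L + 1) by rewrite /d !ge_min lexx ?orbT.
have de : d <= r / (eps + 1) by rewrite /d !ge_min lexx ?orbT.
have dK : d <= eps / (2 * (K + 1)) by rewrite /d !ge_min lexx ?orbT.
exists d; split=> // w w' mu aw wd /andP[mu0 muB] nstep.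
set e := dist a w ws in wd *; have e0 : 0 <= e by exact: dist_ge0.
have znw : zeta_norm f h g a 0 w <= L * e by apply: zn => //; exact: lt_le_trans dr1.
set z := zeta_norm f h g a 0 w in muB znw *; have z0 : 0 <= z by exact: normr_ge0.
have zd1 : z < d1.
  have h1 : e * (L + 1) < d1 by rewrite -ltr_pdivlMr; [exact: lt_le_trans dd1|lra].
  lra.
have Bz : B z <= e1 * z by apply: Bd1; rewrite z0.
have e1E : e1 * (2 * (K + 1) * (L + 1)) = eps.
  by rewrite /e1 divfK// gt_eqF// !mulr_gt0//; lra.
have muE : (K + 1) * mu <= eps / 2 * e.
  have h1 : mu <= e1 * (L * e).
    by apply: le_trans muB (le_trans Bz _); rewrite ler_wpM2l// ltW.
  have h2 : 0 <= e1 * e by rewrite mulr_ge0// ltW.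
  have h3 : mu <= e1 * (L + 1) * e by lra.
  have h4 : (K + 1) * mu <= (K + 1) * (e1 * (L + 1) * e) by rewrite ler_wpM2l//; lra.
  have h5 : (K + 1) * (e1 * (L + 1) * e) = eps / 2 * e by rewrite -e1E; field.
  by rewrite -h5.
have mur : mu <= r.
  have h1 : e * (eps + 1) < r by rewrite -ltr_pdivlMr; [exact: lt_le_trans de|lra].
  have h2 : 0 <= K * mu by rewrite mulr_ge0.
  have h3 : 0 <= eps * e by rewrite mulr_ge0// ltW.
  lra.
have mun : `|mu - 0| <= r by rewrite subr0 ger0_norm.
have ws0 : dist a ws ws < r by rewrite /dist subrr normr0.
have [aw' le] := step w ws w' mu 0 aw a_ws (lt_le_trans wd dr) ws0 zeta_ws mun nstep.
rewrite subr0 (ger0_norm mu0) -/e in le.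
split=> //.
apply: le_trans le _.
have Ke : e * (2 * (K + 1)) <= eps.
  by rewrite -ler_pdivlMr; [exact: le_trans (ltW wd) dK|lra].
have h1 : e * (2 * (K + 1)) * e <= eps * e by rewrite ler_wpM2r.
have h2 : 0 <= e ^+ 2 by rewrite exprn_ge0.
lra.
Qed.

(** The predicate [Q] lets both rates share the invariance argument; its premise collects everything
    known about a run, and each rate uses the part it needs. *)
Lemma varying_convergence (B : R -> R) (Q : (nat -> KK M l m) -> KK M l m -> Prop) :
  superlinear_bound B ->
  (forall (w : nat -> KK M l m) mu, (forall k, cdom a (w k).1.1.1) ->
     (forall k, dist a (w k.+1) ws <= dist a (w k) ws / 2) ->
     (forall k, step_bounded nb Rt f h g a B mu w k) ->
     (exists K L, [/\ 0 <= K, 0 <= L & forall k,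
        dist a (w k.+1) ws <= K * (dist a (w k) ws ^+ 2 + mu k) /\
        zeta_norm f h g a 0 (w k) <= L * dist a (w k) ws]) ->
     (forall eps, 0 < eps -> exists2 d, 0 < d &
       forall k, dist a (w k) ws < d -> dist a (w k.+1) ws <= eps * dist a (w k) ws) ->
     Q w ws) ->
  locally_convergent nb Rt f h g a B ws Q.
Proof.
move=> sB HQ; have [r [K [L [[r0 K0 L0] [Jbij contr]]]]] := newton_contraction.
have half0 : 0 < 2^-1 :> R by rewrite invr_gt0.
have [d [d0 dr cd]] := contr B sB _ half0.
apply: filterS (dist_near a_ws d0) => w0 [aw0 w0d] mu w w0E.
(* Only the steps before [k] are assumed, because well-definedness concerns finite runs that have
   yet to be continued. *)
have inv k : (forall i, (i < k)%N -> step_bounded nb Rt f h g a B mu w i) ->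
    cdom a (w k).1.1.1 /\ dist a (w k) ws < d.
  elim: k => [|k IH] H; first by rewrite w0E.
  have [|awk wkd] := IH; first by move=> i ik; apply: H; exact: ltnW.
  have [mub st] := H k (ltnSn k).
  have [aw' le _ _] := cd _ _ _ awk wkd mub st; split=> //.
  apply: le_lt_trans le _; have := dist_ge0 (w k) ws; lra.
split=> [k /inv[awk wkd]|H]; first by apply: Jbij => //; exact: lt_le_trans dr.
have invk k : cdom a (w k).1.1.1 /\ dist a (w k) ws < d by apply: inv => i _.
have stepk k := let: conj awk wkd := invk k in let: conj mub st := H k in
  cd _ _ _ awk wkd mub st.
apply: (HQ w mu) => //.
- by move=> k; have [] := invk k.
- by move=> k; have [_ + _ _] := stepk k; rewrite mulrC.
- by exists K, L; split=> // k; have [] := stepk k.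
move=> eps eps0; have [d' [d'0 _ cd']] := contr B sB eps eps0.
exists d' => // k wkd'; have [mub st] := H k.
by have [] := cd' _ _ _ (invk k).1 wkd' mub st.
Qed.

Lemma perturbed_KKT_zero (N : set (KK M l m)) : nbhs ws N ->
  exists2 mu0 : R, 0 < mu0 & forall mu : R, 0 <= mu <= mu0 ->
  exists wmu : KK M l m, [/\ N wmu, cdom a wmu.1.1.1 & zeta f h g mu wmu = 0].
Proof.
move=> wsN; have [r r0 NK] := nbhs_Kinv a_ws wsN.
have p0_cod : ccod a (Kcoord a ws).1.1.1 by exact: cmap_cod.
have c2F := zetaC_c2 f_smooth h_smooth g_smooth aa p0_cod.
have [r1 [K1 [r10 _ c2]]] := c2F.
have p00 : `|Kcoord a ws - Kcoord a ws| < r1 by rewrite subrr normr0.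
have [lin0 _ _ _ _] := c2 _ _ p00 p00.
have bij := dzetaC_ws_bijective f_smooth h_smooth g_smooth aa a_ws zeta_ws J_inj.
have [c c0 cb] := linear_bijective_bound (@finite_dim_E R n l m) lin0 bij.
have surj t : exists d, dzetaC f h g a (Kcoord a ws) d = t.
  by have [G _ GK] := bij; exists (G t).
have cpt s : 0 < s -> compact [set p : E | `|p - Kcoord a ws| <= s].
  by move=> s0; do !apply: compact_ball_prod; exact: compact_ball_rV.
have z0 := zetaC_ws f_smooth h_smooth g_smooth aa a_ws zeta_ws.
have [mu0 mu00 zero] := perturbed_zero c2F z0 c0 cb surj cpt r0.
exists mu0 => // mu /andP[mu_ge0 mule].
have [|p pr pE] := zero (muC mu).
  apply: le_trans mule; rewrite -{2}(ger0_norm mu_ge0) -[muC mu]subr0.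
  have -> : 0 = muC 0 :> E by congr (_, _, _, _); apply/rowP => i; rewrite !mxE.
  by apply: le_trans (muC_dist mu 0) _; rewrite subr0.
have [ap Np] := NK p pr.
have awmu : cdom a (Kinv a p).1.1.1 by exact: cinv_dom.
exists (Kinv a p); split=> //.
by apply/(zeta_eq0 f_smooth h_smooth g_smooth aa mu awmu); rewrite KinvK.
Qed.

(** With [nu = mu] the parameter term of [local_step] disappears and the error at the perturbed zero
    is squared at each step, which is more than superlinear convergence asks. *)
Lemma fixed_parameter (N : set (KK M l m)) : nbhs ws N ->
  exists2 mu0 : R, 0 < mu0 & forall mu : R, 0 <= mu <= mu0 ->
  exists wmu : KK M l m, [/\ N wmu, zeta f h g mu wmu = 0 &
    \forall w0 \near wmu, exists w : nat -> KK M l m,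
      [/\ w 0%N = w0,
          forall k, bijective (Jzeta nb f h g (w k)) /\
                    newton_step nb Rt f h g mu (w k) (w k.+1) &
          converges_superlinearly a w wmu]].
Proof.
move=> wsN.
have [r [K [r0 K0 Jbij step]]] :=
  local_step Rt f_smooth h_smooth g_smooth aa a_ws zeta_ws J_inj.
have [mu0 mu00 zero] := perturbed_KKT_zero (filterI wsN (dist_near a_ws r0)).
exists mu0 => // mu /zero[wmu [[Nwmu [_ wmur]] awmu zmu]].
exists wmu; split=> //; clear zero Nwmu wsN N mu00 mu0.
(* The first bound keeps the ball around [wmu] inside the one around [ws] where [local_step] holds;
   the second turns the quadratic bound into halving. *)
pose eta := Num.min (r - dist a wmu ws) (1 / (2 * (K + 1))).
have eta0 : 0 < eta by rewrite lt_min subr_gt0 wmur divr_gt0// mulr_gt0// ltr_wpDl.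
have eta1 : eta <= r - dist a wmu ws by rewrite /eta ge_min lexx.
have eta2 : eta <= 1 / (2 * (K + 1)) by rewrite /eta ge_min lexx orbT.
pose G (w : KK M l m) := cdom a w.1.1.1 /\ dist a w wmu < eta.
have Gr w : G w -> dist a w ws < r.
  move=> [_ wd]; apply: le_lt_trans (dist_triangle w wmu ws) _.
  by rewrite -ltrBrDr; exact: lt_le_trans eta1.
have Gstep w w' : G w -> newton_step nb Rt f h g mu w w' ->
    [/\ G w', dist a w' wmu <= dist a w wmu / 2 &
        dist a w' wmu <= K * dist a w wmu ^+ 2].
  move=> Gw st; have [aw wd] := Gw.
  have mm : `|mu - mu| <= r by rewrite subrr normr0 ltW.
  have [aw' le] := step w wmu w' mu mu aw awmu (Gr _ Gw) wmur zmu mm st.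
  rewrite subrr normr0 addr0 in le.
  have he := quadratic_half K0 (dist_ge0 w wmu) (le_trans (ltW wd) eta2).
  have hh := le_trans le he; split; [split; [exact: aw'|]|exact: hh|exact: le].
  apply: le_lt_trans hh (le_lt_trans _ wd).
  by rewrite ler_pdivrMr// ler_peMr ?dist_ge0// ler1n.
(* Totalised for the axiom of choice: outside [G] the value is arbitrary, and the iteration never
   leaves [G]. *)
have next w : exists w', G w -> newton_step nb Rt f h g mu w w'.
  have [Gw|nGw] := pselect (G w); last by exists w.
  have [Ji _ JK] := Jbij w Gw.1 (Gr _ Gw).
  by exists (retrK Rt (Ji (- zeta f h g mu w))) => _; exists (Ji (- zeta f h g mu w)).
have [nxt nxtP] := choice next.
apply: filterS (dist_near awmu eta0) => w0 Gw0.
pose w k := iter k nxt w0.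
have Gk k : G (w k).
  by elim: k => [|k IH]; [exact: Gw0|have [] := Gstep _ _ IH (nxtP _ IH)].
exists w; split; first by [].
  by move=> k; split; [apply: Jbij; [exact: (Gk k).1|exact: Gr]|exact: nxtP].
apply: (superlinear_cvg awmu).
- by move=> k; exact: (Gk k).1.
- by move=> k; have [] := Gstep _ _ (Gk k) (nxtP _ (Gk k)).
move=> eps eps0; exists (eps / (K + 1)); first by rewrite divr_gt0// ltr_wpDl.
move=> k wkd; have [_ _ le] := Gstep _ _ (Gk k) (nxtP _ (Gk k)).
apply: le_trans le _; rewrite expr2 mulrA; apply: ler_wpM2r; first exact: dist_ge0.
have h1 : dist a (w k) wmu * (K + 1) < eps by rewrite -ltr_pdivlMr// ltr_wpDl.
apply: le_trans (ltW h1); rewrite mulrC; apply: ler_wpM2l; first exact: dist_ge0.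
by rewrite lerDl.
Qed.

End Convergence.

Theorem theorem2 (R : realType) (n : nat) (M : manifold R n)
    (nb : connection M) (Rt : retraction M) (l m : nat)
    (f : M -> R) (h : 'I_l -> M -> R) (g : 'I_m -> M -> R)
    (f_smooth : smooth_fun f)
    (h_smooth : forall i, smooth_fun (h i))
    (g_smooth : forall j, smooth_fun (g j))
    (* the point (xs, ys, zs, ss); xs is ws.1.1.1 *)
    (ws : KK M l m)
    (ws_KKT : KKT_point f h g ws)
    (ws_LICQ : LICQ h g ws.1.1.1)
    (ws_strict : strict_complementarity g ws)
    (ws_SOSC : SOSC nb f h g ws)
    (* the chart in which norms near ws are taken *)
    (a : chart R n M) (a_atlas : atlas a) (a_ws : cdom a ws.1.1.1) :
  [/\ (* (i) *)
      bijective (Jzeta nb f h g ws),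
      (* (ii) *)
      forall N : set (KK M l m), nbhs ws N ->
        exists2 mu0 : R, 0 < mu0 &
        forall mu : R, 0 <= mu <= mu0 ->
        exists wmu : KK M l m,
          [/\ N wmu, zeta f h g mu wmu = 0 &
              \forall w0 \near wmu,
              exists w : nat -> KK M l m,
                [/\ w 0%N = w0,
                    forall k, bijective (Jzeta nb f h g (w k)) /\
                              newton_step nb Rt f h g mu (w k) (w k.+1) &
                    converges_superlinearly a w wmu]],
      (* (iii) *)
      forall theta : R -> R,
        theta 0 = 0 -> (forall t, 0 <= t -> 0 <= theta t) ->
        (fun t => theta t / t) @ 0^'+ --> (0 : R) ->
        locally_convergent nb Rt f h g a theta ws (converges_superlinearly a) &
      forall C : R,
        locally_convergent nb Rt f h g a (fun t => C * t ^+ 2) ws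
          (converges_quadratically a)].
Proof.
have J_inj := KKT_nonsingular f_smooth h_smooth g_smooth ws_KKT ws_LICQ ws_strict ws_SOSC.
have zeta_ws := KKT_zeta0 f_smooth h_smooth g_smooth ws_KKT.
split.
- exact: Jzeta_bijective.
- exact: fixed_parameter.
- move=> theta theta0 theta_ge0 theta_o; apply: varying_convergence => //.
    move=> eps eps0; have N : \forall t \near 0^'+, `|0 - theta t / t| < eps.
      by exact: (cvgrPdist_lt _ _).1 theta_o eps eps0.
    have [d /= d0 db] := N.
    (* The limit of [theta t / t] says nothing at [t = 0]; there [theta 0 = 0] is used. *)
    exists d => // t /andP[]; rewrite le_eqVlt => /orP[/eqP <- _|t0 td].
      by rewrite theta0 mulr0.
    have /db : ball_ Num.norm 0 d t by rewrite /ball_ /= sub0r normrN gtr0_norm.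
    move=> /(_ t0); rewrite sub0r normrN ger0_norm;
      last by rewrite divr_ge0 ?theta_ge0 ?ltW.
    by rewrite ltr_pdivrMr// => /ltW.
  by move=> w mu aw half _ _ sup; exact: superlinear_cvg.
move=> C; apply: varying_convergence => //.
  move=> eps eps0; exists (eps / (`|C| + 1)); first by rewrite divr_gt0// ltr_wpDl.
  move=> t /andP[t0]; rewrite ltr_pdivlMr ?ltr_wpDl// => td.
  rewrite expr2 mulrA ler_wpM2r//.
  have : C * t <= `|C| * t by rewrite ler_wpM2r// ler_norm.
  lra.
move=> w mu aw half sb [K [L [K0 L0 KL]]] _.
(* The parameter is at most |C| times the square of [zeta_norm], hence at most |C| L^2 times the
   squared distance; the absolute value covers a negative [C]. *)
apply: (@quadratic_cvg _ _ _ _ _ _ _ _ (K * (1 + `|C| * L ^+ 2))) => // k.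
have [le zn] := KL k; apply: le_trans le _.
rewrite -mulrA ler_wpM2l// mulrDl mul1r lerD2l.
have [/andP[_ mule] _] := sb k.
apply: le_trans mule _.
have z0 : 0 <= zeta_norm f h g a 0 (w k) by exact: normr_ge0.
apply: le_trans (ler_wpM2r (exprn_ge0 2 z0) (ler_norm C)) _.
rewrite -mulrA ler_wpM2l// -exprMn lerXn2r// nnegrE mulr_ge0//; exact: dist_ge0.
Qed.
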